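(* Fix $C\geq 1$. Let $\mathfrak A=\overline{\bigcup_{n\in\mathbb N}\mathfrak A_n}^{\|\cdot\|_{\mathfrak A}}$ be a unital C*-algebra, where $(\mathfrak A_n)_{n\in\mathbb N}$ is a non-decreasing sequence of unital C*-subalgebras of $\mathfrak A$. Assume that $(\mathfrak A_n,\mathsf L_n)$ is a $C$-strongly Leibniz quantum compact metric space for all $n\in\mathbb N$. Let $(\beta(j))_{j\in\mathbb N}$ be a summable sequence in $(0,\infty)$. If for all $n\in\mathbb N$: (1) $\mathsf L_{n+1}(a)\leq\mathsf L_n(a)$ for all $a\in\mathfrak A_n$, and (2) for all $a\in\mathfrak A_{n+1}$ with $\mathsf L_{n+1}(a)\leq 1$, there exists $b\in\mathfrak A_n$ with $\mathsf L_n(b)\leq 1$ such that $\|a-b\|_{\mathfrak A}<\beta(n)$, then there exists a $C$-strongly Leibniz seminorm $\mathsf L$ on $\mathfrak A$ such that $(\mathfrak A,\mathsf L)$ is a quantum compact metric space and $$\mathsf{\Lambda}^\ast_{SL_C}((\mathfrak A_n,\mathsf L_n),(\mathfrak A,\mathsf L))\leq 4\sum_{j=n}^\infty\beta(j)$$ for all $n\in\mathbb N$, and thus $\lim_{n\to\infty}\mathsf{\Lambda}^\ast_{SL_C}((\mathfrak A_n,\mathsf L_n),(\mathfrak A,\mathsf L))=0$.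
   Context: $\mathbb N=\{0,1,2,\dots\}$. Unital C*-subalgebras of $\mathfrak A$ contain $1_{\mathfrak A}$. For a unital C*-algebra $\mathfrak A$: $\mathfrak{sa}(\mathfrak A)$ is the set of self-adjoint elements, $\mathrm{GL}(\mathfrak A)$ the group of invertible elements, $\mathscr S(\mathfrak A)$ the state space. A seminorm $\mathsf L$ with domain $\mathrm{dom}(\mathsf L)$ is given the value $\infty$ outside its domain; so in (1) the inequality means: if $a\in\mathrm{dom}(\mathsf L_n)$ then $a\in\mathrm{dom}(\mathsf L_{n+1})$ and $\mathsf L_{n+1}(a)\le\mathsf L_n(a)$; and in (2) $a\in\mathrm{dom}(\mathsf L_{n+1})$, $b\in\mathrm{dom}(\mathsf L_n)$. Quantum compact metric space. Fix once and for all constants $A\geq 1$ and $B\geq 0$. A quantum compact metric space $(\mathfrak A,\mathsf L)$ is a unital C*-algebra $\mathfrak A$ with a seminorm $\mathsf L$ defined on a dense Jordan-Lie subalgebra $\mathrm{dom}(\mathsf L)$ of $\mathfrak{sa}(\mathfrak A)$ (a real subspace closed under $(ab+ba)/2$ and $(ab-ba)/(2i)$) such that: (1) $\{a\in\mathrm{dom}(\mathsf L):\mathsf L(a)=0\}=\mathbb R 1_{\mathfrak A}$; (2) the distance $\mathsf{mk}_{\mathsf L}(\varphi,\psi)=\sup\{|\varphi(a)-\psi(a)|:a\in\mathrm{dom}(\mathsf L),\ \mathsf L(a)\leq 1\}$ metrizes the weak* topology of $\mathscr S(\mathfrak A)$; (3) for all $a,b\in\mathrm{dom}(\mathsf L)$,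 $\max\{\mathsf L(\frac{ab+ba}{2}),\mathsf L(\frac{ab-ba}{2i})\}\leq A(\mathsf L(a)\|b\|_{\mathfrak A}+\|a\|_{\mathfrak A}\mathsf L(b))+B\,\mathsf L(a)\mathsf L(b)$; (4) $\{a\in\mathrm{dom}(\mathsf L):\mathsf L(a)\leq 1\}$ is closed in $\mathfrak A$. Such an $\mathsf L$ is called an L-seminorm. For $C\geq 1$, $(\mathfrak A,\mathsf L)$ (or $\mathsf L$) is $C$-strongly Leibniz if for all $a\in\mathrm{dom}(\mathsf L)\cap\mathrm{GL}(\mathfrak A)$ one has $a^{-1}\in\mathrm{dom}(\mathsf L)$ and $\mathsf L(a^{-1})\leq C\|a^{-1}\|_{\mathfrak A}^2\mathsf L(a)$. $\mathcal{SL}_C$ is the class of all $C$-strongly Leibniz quantum compact metric spaces. A quantum isometry $\pi:(\mathfrak A,\mathsf L_{\mathfrak A})\to(\mathfrak B,\mathsf L_{\mathfrak B})$ is a surjective *-morphism $\pi:\mathfrak A\to\mathfrak B$ with $\pi(\mathrm{dom}(\mathsf L_{\mathfrak A}))\subseteq\mathrm{dom}(\mathsf L_{\mathfrak B})$ and $\mathsf L_{\mathfrak B}(b)=\inf\{\mathsf L_{\mathfrak A}(a):a\in\mathrm{dom}(\mathsf L_{\mathfrak A}),\pi(a)=b\}$ for all $b\in\mathrm{dom}(\mathsf L_{\mathfrak B})$. A tunnel $\tau=(\mathfrak D,\mathsf L_{\mathfrak D},\pi_1,\pi_2)$ from $(\mathfrak A_1,\mathsf L_1)$ to $(\mathfrak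 A_2,\mathsf L_2)$ is a quantum compact metric space $(\mathfrak D,\mathsf L_{\mathfrak D})$ with quantum isometries $\pi_j:(\mathfrak D,\mathsf L_{\mathfrak D})\to(\mathfrak A_j,\mathsf L_j)$, $j=1,2$. Its extent is $\chi(\tau)=\max_{j\in\{1,2\}}\mathsf{Haus}_{\mathsf{mk}_{\mathsf L_{\mathfrak D}}}(\mathscr S(\mathfrak D),\{\varphi\circ\pi_j:\varphi\in\mathscr S(\mathfrak A_j)\})$, where $\mathsf{Haus}$ is the Hausdorff distance. For $(\mathfrak A_1,\mathsf L_1),(\mathfrak A_2,\mathsf L_2)\in\mathcal{SL}_C$, $\mathsf{\Lambda}^\ast_{SL_C}((\mathfrak A_1,\mathsf L_1),(\mathfrak A_2,\mathsf L_2))$ is the infimum of $\chi(\tau)$ over all tunnels $\tau=(\mathfrak D,\mathsf L_{\mathfrak D},\pi_1,\pi_2)$ from $(\mathfrak A_1,\mathsf L_1)$ to $(\mathfrak A_2,\mathsf L_2)$ with $(\mathfrak D,\mathsf L_{\mathfrak D})\in\mathcal{SL}_C$. *)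

(* Defs.v *)
From HB Require Import structures.
From mathcomp Require Import all_boot all_order all_algebra.
From mathcomp Require Import complex.
From mathcomp Require Import all_classical all_reals all_analysis.

Set Implicit Arguments.
Unset Strict Implicit.
Unset Printing Implicit Defensive.

Import Order.TTheory GRing.Theory Num.Theory.
Import numFieldNormedType.Exports.

Local Open Scope classical_set_scope.
Local Open Scope complex_scope.
Local Open Scope ring_scope.

(* The norm is a real-valued field [cnorm] rather than the [R[i]]-valued norm
   of [normedModType R[i]]: HB rejects a new structure joining [algType] and
   [normedModType], as the ring and norm hierarchies already meet at
   [numDomainType]. The library norm `|x| = (cnorm x)%:C and its topology are recovered by an
   instance below. Since [algType] requires [1 != 0], the zero algebra is
   excluded. *)
HB.mixin Record isNormedAlgebra (R : realType) A of GRing.Algebra R[i] A := {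
  cnorm : A -> R ;
  cnormD : forall x y, cnorm (x + y) <= cnorm x + cnorm y ;
  cnormZ : forall (z : R[i]) x, (cnorm (z *: x))%:C = `|z| * (cnorm x)%:C ;
  cnorm_eq0 : forall x, cnorm x = 0 -> x = 0 ;
  cnormM : forall x y, cnorm (x * y) <= cnorm x * cnorm y
}.

#[short(type="normedAlgType")]
HB.structure Definition NormedAlgebra (R : realType) :=
  {A of isNormedAlgebra R A & GRing.Algebra R[i] A}.

Section NormedAlgebraTopology.
Variables (R : realType) (A : normedAlgType R).
Implicit Types x y : A.

Let nrm x : R[i] := (cnorm x)%:C.

Let nrmD x y : nrm (x + y) <= nrm x + nrm y.
Proof. by rewrite /nrm -rmorphD /= lecR cnormD. Qed.

Let nrmZ (z : R[i]) x : nrm (z *: x) = `|z| * nrm x.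
Proof. exact: cnormZ. Qed.

Let nrm_eq0 x : nrm x = 0 -> x = 0.
Proof. by move=> /(congr1 (@complex.Re R)) /cnorm_eq0. Qed.

#[non_forgetful_inheritance]
HB.instance Definition _ := Lmodule_isNormed.Build R[i] A nrmD nrmZ nrm_eq0.

End NormedAlgebraTopology.

Definition complete_norm (R : realType) (A : normedAlgType R) : Prop :=
  forall F : set_system A, ProperFilter F -> cauchy F -> cvg F.

HB.mixin Record isCstarAlgebra (R : realType) A of NormedAlgebra R A := {
  star : A -> A ;
  starK : involutive star ;
  starD : {morph star : x y / x + y} ;
  starZ : forall (z : R[i]) (x : A), star (z *: x) = z^*%C *: star x ;
  starM : forall x y : A, star (x * y) = star y * star x ;
  cstar_identity : forall x : A, cnorm (star x * x) = cnorm x ^+ 2 ;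
  cnorm_complete : complete_norm A
}.

#[short(type="cstarAlgType")]
HB.structure Definition CstarAlgebra (R : realType) :=
  {A of isCstarAlgebra R A & NormedAlgebra R A}.

#[non_forgetful_inheritance]
HB.instance Definition _ (R : realType) (A : cstarAlgType R) :=
  NormedModule.copy A (NormedAlgebra.sort A).
#[non_forgetful_inheritance]
HB.instance Definition _ (R : realType) (A : cstarAlgType R) :=
  Uniform_isComplete.Build A (@cnorm_complete R A).

Section SelfAdjoint.
Variables (R : realType) (A : cstarAlgType R).
Implicit Types a b : A.

Definition self_adjoint : set A := [set a | star a = a].

Definition jordan a b : A := (2 : R[i])^-1 *: (a * b + b * a).

Definition lie a b : A := (2 * 'i%C : R[i])^-1 *: (a * b - b * a).

Definition jordan_lie_subalgebra (S : set A) : Prop :=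
  [/\ S `<=` self_adjoint,
      S 0,
      forall a b, S a -> S b -> S (a + b),
      forall (t : R) a, S a -> S (t%:C *: a)
    & forall a b, S a -> S b -> S (jordan a b) /\ S (lie a b)].

End SelfAdjoint.

Record cstarSubalg (R : realType) (A : cstarAlgType R) := CstarSubalg {
  subalg_set :> set A ;
  subalg1 : subalg_set 1 ;
  subalg_lin : forall (z : R[i]) (x y : A),
    subalg_set x -> subalg_set y -> subalg_set (z *: x + y) ;
  subalgM : forall x y : A,
    subalg_set x -> subalg_set y -> subalg_set (x * y) ;
  subalg_star : forall x : A, subalg_set x -> subalg_set (star x) ;
  subalg_top_closed : closed subalg_set
}.

(* An alias of the sigma-type, so that the topology comes from the norm and not
   from the library instances on [set_type]. *)
Definition subalg_type (R : realType) (A : cstarAlgType R)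
  (S : cstarSubalg A) : Type := {x : A | x \in (S : set A)}.

Section SubalgType.
Variables (R : realType) (A : cstarAlgType R) (S : cstarSubalg A).
Local Notation T := (subalg_type S).
Local Notation P := (fun x : A => x \in (S : set A)).

HB.instance Definition _ := SubType.on T.
HB.instance Definition _ := [Choice of T by <:].

Let P_closed : GRing.subsemialg_closed P.
Proof.
apply: GRing.subalg_closed_semi; split.
- by rewrite unfold_in inE; exact: subalg1.
- by move=> z x y; rewrite !unfold_in !inE; exact: subalg_lin.
- by move=> x y; rewrite !unfold_in !inE; exact: subalgM.
Qed.

HB.instance Definition _ :=
  GRing.SubChoice_isSubAlgebra.Build R[i] A P T P_closed.

Definition sub_norm (x : T) : R := cnorm (val x).

Let sub_normD x y : sub_norm (x + y) <= sub_norm x + sub_norm y.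
Proof. by rewrite /sub_norm raddfD cnormD. Qed.

Let sub_normZ (z : R[i]) x : (sub_norm (z *: x))%:C = `|z| * (sub_norm x)%:C.
Proof. by rewrite /sub_norm linearZ cnormZ. Qed.

Let sub_norm_eq0 x : sub_norm x = 0 -> x = 0.
Proof. by move=> /cnorm_eq0 x0; apply: val_inj; rewrite x0 raddf0. Qed.

Let sub_normM x y : sub_norm (x * y) <= sub_norm x * sub_norm y.
Proof. by rewrite /sub_norm rmorphM cnormM. Qed.

HB.instance Definition _ := isNormedAlgebra.Build R T
  sub_normD sub_normZ sub_norm_eq0 sub_normM.

Let star_in (x : T) : star (val x) \in (S : set A).
Proof. by rewrite inE; apply: subalg_star; move: (valP x); rewrite inE. Qed.

Definition sub_star (x : T) : T := Sub (star (val x)) (star_in x).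

Let val_star x : val (sub_star x) = star (val x).
Proof. by []. Qed.

Let sub_starK : involutive sub_star.
Proof. by move=> x; apply: val_inj; rewrite !val_star starK. Qed.

Let sub_starD : {morph sub_star : x y / x + y}.
Proof. by move=> x y; apply: val_inj; rewrite !(val_star, raddfD) /= starD. Qed.

Let sub_starZ (z : R[i]) (x : T) : sub_star (z *: x) = z^*%C *: sub_star x.
Proof. by apply: val_inj; rewrite !(val_star, linearZ) /= starZ. Qed.

Let sub_starM (x y : T) : sub_star (x * y) = sub_star y * sub_star x.
Proof. by apply: val_inj; rewrite !(val_star, rmorphM) /= starM. Qed.

Let sub_identity (x : T) : cnorm (sub_star x * x) = cnorm x ^+ 2.
Proof.
rewrite -[LHS]/(cnorm (val (sub_star x * x))) rmorphM.
exact: cstar_identity.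
Qed.

Let U : normedAlgType R := T.

Let ball_val (x y : U) (e : R[i]) : ball x e y = ball (val x) e (val y).
Proof.
rewrite -!ball_normE /ball_ /=.
rewrite -[`|x - y|]/((cnorm (val (x - y)))%:C) raddfB.
by [].
Qed.

Let sub_complete : complete_norm U.
Proof.
move=> F FF /cauchy_ballP Fc.
pose G : set_system A := (val : U -> A) @ F.
have Gc : cauchy G.
  apply/cauchy_ballP => e e0; have := Fc e e0.
  move=> [[B C] /= [FB FC] BC].
  exists ((val : U -> A) @` B, (val : U -> A) @` C) => /=.
    split; [apply: filterS FB | apply: filterS FC] => x ? /=; by exists x.
  move=> [_ _] /= [[x Bx <-] [y Cy <-]].
  by have := BC (x, y) (conj Bx Cy); rewrite /= ball_val.
have [l Gl] : exists l : A, G --> l by apply/cvg_ex; exact: cauchy_cvg.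
have Sl : l \in (S : set A).
  rewrite inE; apply: (@subalg_top_closed _ _ S) => B lB.
  have FB : F ((val : U -> A) @^-1` B) := Gl _ lB.
  have [x Bx] := filter_ex FB.
  by exists (val x); split => //; move: (valP x); rewrite inE.
apply/(@cvg_ex U); exists (Sub l Sl : U); apply/cvg_ballP => e e0.
have GB : G (ball l e) by move/cvg_ballP: Gl => /(_ e e0).
have FB : F ((val : U -> A) @^-1` ball l e) := GB.
by apply: filterS FB => x /=; rewrite ball_val.
Qed.

HB.instance Definition _ := isCstarAlgebra.Build R T
  sub_starK sub_starD sub_starZ sub_starM sub_identity sub_complete.

End SubalgType.

Section States.
Variables (R : realType) (A : cstarAlgType R).

Record state := State {
  state_fun :> {linear A -> R[i]^o} ;
  state_ge0 : forall a : A, 0 <= (state_fun (star a * a) : R[i]) ;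
  state1 : state_fun 1 = 1 :> R[i]
}.

HB.instance Definition _ := gen_eqMixin state.
HB.instance Definition _ := gen_choiceMixin state.

(* The weak-star topology is the trace on states of the topology of pointwise
   convergence. *)
Definition weak_star_state : topologicalType :=
  initial_topology (fun phi : state => (phi : A -> R[i]) : {ptws A -> R[i]^o}).

End States.

Definition metrizes (R : realType) (T : topologicalType)
    (d : T -> T -> \bar R) : Prop :=
  [/\ forall x y, 0 <= d x y < +oo,
      forall x y, d x y = 0 <-> x = y,
      forall x y, d x y = d y x,
      forall x y z, d x z <= d x y + d y z
    & forall (x : T) (U : set T),
        nbhs x U <->
          exists2 e : R, (0 < e)%R & [set y | d x y < e%:E] `<=` U]%E.

Definition hausdorff_dist (R : realType) (T : Type) (d : T -> T -> \bar R)
    (X Y : set T) : \bar R :=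
  maxe (ereal_sup [set ereal_inf [set d x y | y in Y] | x in X])
       (ereal_sup [set ereal_inf [set d x y | x in X] | y in Y]).

Section Lip.
Variables (R : realType) (A : cstarAlgType R).
Implicit Types (L : A -> \bar R) (a b : A).

(* A seminorm defined on a subspace is extended by [+oo] outside of it. *)
Definition dom L : set A := [set a | L a < +oo]%E.

Definition mk L (phi psi : state A) : \bar R :=
  ereal_sup [set (Normc.normc (phi a - psi a))%:E | a in [set a | L a <= 1]%E].

Definition seminorm_on_dom L : Prop :=
  [/\ forall a, (0 <= L a)%E,
      forall a b, dom L a -> dom L b -> (L (a + b)%R <= L a + L b)%E
    & forall (t : R) a, dom L a -> (L (t%:C *: a)%R = `|t|%:E * L a)%E].

(* [A0] and [B0] are the constants of the quasi-Leibniz inequality. The pair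
   [(A, L)] is a quantum compact metric space iff [Lseminorm A0 B0 L]. *)
Record Lseminorm (A0 B0 : R) L : Prop := {
  Lip_seminorm : seminorm_on_dom L ;
  Lip_jordan_lie : jordan_lie_subalgebra (dom L) ;
  Lip_dense : @self_adjoint R A `<=` closure (dom L) ;
  Lip_ker : [set a | L a = 0%E] = [set t%:C *: 1 | t in [set: R]] ;
  Lip_mk : @metrizes R (weak_star_state A) (mk L) ;
  Lip_leibniz : forall a b, dom L a -> dom L b ->
    (maxe (L (jordan a b)) (L (lie a b)) <=
     A0%:E * (L a * (cnorm b)%:E + (cnorm a)%:E * L b) + B0%:E * (L a * L b))%E ;
  Lip_closed : closed [set a | L a <= 1]%E
}.

(* [b] is the inverse of [a]; [cstarAlgType] carries no inverse operation. *)
Definition strongly_leibniz (C : R) L : Prop :=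
  forall a b, dom L a -> a * b = 1 -> b * a = 1 ->
    dom L b /\ (L b <= (C * cnorm b ^+ 2)%R%:E * L a)%E.

End Lip.

Section Tunnels.
Variable R : realType.

Definition quantum_isometry (D A : cstarAlgType R) (LD : D -> \bar R)
    (LA : A -> \bar R) (pi : {lrmorphism D -> A}) : Prop :=
  [/\ forall d, pi (star d) = star (pi d),
      forall a, exists d, pi d = a,
      forall d, dom LD d -> dom LA (pi d)
    & forall a, dom LA a ->
        LA a = ereal_inf [set LD d | d in [set d | dom LD d /\ pi d = a]]].

(* [{lrmorphism _ -> _}] includes preservation of the unit, which is automatic
   for a surjective morphism. *)
Record tunnel (A0 B0 : R) (A1 A2 : cstarAlgType R)
    (L1 : A1 -> \bar R) (L2 : A2 -> \bar R) := Tunnel {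
  tunnel_alg : cstarAlgType R ;
  tunnel_lip : tunnel_alg -> \bar R ;
  tunnel_left : {lrmorphism tunnel_alg -> A1} ;
  tunnel_right : {lrmorphism tunnel_alg -> A2} ;
  tunnel_qcms : Lseminorm A0 B0 tunnel_lip ;
  tunnel_left_isometry : quantum_isometry tunnel_lip L1 tunnel_left ;
  tunnel_right_isometry : quantum_isometry tunnel_lip L2 tunnel_right
}.

Definition pullback_states (D A : cstarAlgType R) (pi : D -> A) :
    set (state D) :=
  [set psi | exists phi : state A, psi = phi \o pi :> (D -> R[i])].

Definition extent (A0 B0 : R) (A1 A2 : cstarAlgType R) (L1 : A1 -> \bar R)
    (L2 : A2 -> \bar R) (tau : tunnel A0 B0 L1 L2) : \bar R :=
  let haus X := hausdorff_dist (mk (@tunnel_lip _ _ _ _ _ _ tau)) setT X in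
  maxe (haus (pullback_states (tunnel_left tau)))
       (haus (pullback_states (tunnel_right tau))).

Definition propinquity_SL (A0 B0 C : R) (A1 A2 : cstarAlgType R)
    (L1 : A1 -> \bar R) (L2 : A2 -> \bar R) : \bar R :=
  (* not written as an image of a [set] of tunnels: [tunnel] is too large to be
     the carrier of a [set] *)
  ereal_inf [set x | exists tau : tunnel A0 B0 L1 L2,
    strongly_leibniz C (@tunnel_lip _ _ _ _ _ _ tau) /\ x = extent tau].

End Tunnels.

(* Main.v *)
From HB Require Import structures.
Require Import Defs.
From mathcomp Require Import all_boot all_order all_algebra.
From mathcomp Require Import ring lra complex.
From mathcomp Require Import all_classical all_reals all_analysis.

Set Implicit Arguments.
Unset Strict Implicit.
Unset Printing Implicit Defensive.

Import Order.TTheory GRing.Theory Num.Theory.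
Import numFieldNormedType.Exports.

Local Open Scope classical_set_scope.
Local Open Scope complex_scope.
Local Open Scope ring_scope.

                                              

(** The limit seminorm can be written down directly. Let sigma(n) be the sum of beta(j) over j >= n.
    Call [a] approximable at level n with constant K if some x in A_n satisfies L_n(x) <= K and lies
    within K sigma(n) of [a]; then L(a), here [limit_lip], is the infimum of the K > 0 for which [a]
    is approximable at every level. Since sigma(n) = beta(n) + sigma(n+1), hypothesis (2), rescaled,
    turns approximability at level n+1 into approximability at level n with the same K
    ([approximable_pred]). Hence only arbitrarily late levels have to be examined ([limit_lip_le]),
    and there sigma is as small as desired.

    The properties of an L-seminorm pass from the L_n to L in this way, the error being absorbed by
    the term K sigma(n) ([limit_lip_axioms]). Hypothesis (1) makes an element of A_n its own
    approximant at all later levels, so L <= L_n on A_n ([limit_lip_val]); this gives density of the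
    domain. For the strong Leibniz property, an approximant x of an invertible [a] is itself
    invertible by a Neumann series ([nearby_inverse]), its inverse stays in A_n by spectral
    permanence ([sub_inverse]), and it approximates the inverse of [a].

    For the distance, the direct sum of A_n and A carries the seminorm max(L_n(x), L(y), ||x - y|| /
    sigma(n)), called [bridge_lip]. It is again a C-strongly Leibniz L-seminorm. Both projections
    are quantum isometries: an element of A_n lifts diagonally, an element of A lifts by
    approximability. A state of the sum is within sigma(n) of one coming from A_n, and within 2
    sigma(n) of one coming from A, obtained by extending a state of A_n to A. So the extent is at
    most 2 sigma(n), within the required 4 sigma(n).

    That the Monge-Kantorovich distance metrizes the weak* topology is handled through one
    equivalent condition, [mk_weak_continuous]: weak* closeness to a given state forces uniform
    closeness on the unit Lipschitz ball. The C*-algebra theory used on the way (square roots,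
    positivity of [star a * a], Hahn-Banach extension of states) is built from the norm alone,
    without spectral theory. *)

(** * Noncommutative polynomial identities by reflection *)

Inductive ncterm (K : Type) :=
  | NCvar of nat | NCzero | NCone
  | NCadd of ncterm K & ncterm K
  | NCopp of ncterm K
  | NCmul of ncterm K & ncterm K
  | NCscale of K & ncterm K.
Arguments NCvar {K}.
Arguments NCzero {K}.
Arguments NCone {K}.

Section NoncommutativeNormalForm.
Variables (R : realType) (B : algType R[i]).
Local Notation K := R[i].
Implicit Types (e : nat -> B) (t : ncterm K) (l : seq (K * seq nat)).

Fixpoint nceval e t : B :=
  match t with
  | NCvar n => e n
  | NCzero => 0
  | NCone => 1
  | NCadd a b => nceval e a + nceval e b
  | NCopp a => - nceval e a
  | NCmul a b => nceval e a * nceval e b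
  | NCscale c a => c *: nceval e a
  end.

Definition ncsum e l : B := \sum_(p <- l) p.1 *: \prod_(i <- p.2) e i.

(** Words are compared through [Nat.eqb], so that the explicit reduction list of [nc_expand]
    evaluates the comparison completely. *)
Fixpoint nceqw (v w : seq nat) : bool :=
  match v, w with
  | [::], [::] => true
  | m :: v', n :: w' => if Nat.eqb m n then nceqw v' w' else false
  | _, _ => false
  end.

Lemma nceqwP v w : nceqw v w -> v = w.
Proof.
elim: v w => [|m v IH] [|n w] //=.
by case: PeanoNat.Nat.eqb_spec => // -> /IH ->.
Qed.

Fixpoint ncadd (c : K) (w : seq nat) l :=
  if l is p :: l' then
    if nceqw w p.2 then (c + p.1, w) :: l' else p :: ncadd c w l'
  else [:: (c, w)].

Definition ncmul l1 l2 :=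
  [seq (p.1 * q.1, p.2 ++ q.2) | p <- l1, q <- l2].

Fixpoint ncnorm t : seq (K * seq nat) :=
  match t with
  | NCvar n => [:: (1, [:: n])]
  | NCzero => [::]
  | NCone => [:: (1, [::])]
  | NCadd a b => ncnorm a ++ ncnorm b
  | NCopp a => [seq (- p.1, p.2) | p <- ncnorm a]
  | NCmul a b => ncmul (ncnorm a) (ncnorm b)
  | NCscale c a => [seq (c * p.1, p.2) | p <- ncnorm a]
  end.

Definition nccollect l := foldr (fun p r => ncadd p.1 p.2 r) [::] l.

Fixpoint nczero l : Prop := if l is p :: l' then p.1 = 0 /\ nczero l' else True.

Lemma ncsum_add e c w l :
  ncsum e (ncadd c w l) = c *: (\prod_(i <- w) e i) + ncsum e l.
Proof.
elim: l => [|[d v] l IH] /=; first by rewrite /ncsum !big_cons big_nil.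
case: ifP => [/nceqwP <-|_]; rewrite /ncsum !big_cons -/(ncsum e _) /=.
  by rewrite scalerDl addrA.
by rewrite IH addrCA.
Qed.

Lemma ncsum_collect e l : ncsum e (nccollect l) = ncsum e l.
Proof.
by elim: l => [//|p l IH]; rewrite /= ncsum_add IH /ncsum big_cons.
Qed.

Lemma nceval_norm e t : nceval e t = ncsum e (ncnorm t).
Proof.
rewrite /ncsum; elim: t => [n|||a IHa b IHb|a IHa|a IHa b IHb|c a IHa] /=.
- by rewrite !big_seq1 scale1r.
- by rewrite big_nil.
- by rewrite big_seq1 big_nil scale1r.
- by rewrite big_cat IHa IHb.
- rewrite big_map IHa -sumrN; apply: eq_bigr => p _; by rewrite scaleNr.
- rewrite IHa IHb /ncmul big_allpairs_dep mulr_suml; apply: eq_bigr => p _.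
  rewrite mulr_sumr; apply: eq_bigr => q _ /=.
  by rewrite big_cat -scalerAl -scalerAr scalerA.
- rewrite big_map IHa scaler_sumr; apply: eq_bigr => p _ /=.
  by rewrite scalerA.
Qed.

Lemma nczero_sum e l : nczero l -> ncsum e l = 0.
Proof.
elim: l => [|p l IH] /=; first by rewrite /ncsum big_nil.
by move=> [p0 /IH]; rewrite /ncsum big_cons p0 scale0r add0r.
Qed.

(** Soundness of the procedure: an equation between polynomials in noncommuting variables reduces to
    the vanishing of the collected coefficient of each word in the difference, which is a
    commutative problem over [R[i]]. *)
Lemma nceq e t1 t2 : nczero (nccollect (ncnorm (NCadd t1 (NCopp t2)))) ->
  nceval e t1 = nceval e t2.
Proof.
move=> /(nczero_sum e); rewrite ncsum_collect -nceval_norm /=.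
by move/eqP; rewrite subr_eq0 => /eqP.
Qed.

End NoncommutativeNormalForm.

Ltac nc_mem x l :=
  lazymatch l with
  | nil => constr:(false)
  | ?y :: ?l' => lazymatch x with y => constr:(true) | _ => nc_mem x l' end
  end.
Ltac nc_index x l :=
  lazymatch l with
  | ?y :: ?l' =>
    lazymatch x with
    | y => constr:(0%N)
    | _ => let n := nc_index x l' in constr:(S n)
    end
  end.
Ltac nc_atoms x l :=
  lazymatch x with
  | @Algebra.add _ ?a ?b => let l := nc_atoms a l in nc_atoms b l
  | @Algebra.opp _ ?a => nc_atoms a l
  | @GRing.mul _ ?a ?b => let l := nc_atoms a l in nc_atoms b l
  | @GRing.scale _ _ _ ?a => nc_atoms a l
  | @Algebra.zero _ => l
  | @GRing.one _ => l
  | _ => lazymatch nc_mem x l with true => l | false => constr:(x :: l) end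
  end.
Ltac nc_reify K x l :=
  lazymatch x with
  | @Algebra.add _ ?a ?b => let a := nc_reify K a l in let b := nc_reify K b l in
      constr:(@NCadd K a b)
  | @Algebra.opp _ ?a => let a := nc_reify K a l in constr:(@NCopp K a)
  | @GRing.mul _ ?a ?b => let a := nc_reify K a l in let b := nc_reify K b l in
      constr:(@NCmul K a b)
  | @GRing.scale _ _ ?c ?a => let a := nc_reify K a l in
      constr:(@NCscale K c a)
  | @Algebra.zero _ => constr:(@NCzero K)
  | @GRing.one _ => constr:(@NCone K)
  | _ => let n := nc_index x l in constr:(@NCvar K n)
  end.

                                                                                
                                          
(** Leaves one scalar equation per word. It is called without [nc_ring] when coefficients contain
    ['i%C], whose square must be rewritten before a commutative tactic can conclude. *)
Ltac nc_expand R B :=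
  lazymatch goal with
  | |- @eq ?T ?x ?y =>
    let l := nc_atoms x (@nil T) in
    let l := nc_atoms y l in
    let tx := nc_reify (R[i])%type x l in
    let ty := nc_reify (R[i])%type y l in
    refine (@nceq R B (fun n : nat => nth (0 : B) l n) tx ty _);
    cbv [ncnorm nccollect ncmul ncadd nczero nceqw Nat.eqb foldr map
         allpairs_dep cat flatten fst snd]
  end.

Ltac nc_ring R B :=
  nc_expand R B;
  repeat (lazymatch goal with |- _ /\ _ => split | |- True => exact I end);
  try first [by ring | by field].

              

(** * The real-valued norm and convergence of sequences *)

Section Norm.
Variables (R : realType) (A : normedAlgType R).
Implicit Types x y : A.

Lemma cnormZr (t : R) x : cnorm (t%:C *: x) = `|t| * cnorm x.
Proof.
have /(congr1 (@complex.Re R)) /= := cnormZ t%:C x.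
by rewrite expr0n addr0 sqrtr_sqr !mul0r subr0.
Qed.

Lemma cnorm0 : cnorm (0 : A) = 0.
Proof. by rewrite -(scale0r (0 : A)) -(rmorph0 (real_complex R)) cnormZr normr0 mul0r. Qed.

Lemma cnormN x : cnorm (- x) = cnorm x.
Proof.
have -> : - x = (- 1 : R)%:C *: x by rewrite rmorphN1 scaleN1r.
by rewrite cnormZr normrN1 mul1r.
Qed.

Lemma cnorm_distC x y : cnorm (x - y) = cnorm (y - x).
Proof. by rewrite -cnormN opprB. Qed.

Lemma cnorm_ge0 x : 0 <= cnorm x.
Proof.
have := cnormD x (- x); rewrite subrr cnorm0 cnormN; lra.
Qed.

Lemma cnormB x y : cnorm (x - y) <= cnorm x + cnorm y.
Proof. by rewrite -(cnormN y) cnormD. Qed.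

Lemma cnorm_triangle z x y : cnorm (x - y) <= cnorm (x - z) + cnorm (z - y).
Proof. by have := cnormD (x - z) (z - y); rewrite addrA subrK. Qed.

Lemma cnorm_small_eq0 (K : R) x :
  (forall e, 0 < e -> cnorm x <= K * e) -> x = 0.
Proof.
move=> h; apply: cnorm_eq0; apply/eqP; rewrite eq_le cnorm_ge0 andbT.
apply/ler_addgt0Pr => e e0; rewrite add0r.
have K1 : 0 < `|K| + 1 by rewrite ltr_pwDr.
apply: le_trans (h _ (divr_gt0 e0 K1)) _.
rewrite mulrCA ger_pMr// ler_pdivrMr// mul1r; have := ler_norm K; lra.
Qed.

(** Convergence with real tolerances, to avoid the [R[i]]-valued radii of the ambient topology. *)
Definition cconv (u : nat -> A) (l : A) :=
  forall e : R, 0 < e -> exists N, forall n, (N <= n)%N -> cnorm (u n - l) < e.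

Lemma cauchy_cconv (u : nat -> A) : complete_norm A ->
  (forall e : R, 0 < e ->
     exists N, forall n m, (N <= n)%N -> (N <= m)%N -> cnorm (u n - u m) < e) ->
  exists l, cconv u l.
Proof.
move=> cA uc.
have : cvg (u @ \oo).
  apply: cA; apply/cauchy_ballP => e e0.
  have eE : e = (complex.Re e)%:C by rewrite RRe_real// gtr0_real.
  have e1 : 0 < complex.Re e by rewrite -ltcR -eE.
  have [N hN] := uc _ e1.
  exists (u @` [set n | (N <= n)%N], u @` [set n | (N <= n)%N]) => /=.
    by split; exists N => // n /= Nn; exists n.
  move=> [_ _] [[n /= Nn <-] [m /= Nm <-]] /=.
  rewrite -ball_normE /ball_ /= eE ltcR; exact: hN.
move=> /cvg_ex [l ul]; exists l => e e0.
have e1 : 0 < e%:C by rewrite ltcR.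
move/cvg_ballP : ul => /(_ _ e1) [N _ hN]; exists N => n Nn.
have := hN n Nn; rewrite -ball_normE /ball_ /= ltcR.
by rewrite -/(cnorm _) cnorm_distC.
Qed.

End Norm.

                                        

Section CauchyDominated.
Variables (R : realType) (A : cstarAlgType R).
Implicit Types x y z : A.

(** The majorant [t] is nondecreasing and bounded, hence convergent, and its increments control
    those of [u], which is therefore Cauchy. *)
Lemma cconv_dominated (u : nat -> A) (t : nat -> R) (M : R) :
  (forall n, cnorm (u n.+1 - u n) <= t n.+1 - t n) -> (forall n, t n <= M) ->
  exists l, cconv u l.
Proof.
move=> ut tM; apply: (cauchy_cconv (@cnorm_complete R A)) => e e0.
have tnd : {homo t : n m / (n <= m)%N >-> n <= m}.
  apply/nondecreasing_seqP => n; have := ut n.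
  have := cnorm_ge0 (u n.+1 - u n); lra.
have ct : cvgn t.
  by apply: nondecreasing_is_cvgn => //; exists M => _ [n _ <-]; exact: tM.
have [N _ hN] : \forall n \near \oo, `|limn t - t n| < e.
  by move/cvgrPdist_lt: ct => /(_ _ e0).
have tl n : t n <= limn t by exact: nondecreasing_cvgn_le.
have um n k : cnorm (u (n + k)%N - u n) <= t (n + k)%N - t n.
  elim: k => [|k IH]; first by rewrite addn0 !subrr cnorm0.
  rewrite addnS; apply: le_trans (cnorm_triangle (u (n + k)%N) _ _) _.
  by have := ut (n + k)%N; lra.
have main n m : (N <= n)%N -> (n <= m)%N -> cnorm (u m - u n) < e.
  move=> Nn nm; rewrite -(subnKC nm); apply: le_lt_trans (um _ _) _.
  have := hN n Nn; have := tl (n + (m - n))%N; rewrite ltr_norml /=; lra.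
exists N => n m Nn Nm; case: (leqP n m) => nm.
  by rewrite cnorm_distC; exact: main.
by apply: main => //; exact: ltnW.
Qed.

Lemma cconv_norm_le (u : nat -> A) l M : cconv u l ->
  (forall n, cnorm (u n) <= M) -> cnorm l <= M.
Proof.
move=> ul uM; apply/ler_addgt0Pr => e e0.
have [N /(_ N (leqnn N)) h] := ul e e0.
have := cnormD (l - u N) (u N); rewrite subrK (cnorm_distC l).
have := uM N; lra.
Qed.

End CauchyDominated.

(** * Adjoints, square roots by iteration, Neumann series *)

Section CstarBasics.
Variables (R : realType) (A : cstarAlgType R).
Implicit Types x y z : A.

Lemma star1 : star (1 : A) = 1.
Proof.
have h : star (star 1 * 1 : A) = star 1 * 1 by rewrite starM starK.
by rewrite !mulr1 starK in h.
Qed.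

Lemma starZr (t : R) x : star (t%:C *: x) = t%:C *: star x.
Proof. by rewrite starZ conjc_real. Qed.

Lemma star0 : star (0 : A) = 0.
Proof. by have := starZr 0 0; rewrite rmorph0 !scale0r. Qed.

Lemma starN x : star (- x) = - star x.
Proof. by apply/eqP; rewrite -addr_eq0 -starD addNr star0. Qed.

Lemma starB x y : star (x - y) = star x - star y.
Proof. by rewrite starD starN. Qed.

Lemma cnorm_star x : cnorm (star x) = cnorm x.
Proof.
have h (y : A) : cnorm y <= cnorm (star y).
  have := cstar_identity y; have := cnormM (star y) y.
  have := cnorm_ge0 y; rewrite le_eqVlt => /orP[/eqP <- _ _|y0]; first exact: cnorm_ge0.
  by move=> + e; rewrite e expr2 ler_pM2r.
by apply/eqP; rewrite eq_le h -{2}(starK x) h.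
Qed.

Lemma cnorm1 : cnorm (1 : A) = 1.
Proof.
have := cstar_identity (1 : A); rewrite star1 mulr1 expr2 => h.
have n0 : cnorm (1 : A) != 0.
  by apply/eqP => /cnorm_eq0 /eqP; rewrite oner_eq0.
by apply: (mulfI n0); rewrite -h mulr1.
Qed.

Lemma cnorm_sqr x : star x = x -> cnorm (x * x) = cnorm x ^+ 2.
Proof. by move=> {1}<-; exact: cstar_identity. Qed.

Lemma star_sqr x : star x = x -> star (x * x) = x * x.
Proof. by rewrite starM => ->. Qed.

Lemma star_mul_comm x y : star x = x -> star y = y -> x * y = y * x ->
  star (x * y) = x * y.
Proof. by rewrite starM => -> -> ->. Qed.

Definition rpart x : A := (2^-1 : R)%:C *: (x + star x).
Definition ipart x : A := (2^-1 : R)%:C *: ('i%C *: (star x - x)).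

Lemma star_rpart x : star (rpart x) = rpart x.
Proof. by rewrite /rpart starZr starD starK addrC. Qed.

Lemma conjc_i : ('i%C : R[i])^*%C = - 'i%C.
Proof. by apply/eqP; rewrite eq_complex /= !oppr0 !eqxx. Qed.

Lemma complexii : 'i%C * 'i%C = -1 :> R[i].
Proof. by rewrite -expr2 sqr_i. Qed.

Lemma star_ipart x : star (ipart x) = ipart x.
Proof.
by rewrite /ipart starZr starZ conjc_i starB starK scaleNr -scalerN opprB.
Qed.

Lemma rpart_ipart x : x = rpart x + 'i%C *: ipart x.
Proof.
rewrite /rpart /ipart; move: (star x) => y; nc_expand R A.
do ! split.
  transitivity (1 - (2^-1 : R)%:C + 'i%C * 'i%C * (2^-1 : R)%:C); first by ring.
  by rewrite complexii; field.
transitivity (- (2^-1 : R)%:C - 'i%C * 'i%C * (2^-1 : R)%:C); first by ring.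
by rewrite complexii; field.
Qed.

(** The device by which identities of iterates reach their limit: with shift [k = 1] a recursion
    becomes a fixed-point equation, with [k = 0] a property of each term becomes a property of the
    limit. *)
Lemma cconv_eq k K (u : nat -> A) l (f g : A -> A) :
  cconv u l -> (forall n, cnorm (f (u n) - f l) <= K * cnorm (u n - l)) ->
  (forall n, cnorm (g (u n) - g l) <= K * cnorm (u n - l)) ->
  (forall n, f (u (k + n)%N) = g (u n)) -> f l = g l.
Proof.
move=> ul fK gK fg; apply/eqP; rewrite -subr_eq0; apply/eqP.
apply: (@cnorm_small_eq0 _ _ (2 * `|K|)) => e e0.
have [N hN] := ul e e0.
have h0 := hN N (leqnn N); have h1 := hN (k + N)%N (leq_addl _ _).
have Kle (d : R) : 0 <= d -> d < e -> K * d <= `|K| * e.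
  move=> d0 de; apply: le_trans (ler_wpM2r d0 (ler_norm K)) _.
  by apply: ler_wpM2l => //; exact: ltW.
have := cnorm_triangle (f (u (k + N)%N)) (f l) (g l).
rewrite (cnorm_distC (f l) (f _)) fg => h.
have := fK (k + N)%N; have := gK N; rewrite fg.
have := Kle _ (cnorm_ge0 _) h0; have := Kle _ (cnorm_ge0 _) h1.
by move=> a b c d; lra.
Qed.

Fixpoint sqiter x n : A :=
  if n is n'.+1 then (2^-1 : R)%:C *: (x + sqiter x n' * sqiter x n') else 0.

(** The iteration [sqiter] at the scalar 1; it dominates the norms and the increments of [sqiter x]
    whenever x has norm at most 1. *)
Fixpoint sqmajor n : R :=
  if n is n'.+1 then 2^-1 * (1 + sqmajor n' * sqmajor n') else 0.

Lemma sqmajor_bound n : [/\ 0 <= sqmajor n, sqmajor n <= sqmajor n.+1 & sqmajor n <= 1].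
Proof.
elim: n => [|n [h0 h1 h2]]; first by split=> /=; lra.
by split; rewrite /= in h1 *; nra.
Qed.

Lemma sqiter_norm x n : cnorm x <= 1 -> cnorm (sqiter x n) <= sqmajor n.
Proof.
move=> x1; elim: n => [|n IH] /=; first by rewrite cnorm0.
have h0 : 0 <= 2^-1 :> R by lra.
rewrite cnormZr ger0_norm//; apply: ler_wpM2l => //.
apply: le_trans (cnormD _ _) _; apply: lerD => //.
by apply: le_trans (cnormM _ _) _; apply: ler_pM => //; exact: cnorm_ge0.
Qed.

Lemma sqiter_step x n : cnorm x <= 1 ->
  cnorm (sqiter x n.+1 - sqiter x n) <= sqmajor n.+1 - sqmajor n.
Proof.
move=> x1; elim: n => [|n IH].
  by have := sqiter_norm 1 x1; rewrite /= !subr0.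
have [t0 t1 _] := sqmajor_bound n.
move: (sqiter_norm n x1) (sqiter_norm n.+1 x1) IH.
have -> : sqiter x n.+2 - sqiter x n.+1 = (2^-1 : R)%:C *:
   (sqiter x n.+1 * (sqiter x n.+1 - sqiter x n)
    + (sqiter x n.+1 - sqiter x n) * sqiter x n).
  have e m : sqiter x m.+1 = (2^-1 : R)%:C *: (x + sqiter x m * sqiter x m) by [].
  rewrite (e n.+1) [X in _ - X = _](e n).
  by move: (sqiter x n.+1) (sqiter x n) => a b; nc_ring R A.
have -> : sqmajor n.+2 - sqmajor n.+1 = 2^-1 *
   (sqmajor n.+1 * (sqmajor n.+1 - sqmajor n)
    + (sqmajor n.+1 - sqmajor n) * sqmajor n).
  have e m : sqmajor m.+1 = 2^-1 * (1 + sqmajor m * sqmajor m) by [].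
  rewrite (e n.+1) [X in _ - X = _](e n).
  by move: (sqmajor n.+1) (sqmajor n) => a b; ring.
move: (sqiter x n.+1) (sqiter x n) (sqmajor n.+1) (sqmajor n) t0 t1.
move=> a b s t t0 t1 bt as_ abst.
have h0 : 0 <= 2^-1 :> R by lra.
rewrite cnormZr ger0_norm//; apply: ler_wpM2l => //.
apply: le_trans (cnormD _ _) _; apply: lerD.
  by apply: le_trans (cnormM _ _) _; apply: ler_pM => //; exact: cnorm_ge0.
by apply: le_trans (cnormM _ _) _; apply: ler_pM => //; exact: cnorm_ge0.
Qed.

                                                                             
                                                                     
                    
(** The limit y of [sqiter x] solves y = (x + y^2) / 2, so s = 1 - y has square 1 - 2y + y^2 = 1 -
    x. Self-adjointness, and commutation with whatever commutes with x, hold along the iteration and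
    survive the limit. *)
Lemma sqrt_one_minus x : star x = x -> cnorm x <= 1 ->
  exists s, [/\ star s = s, s * s = 1 - x, cnorm (1 - s) <= 1
    & forall z, z * x = x * z -> z * s = s * z].
Proof.
move=> xsa x1.
have [y ly] : exists l, cconv (sqiter x) l.
  apply: (@cconv_dominated _ _ _ sqmajor 1) => n; first exact: sqiter_step.
  by have [] := sqmajor_bound n.
have n1 n : cnorm (sqiter x n) <= 1.
  by have [_ _] := sqmajor_bound n; apply: le_trans; exact: sqiter_norm.
have y1 : cnorm y <= 1 by exact: cconv_norm_le ly n1.
have ysa : star y = y.
  apply: (cconv_eq (k := 0) (K := 1) (f := star) (g := id) ly) => n.
  - by rewrite -starB cnorm_star mul1r.
  - by rewrite mul1r.
  - elim: n => [|n IH] /=; first by rewrite star0.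
    by rewrite starZr starD starM xsa IH.
have yE : y = (2^-1 : R)%:C *: (x + y * y).
  rewrite -[LHS]/(id y).
  apply: (cconv_eq (k := 1) (K := 1) (f := id)
    (g := fun z => (2^-1 : R)%:C *: (x + z * z)) ly) => [n|n|//].
    by rewrite mul1r.
  set a := sqiter x n.
  have -> : (2^-1 : R)%:C *: (x + a * a) - (2^-1 : R)%:C *: (x + y * y) =
     (2^-1 : R)%:C *: (a * (a - y) + (a - y) * y) by nc_ring R A.
  rewrite cnormZr ger0_norm ?invr_ge0//.
  have := cnormD (a * (a - y)) ((a - y) * y).
  have := cnormM a (a - y); have := cnormM (a - y) y.
  have := n1 n; rewrite -/a; have := cnorm_ge0 (a - y); nra.
have ycomm z : z * x = x * z -> z * y = y * z.
  move=> zx; apply: (cconv_eq (k := 0) (K := cnorm z) (f := fun y => z * y)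
    (g := fun y => y * z) ly) => n.
  - by rewrite -mulrBr cnormM.
  - by rewrite -mulrBl mulrC cnormM.
  - elim: n => [|n IH] /=; first by rewrite mulr0 mul0r.
    by rewrite -scalerAr -scalerAl mulrDr mulrDl zx !mulrA IH -!mulrA IH.
exists (1 - y); split.
- by rewrite starB star1 ysa.
- have -> : x = 2%:R *: y - y * y.
    rewrite {1}yE scalerA -[2%:R](rmorph_nat (real_complex R)) -rmorphM.
    by rewrite divff ?pnatr_eq0// scale1r addrK.
  by nc_ring R A.
- by rewrite subKr.
- by move=> z /ycomm h; rewrite mulrBr mulrBl h mulr1 mul1r.
Qed.

(** The inverse is the limit of the partial sums of the geometric series, dominated by the scalar
    partial sums (1 - r^n) / (1 - r); it satisfies z = 1 + x z and commutes with x. *)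
Lemma neumann_series x : cnorm x < 1 ->
  exists z, z * (1 - x) = 1 /\ (1 - x) * z = 1.
Proof.
set r := cnorm x => r1; have r0 : 0 <= r := cnorm_ge0 x.
pose u := fix u n : A := if n is n'.+1 then 1 + x * u n' else 0.
have uS n : u n.+1 = 1 + x * u n by [].
have ux n : u n * x = x * u n.
  elim: n => [|n IH]; first by rewrite mulr0 mul0r.
  by rewrite uS mulrDl mulrDr mul1r mulr1 -mulrA IH.
have r1' : 1 - r != 0 by rewrite subr_eq0 eq_sym lt_eqF.
have [l ul] : exists l, cconv u l.
  apply: (@cconv_dominated _ _ _ (fun n => (1 - r ^+ n) / (1 - r)) (1 - r)^-1).
    move=> n; rewrite -mulrBl.
    have -> : 1 - r ^+ n.+1 - (1 - r ^+ n) = r ^+ n * (1 - r) by rewrite exprS; ring.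
    rewrite mulfK//; elim: n => [|n IH].
      by rewrite /= subr0 mulr0 addr0 cnorm1 expr0.
    rewrite !uS opprD addrACA subrr add0r -mulrBr exprS.
    by apply: le_trans (cnormM _ _) _; exact: ler_wpM2l.
  move=> n; rewrite ler_pdivrMr ?subr_gt0// mulVf//.
  by rewrite gerBl exprn_ge0.
have lE : l = 1 + x * l.
  rewrite -[LHS]/(id l).
  apply: (cconv_eq (k := 1) (K := 1) (f := id) (g := fun z => 1 + x * z) ul) => //.
    by move=> n; rewrite mul1r.
  move=> n; rewrite opprD addrACA subrr add0r -mulrBr.
  by apply: le_trans (cnormM _ _) _; apply: ler_wpM2r; [exact: cnorm_ge0 | exact: ltW].
have lx : l * x = x * l.
  apply: (cconv_eq (k := 0) (K := r) (f := fun y => y * x)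
    (g := fun y => x * y) ul) => n.
  - by rewrite -mulrBl mulrC cnormM.
  - by rewrite -mulrBr cnormM.
  - exact: ux.
by exists l; rewrite mulrBr mulrBl mulr1 mul1r lx {1 3}lE addrK.
Qed.

End CstarBasics.

                                  

(** * Positive elements through norm estimates *)

Section Positivity.
Variables (R : realType) (A : cstarAlgType R).
Implicit Types (x y z a b s c : A) (M : R).

Lemma scaleVr M x : M != 0 -> M%:C *: ((M^-1)%:C *: x) = x.
Proof. by move=> M0; rewrite scalerA -rmorphM divff// scale1r. Qed.

(** Write a = M (1 - x) with x of norm at most 1 and rescale the root of 1 - x. The norm clause on s
    has the same shape as the hypothesis on a, so it certifies that the root is itself positive. *)
Lemma sqrt_positive M a : 0 < M -> star a = a -> cnorm (M%:C *: 1 - a) <= M ->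
  exists s, [/\ star s = s, s * s = a,
    cnorm ((Num.sqrt M)%:C *: 1 - s) <= Num.sqrt M
    & forall z, z * a = a * z -> z * s = s * z].
Proof.
move=> M0 asa aM; pose x : A := (M^-1)%:C *: (M%:C *: 1 - a).
have Mn0 : M != 0 by rewrite gt_eqF.
have xsa : star x = x by rewrite /x starZr starB starZr star1 asa.
have x1 : cnorm x <= 1.
  rewrite /x cnormZr ger0_norm; last by rewrite invr_ge0 ltW.
  by rewrite ler_pdivrMl// mulr1.
have [s [ssa ss s1 sc]] := sqrt_one_minus xsa x1.
have ax : a = M%:C *: (1 - x) by rewrite scalerBr /x scaleVr// subKr.
exists ((Num.sqrt M)%:C *: s); split.
- by rewrite starZr ssa.
- by rewrite -scalerAl -scalerAr scalerA -rmorphM -expr2 sqr_sqrtr ?ltW// ss -ax.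
- rewrite -scalerBr cnormZr ger0_norm ?sqrtr_ge0//.
  by rewrite ler_piMr ?sqrtr_ge0.
- move=> z za; rewrite -scalerAl -scalerAr sc//.
  by rewrite /x -scalerAl -scalerAr mulrBl mulrBr za -scalerAl -scalerAr mulr1 mul1r.
Qed.

                                                                   
(** For u = s + i c, commutation gives [star u * u] = s^2 + c^2 = M, hence ||u||^2 = M by the
    C*-identity, and s is the real part of u. *)
Lemma cnorm_sum_sqr_le M s c : star s = s -> star c = c -> s * c = c * s ->
  0 <= M -> s * s + c * c = M%:C *: 1 -> cnorm s ^+ 2 <= M.
Proof.
move=> ssa csa sc M0 sM; pose u : A := s + 'i%C *: c.
have su : star u = s - 'i%C *: c.
  by rewrite /u starD starZ conjc_i ssa csa scaleNr.
have uu : star u * u = M%:C *: 1.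
  rewrite -sM su /u mulrDr !mulrBl -!scalerAr -!scalerAl scalerA complexii.
  by rewrite scaleN1r opprK sc addrA subrK.
have u2 : cnorm u ^+ 2 = M.
  by rewrite -cstar_identity uu cnormZr cnorm1 mulr1 ger0_norm.
have sE : s = (2^-1 : R)%:C *: (u + star u) by rewrite su /u; nc_ring R A.
have : cnorm s <= cnorm u.
  rewrite sE cnormZr; have h0 : 0 <= 2^-1 :> R by lra.
  rewrite ger0_norm//; have := cnormD u (star u); rewrite cnorm_star; lra.
by rewrite -u2; have := cnorm_ge0 s; have := cnorm_ge0 u; nra.
Qed.

Lemma cnorm_sub_sqr M s : star s = s -> cnorm s ^+ 2 <= M ->
  exists v, [/\ star v = v, v * v = M%:C *: 1 - s * s
    & forall z, z * (s * s) = s * s * z -> z * v = v * z].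
Proof.
move=> ssa sM; have : 0 <= M by apply: le_trans sM; exact: sqr_ge0.
rewrite le_eqVlt => /orP[/eqP M0|M0].
  have s0 : s = 0.
    apply: cnorm_eq0; apply/eqP; rewrite -sqrf_eq0 eq_le sqr_ge0 andbT.
    by rewrite M0.
  exists 0; split; first exact: star0.
    by rewrite s0 -M0 scale0r !mul0r subr0.
  by move=> z _; rewrite mulr0 mul0r.
have [|| v [vsa vv _ vc]] := @sqrt_positive M (M%:C *: 1 - s * s) M0.
- by rewrite starB starZr star1 star_sqr.
- by rewrite subKr cnorm_sqr.
- exists v; split=> // z h; apply: vc.
  by rewrite mulrBr mulrBl h -scalerAl -scalerAr mulr1 mul1r.
Qed.

Lemma cnorm_sub_sqr_le M s : star s = s -> cnorm s ^+ 2 <= M ->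
  cnorm (M%:C *: 1 - s * s) <= M.
Proof.
move=> ssa sM; have M0 : 0 <= M by apply: le_trans sM; exact: sqr_ge0.
have [v [vsa vv vc]] := cnorm_sub_sqr ssa sM.
rewrite -vv cnorm_sqr//; apply: (@cnorm_sum_sqr_le M v s) => //.
  by rewrite vc// mulrA.
by rewrite vv subrK.
Qed.

Definition positive a := exists2 s, star s = s & a = s * s.

Lemma positive_sa a : positive a -> star a = a.
Proof. by move=> [s ssa ->]; rewrite star_sqr. Qed.

(** The norm criterion is what makes positivity additive: the constants M of two elements add up by
    the triangle inequality, whereas a sum of two squares has no evident square root. *)
Lemma positive_norm a : positive a <->
  star a = a /\ exists2 M, 0 <= M & cnorm (M%:C *: 1 - a) <= M.
Proof.
split=> [[s ssa ->]|[asa [M]]].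
  rewrite star_sqr//; split=> //; exists (cnorm s ^+ 2); first exact: sqr_ge0.
  exact: cnorm_sub_sqr_le.
rewrite le_eqVlt => /orP[/eqP <-|M0] aM; last first.
  by have [s [ssa ss _ _]] := sqrt_positive M0 asa aM; exists s.
exists 0; first exact: star0.
have : cnorm a = 0.
  apply/eqP; rewrite eq_le cnorm_ge0 andbT.
  by move: aM; rewrite scale0r sub0r cnormN.
by move=> /cnorm_eq0 ->; rewrite mulr0.
Qed.

Lemma positiveD a b : positive a -> positive b -> positive (a + b).
Proof.
move=> /positive_norm [asa [M M0 aM]] /positive_norm [bsa [N N0 bN]].
apply/positive_norm; split; first by rewrite starD asa bsa.
exists (M + N); first exact: addr_ge0.
have -> : (M + N)%:C *: 1 - (a + b) = (M%:C *: 1 - a) + (N%:C *: 1 - b).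
  by rewrite rmorphD scalerDl opprD addrACA.
by apply: le_trans (cnormD _ _) _; exact: lerD.
Qed.

Lemma positive_sqrt a : positive a ->
  exists s, [/\ positive s, s * s = a & forall z, z * a = a * z -> z * s = s * z].
Proof.
move=> /positive_norm [asa [M M0 aM]].
have M1 : 0 < M + 1 by rewrite ltr_wpDl.
have aM1 : cnorm ((M + 1)%:C *: 1 - a) <= M + 1.
  have -> : (M + 1)%:C *: 1 - a = (M%:C *: 1 - a) + 1.
    by rewrite rmorphD scalerDl scale1r addrAC.
  by apply: le_trans (cnormD _ _) _; rewrite cnorm1 lerD2r.
have [s [ssa ss sM sc]] := sqrt_positive M1 asa aM1.
exists s; split=> //; apply/positive_norm; split=> //.
by exists (Num.sqrt (M + 1)); first exact: sqrtr_ge0.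
Qed.

Lemma sa_sub_norm_positive a : star a = a -> positive ((cnorm a)%:C *: 1 - a).
Proof.
move=> asa; apply/positive_norm; rewrite starB starZr star1 asa; split=> //.
by exists (cnorm a); [exact: cnorm_ge0 | rewrite subKr].
Qed.

Lemma inverse_sa x y : star x = x -> x * y = 1 -> y * x = 1 -> star y = y.
Proof.
move=> xsa xy yx.
have h : star y * x = 1 by rewrite -{1}xsa -starM xy star1.
by rewrite -[LHS]mulr1 -xy mulrA h mul1r.
Qed.

                                                           
(** Invertibility of x keeps x^2 away from 0. With N = ||y||^2, w a root of N - y^2 and v a root of
    M - x^2, the element p = w x satisfies p^2 = N x^2 - 1, so v^2 + p^2 / N = M - 1/N. By
    [cnorm_sum_sqr_le], ||v||^2 <= M - 1/N < M. *)
Lemma cnorm_sub_sqr_lt M x y : star x = x -> x * y = 1 -> y * x = 1 ->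
  cnorm x ^+ 2 <= M -> cnorm (M%:C *: 1 - x * x) < M.
Proof.
move=> xsa xy yx xM; have ysa := inverse_sa xsa xy yx.
have y0 : 0 < cnorm y.
  rewrite lt_neqAle cnorm_ge0 andbT eq_sym; apply/eqP => /cnorm_eq0 y0.
  by move/eqP: xy; rewrite y0 mulr0 eq_sym oner_eq0.
have [w [wsa ww wc]] := cnorm_sub_sqr ysa (lexx (cnorm y ^+ 2)).
have [v [vsa vv vc]] := cnorm_sub_sqr xsa xM.
have xw : x * w = w * x by apply: wc; rewrite mulrA xy mul1r -mulrA yx mulr1.
set N := cnorm y ^+ 2 in ww *; have N0 : 0 < N by rewrite exprn_gt0.
have pp : w * x * (w * x) = N%:C *: (x * x) - 1.
  rewrite -mulrA (mulrA x w) xw -mulrA mulrA ww mulrBl -scalerAl mul1r.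
  by rewrite -!mulrA (mulrA y x) yx mul1r yx.
have psa : star (w * x) = w * x by apply: star_mul_comm.
have xp : x * (w * x) = w * x * x by rewrite mulrA xw.
have pv : w * x * v = v * (w * x).
  by apply: vc; rewrite mulrA -xp -[LHS]mulrA -xp [LHS]mulrA.
have Nn0 : N != 0 by rewrite gt_eqF.
have sN : (Num.sqrt N^-1) ^+ 2 = N^-1 by rewrite sqr_sqrtr// invr_ge0 ltW.
have MN : 0 <= M - N^-1.
  rewrite subr_ge0; apply: le_trans xM.
  rewrite -[leLHS]mul1r ler_pdivrMr// /N -exprMn.
  have := cnormM x y; rewrite xy cnorm1 => h; rewrite -[leLHS](expr1n _ 2).
  by rewrite lerXn2r// nnegrE ?ler01// mulr_ge0 ?cnorm_ge0.
have : cnorm v ^+ 2 <= M - N^-1.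
  apply: (@cnorm_sum_sqr_le _ v ((Num.sqrt N^-1)%:C *: (w * x))) => //.
  - by rewrite starZr psa.
  - by rewrite -scalerAl -scalerAr pv.
  rewrite -scalerAl -scalerAr scalerA -rmorphM -[_ * Num.sqrt _]expr2 sN pp vv.
  rewrite scalerBr scalerA.
  by rewrite -rmorphM mulVf// scale1r addrA subrK rmorphB scalerBl.
rewrite -vv cnorm_sqr// => h; apply: le_lt_trans h _.
by rewrite ltrBlDr ltrDl invr_gt0.
Qed.

Lemma cnorm_ball_inverse M a : 0 < M -> cnorm (M%:C *: 1 - a) < M ->
  exists z, z * a = 1 /\ a * z = 1.
Proof.
move=> M0 aM; have Mn0 : M != 0 by rewrite gt_eqF.
pose x : A := (M^-1)%:C *: (M%:C *: 1 - a).
have ax : a = M%:C *: (1 - x) by rewrite scalerBr /x scaleVr// subKr.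
have [|z [zx xz]] := @neumann_series _ _ x.
  rewrite /x cnormZr ger0_norm; last by rewrite invr_ge0 ltW.
  by rewrite ltr_pdivrMl// mulr1.
exists ((M^-1)%:C *: z); rewrite ax -!scalerAl -!scalerAr !scalerA.
by rewrite -!rmorphM divff// mulVf// !scale1r.
Qed.

                                                                     
                                                                               
                                                                              
(** Let h = [star a * a], k the positive root of h^2 and m = k - h, twice the negative part of h.
    With r a root of k, s = r m and b = a m one finds [star b * b] = -s^2. This forces s = 0, since
    the two products of b and its adjoint have the same invertible nonzero translates while
    [b * star b] turns out positive. Then m = 0 and h = k. *)
Lemma positive_star_mul a : positive (star a * a).
Proof.
set h := star a * a; have hsa : star h = h by rewrite /h starM starK.
have [k [kpos kk kc]] : exists s, [/\ positive s, s * s = h * h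
    & forall z, z * (h * h) = h * h * z -> z * s = s * z].
  by apply: positive_sqrt; exists h.
have [r [rpos rr rc]] := positive_sqrt kpos.
have ksa := positive_sa kpos; have rsa := positive_sa rpos.
have hk : h * k = k * h by apply: kc; rewrite mulrA.
have hr : h * r = r * h by exact: rc.
have kr : k * r = r * k by exact: rc.
pose m := k - h; have msa : star m = m by rewrite /m starB ksa hsa.
have km : k * m = m * k by rewrite /m mulrBr mulrBl hk.
have rm : r * m = m * r by rewrite /m mulrBr mulrBl hr kr.
have hm : h * m = - (k * m).
  by rewrite /m !mulrBr kk hk opprB.
pose b := a * m; pose s := r * m.
have ssa : star s = s by exact: star_mul_comm.
have bb : star b * b = - (s * s).
  rewrite /b starM msa -mulrA (mulrA (star a)) -/h hm mulrN /s.
  by rewrite -rr (mulrA m _ m) (mulrA m r r) -rm -[in LHS](mulrA _ r m).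
have bbpos : positive (b * star b).
  pose x := rpart b; pose y := ipart b.
  (* The sum of [star b * b] and [b * star b] is twice the sum of the squares of the real and
     imaginary parts of b. *)
  have -> : b * star b = (x * x + x * x) + (y * y + y * y) + s * s.
    apply: (@addIr _ (star b * b)); rewrite {2}bb addrK.
    have -> : star b = x - 'i%C *: y.
      rewrite {1}(rpart_ipart b) starD star_rpart starZ star_ipart conjc_i.
      by rewrite scaleNr.
    rewrite {1 2}(rpart_ipart b) -/x -/y.
    nc_expand R A.
    do ! split; rewrite ?mul1r ?mulr1 ?(mulNr, mulrN) ?complexii; ring.
  have sqpos (z : A) : star z = z -> positive (z * z) by exists z.
  by do ?apply: positiveD; apply: sqpos => //; [exact: star_rpart..|
    exact: star_ipart|exact: star_ipart].
have s0 : s = 0.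
  apply: cnorm_eq0; apply/eqP; rewrite eq_le cnorm_ge0 andbT leNgt.
  apply/negP => s_gt0; pose l := cnorm s ^+ 2.
  have l0 : 0 < l by rewrite exprn_gt0.
  have ln0 : l != 0 by rewrite gt_eqF.
  have [bbsa [M M0 bbM]] := (positive_norm _).1 bbpos.
  have [||z [zb bz]] := @cnorm_ball_inverse (M + l) (l%:C *: 1 + b * star b).
  - by rewrite ltr_wpDl.
  - have -> : (M + l)%:C *: 1 - (l%:C *: 1 + b * star b) = M%:C *: 1 - b * star b.
      by nc_ring R A.
    by apply: le_lt_trans bbM _; rewrite ltrDl.
  have bz' : b * star b * z = 1 - l%:C *: z.
    by rewrite -bz mulrDl -scalerAl mul1r addrC addKr.
  have zb' : z * (b * star b) = 1 - l%:C *: z.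
    by rewrite -zb mulrDr -scalerAr mulr1 addrC addKr.
  have [v [vsa vv vc]] := cnorm_sub_sqr ssa (lexx l).
  (* The usual transfer of inverses: z inverts l + [b * star b], hence w inverts l + [star b * b],
     which equals v^2 = l - s^2. *)
  pose w := (l^-1)%:C *: (1 - star b * z * b).
  have lvv : v * v = l%:C *: 1 + star b * b by rewrite vv bb.
  have vvw : v * v * w = 1.
    have -> : v * v * w = (l^-1)%:C *: (l%:C *: 1 + star b * b
        - (l%:C *: (star b * z * b) + star b * (b * star b * z) * b)).
      by rewrite lvv /w; nc_ring R A.
    rewrite bz' -[RHS](scaleVr 1 ln0); nc_ring R A.
  have wvv : w * (v * v) = 1.
    have -> : w * (v * v) = (l^-1)%:C *: (l%:C *: 1 + star b * b
        - (l%:C *: (star b * z * b) + star b * (z * (b * star b)) * b)).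
      by rewrite lvv /w; nc_ring R A.
    by rewrite zb' -[RHS](scaleVr 1 ln0); nc_ring R A.
  have vw : v * w = w * v.
    rewrite -[LHS]mul1r -wvv !mulrA -(mulrA (w * v) v v).
    by rewrite -(mulrA (w * v) (v * v) w) vvw mulr1.
  (* Since v is invertible the inequality is strict, but l - v^2 = s^2 has norm exactly l. *)
  have : cnorm (l%:C *: 1 - v * v) < l.
    apply: (@cnorm_sub_sqr_lt l v (v * w) vsa).
    - by rewrite mulrA.
    - by rewrite vw -mulrA.
    - by rewrite -cnorm_sqr// vv; exact: cnorm_sub_sqr_le.
  by rewrite vv subKr cnorm_sqr// ltxx.
have mm : m * m = 2%:R *: (k * m).
  by rewrite {1}/m mulrBl hm; nc_ring R A.
have m0 : m = 0.
  suff /eqP : (cnorm m ^+ 2) ^+ 2 = 0 by rewrite !expf_eq0 => /eqP/cnorm_eq0.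
  rewrite -cnorm_sqr// -cnorm_sqr ?star_sqr//.
  have -> : m * m * (m * m) = 2%:R *: (s * s * m).
    have -> : s * s = k * m * m by rewrite /s mulrA -(mulrA r m r) -rm mulrA rr.
    by rewrite {1}mm; nc_ring R A.
  by rewrite s0 mul0r mul0r scaler0 cnorm0.
have -> : h = k by apply/eqP; rewrite eq_sym -subr_eq0 -/m m0.
exact: kpos.
Qed.

End Positivity.

(** * Spectral permanence for self-adjoint elements *)

Section SubalgebraInverse.
Variables (R : realType) (A : cstarAlgType R) (S : cstarSubalg A).
Implicit Types x y : A.

Lemma cnorm_val (a : subalg_type S) : cnorm (val a) = cnorm a.
Proof. by []. Qed.

Lemma val_star (a : subalg_type S) : val (star a) = star (val a).
Proof. by []. Qed.

Lemma sub_sa (a : subalg_type S) : star (val a) = val a <-> star a = a.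
Proof.
split=> h; first exact: val_inj.
by rewrite -val_star h.
Qed.

(** Invertibility in the large algebra gives ||M - x^2|| < M for M = ||x||^2. This estimate involves
    only the norm, so it holds in the subalgebra, where a Neumann series inverts x^2; if z is that
    inverse, x z inverts x. *)
Lemma sub_inverse (x : subalg_type S) y : star x = x ->
  val x * y = 1 -> y * val x = 1 -> exists z, [/\ val z = y, x * z = 1 & z * x = 1].
Proof.
move=> xsa xy yx; have vxsa : star (val x) = val x by apply/sub_sa.
have := cnorm_sub_sqr_lt vxsa xy yx (lexx _); set M := cnorm (val x) ^+ 2 => hM.
have hM' : cnorm (M%:C *: 1 - x * x) < M by exact: hM.
have M0 : 0 < M by apply: le_lt_trans hM; exact: cnorm_ge0.
have [z [zxx xxz]] := cnorm_ball_inverse M0 hM'.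
have zx : z * x = x * z.
  by rewrite -[LHS]mulr1 -xxz !mulrA -(mulrA z x x) zxx mul1r.
have xzx : x * (x * z) = 1 by rewrite mulrA.
have zxx' : x * z * x = 1 by rewrite -zx -mulrA.
exists (x * z); split=> //.
have vxz : val x * val (x * z) = 1 by rewrite -[1]/(val (1 : subalg_type S)) -xzx.
by rewrite -[LHS]mul1r -yx -mulrA vxz mulr1.
Qed.

End SubalgebraInverse.

                                

(** * Real Hahn-Banach extension under the norm *)

Section HahnBanach.
Variables (R : realType) (A : normedAlgType R).
Implicit Types (x y : A) (r s t : R).

(** Graphs of partial real-linear functionals, kept as relations so that chains can simply be
    united. Single-valuedness is a consequence: two values r, s at one point yield the pair (0, r -
    s), whence r - s <= 0, and symmetrically. *)
Let dominated (H : set (A * R)) :=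
  [/\ H (0, 0),
      forall t p q, H p -> H q -> H (p.1 + t%:C *: q.1, p.2 + t * q.2)
    & forall p, H p -> p.2 <= cnorm p.1].

Let dominated_scale H t p : dominated H -> H p -> H (t%:C *: p.1, t * p.2).
Proof. by move=> [h0 hl _] Hp; have := hl t _ _ h0 Hp; rewrite !add0r. Qed.

(** The value at [x0] must lie above every [p.2 - cnorm (p.1 - x0)] and below every
    [cnorm (q.1 + x0) - q.2]. These bounds are compatible by [key], and the supremum of the lower
    ones is taken. *)
Let dominated_extend H x0 : dominated H ->
  exists H', [/\ dominated H', H `<=` H' & exists r, H' (x0, r)].
Proof.
move=> HH; have [h0 hl hb] := HH.
have key p q : H p -> H q -> p.2 - cnorm (p.1 - x0) <= cnorm (q.1 + x0) - q.2.
  move=> Hp Hq; have /= := hb _ (hl 1 _ _ Hp Hq); rewrite scale1r mul1r.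
  have := cnormD (p.1 - x0) (q.1 + x0); rewrite addrACA addNr addr0; lra.
pose E := [set p.2 - cnorm (p.1 - x0) | p in H].
have Esup : has_sup E.
  split; first by exists (0 - cnorm (0 - x0)), (0, 0).
  exists (cnorm ((0, 0 : R).1 + x0) - (0 : A, 0 : R).2) => _ [p Hp <-].
  exact: (key p (0, 0)).
pose r0 := sup E.
have lo p : H p -> p.2 - r0 <= cnorm (p.1 - x0).
  by move=> Hp; rewrite lerBlDr -lerBlDl; apply: sup_upper_bound => //; exists p.
have hi p : H p -> p.2 + r0 <= cnorm (p.1 + x0).
  move=> Hp; rewrite -lerBrDl; apply: ge_sup; first exact: Esup.1.
  by move=> _ [q Hq <-]; exact: key.
exists [set q | exists p, exists2 t, H p & q = (p.1 + t%:C *: x0, p.2 + t * r0)].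
split; first split.
- by exists (0, 0), 0 => //=; rewrite scale0r mul0r !addr0.
- move=> t _ _ [p [u Hp ->]] [q [v Hq ->]] /=.
  exists (p.1 + t%:C *: q.1, p.2 + t * q.2), (u + t * v); first exact: hl.
  congr pair => /=; last by ring.
  nc_ring R A.
- move=> _ [p [t Hp ->]] /=.
  have [t0|t0|->] := ltgtP t 0; last by rewrite scale0r mul0r !addr0 hb.
  + have tn0 : t != 0 by rewrite lt_eqF.
    have := lo _ (dominated_scale (- t)^-1 HH Hp); rewrite /= => h.
    have -> : p.1 + t%:C *: x0 = (- t)%:C *: (((- t)^-1)%:C *: p.1 - x0).
      by rewrite scalerBr scalerA -rmorphM divff ?oppr_eq0// scale1r rmorphN scaleNr opprK.
    have -> : p.2 + t * r0 = - t * ((- t)^-1 * p.2 - r0) by field.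
    by rewrite cnormZr gtr0_norm ?oppr_gt0// ler_pM2l ?oppr_gt0.
  + have tn0 : t != 0 by rewrite gt_eqF.
    have := hi _ (dominated_scale t^-1 HH Hp); rewrite /= => h.
    have -> : p.1 + t%:C *: x0 = t%:C *: ((t^-1)%:C *: p.1 + x0).
      by rewrite scalerDr scalerA -rmorphM divff// scale1r.
    have -> : p.2 + t * r0 = t * (t^-1 * p.2 + r0) by field.
    by rewrite cnormZr gtr0_norm// ler_pM2l.
- by move=> [x r] Hp; exists (x, r), 0 => //=; rewrite scale0r mul0r !addr0.
- by exists r0, (0, 0), 1 => //=; rewrite scale1r mul1r !add0r.
Qed.

Theorem hahn_banach (S : A -> Prop) (f : A -> R) :
  S 0 ->
  (forall t x y, S x -> S y ->
     S (x + t%:C *: y) /\ f (x + t%:C *: y) = f x + t * f y) ->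
  (forall x, S x -> f x <= cnorm x) ->
  exists F : A -> R, [/\ forall t x y, F (x + t%:C *: y) = F x + t * F y,
    forall x, F x <= cnorm x & forall x, S x -> F x = f x].
Proof.
move=> S0 fl fb.
pose G0 := [set p : A * R | S p.1 /\ p.2 = f p.1].
have f0 : f 0 = 0.
  have [_] := fl 1 _ _ S0 S0; rewrite scaler0 addr0 mul1r => /eqP.
  by rewrite addrC -subr_eq subrr eq_sym => /eqP.
(* Zorn is applied to sets united with the initial graph [G0], so that the empty chain has an
   admissible union as well. *)
have [|G [PG Gmax]] := @Zorn_bigcup _ [set G | dominated (G0 `|` G)].
  move=> F FP Ftot; split; first by left.
    move=> t p q [Gp|[X FX Xp]] [Gq|[Y FY Yq]].
    - left; have [h e] := fl t _ _ Gp.1 Gq.1; split => //=.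
      by rewrite e Gp.2 Gq.2.
    - have [_ /(_ t p q) h _] := FP _ FY; case: h; [by left|by right|by left|].
      by right; exists Y.
    - have [_ /(_ t p q) h _] := FP _ FX; case: h; [by right|by left|by left|].
      by right; exists X.
    - have [XY|YX] := Ftot _ _ FX FY.
        have [_ /(_ t p q) h _] := FP _ FY.
        case: h; [by right; exact: XY|by right|by left|by right; exists Y].
      have [_ /(_ t p q) h _] := FP _ FX.
      case: h; [by right|by right; exact: YX|by left|by right; exists X].
  move=> p [[Sp ->]|[X FX Xp]]; first exact: fb.
  by have [_ _ ] := FP _ FX; apply; right.
have dom x : exists r, (G0 `|` G) (x, r).
  have [H' [H'd GH' [r H'r]]] := dominated_extend x PG.
  exists r; right; apply: contrapT => nG; apply: (Gmax H').
    split=> [p Gp|]; first by apply: GH'; right.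
    by move=> /(_ _ H'r).
  rewrite /=; suff -> : G0 `|` H' = H' by [].
  by apply/setUidPr => p Gp; apply: GH'; left.
have [h0 hl hb] := PG.
have uniq x r s : (G0 `|` G) (x, r) -> (G0 `|` G) (x, s) -> r = s.
  move=> Gr Gs; have h1 := hb _ (hl (-1) _ _ Gr Gs).
  have h2 := hb _ (hl (-1) _ _ Gs Gr).
  move: h1 h2; rewrite /= rmorphN1 scaleN1r subrr cnorm0; lra.
pose F x := sval (cid (dom x)).
have FP x : (G0 `|` G) (x, F x) by rewrite /F; case: cid.
exists F; split.
- move=> t x y; apply: uniq (FP _) _; exact: (hl t _ _ (FP x) (FP y)).
- by move=> x; exact: (hb _ (FP x)).
- by move=> x Sx; apply: uniq (FP x) _; left.
Qed.

End HahnBanach.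

                                        

(** * Real parts, positive functionals and states *)

Section RealParts.
Variables (R : realType) (A : cstarAlgType R).
Implicit Types (x y a b h : A) (t : R).

Lemma rpart_lin t x y : rpart (x + t%:C *: y) = rpart x + t%:C *: rpart y.
Proof. by rewrite /rpart starD starZr; move: (star x) (star y) => *; nc_ring R A. Qed.

Lemma ipart_lin t x y : ipart (x + t%:C *: y) = ipart x + t%:C *: ipart y.
Proof. by rewrite /ipart starD starZr; move: (star x) (star y) => *; nc_ring R A. Qed.

Lemma rpart_i x : rpart ('i%C *: x) = - ipart x.
Proof. by rewrite /rpart /ipart starZ conjc_i; move: (star x) => *; nc_ring R A. Qed.

Lemma ipart_i x : ipart ('i%C *: x) = rpart x.
Proof.
rewrite /rpart /ipart starZ conjc_i; move: (star x) => y.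
rewrite scaleNr -opprD scalerN -scalerDr [X in - X]scalerA complexii.
by rewrite scaleN1r opprK addrC.
Qed.

Lemma rpart_sa h : star h = h -> rpart h = h.
Proof. by rewrite /rpart => ->; nc_ring R A. Qed.

Lemma ipart_sa h : star h = h -> ipart h = 0.
Proof. by rewrite /ipart => ->; rewrite subrr !scaler0. Qed.

Lemma scale_complex (z : R[i]) x :
  z *: x = (complex.Re z)%:C *: x + (complex.Im z)%:C *: ('i%C *: x).
Proof. by rewrite {1}[z]complexE scalerDl scalerA mulrC. Qed.

End RealParts.

Section Functionals.
Variables (R : realType) (A : cstarAlgType R).
Implicit Types (x y a b h : A) (t : R).

(** Without normalization, because the two components of a state on a direct sum are of this kind
    and may have any mass between 0 and 1. *)
Definition positive_functional (f : A -> R[i]) :=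
  (forall z x y, f (z *: x + y) = z * f x + f y) /\
  (forall a, 0 <= f (star a * a)).

Lemma state_positive (phi : state A) : positive_functional phi.
Proof. by split; [move=> z x y; rewrite linearP | exact: state_ge0]. Qed.

Lemma Re_mulr t (z : R[i]) : complex.Re (t%:C * z) = t * complex.Re z.
Proof. by case: z => u v /=; rewrite mul0r subr0. Qed.

Lemma Im_mulr t (z : R[i]) : complex.Im (t%:C * z) = t * complex.Im z.
Proof. by case: z => u v /=; rewrite mul0r addr0. Qed.

Section PositiveFunctional.
Variable f : A -> R[i].
Hypothesis fP : positive_functional f.

Lemma pf_re t x y :
  complex.Re (f (x + t%:C *: y)) = complex.Re (f x) + t * complex.Re (f y).
Proof. by rewrite addrC fP.1 raddfD /= Re_mulr addrC. Qed.

Lemma pf0 : f 0 = 0.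
Proof. by have := fP.1 (-1) 0 0; rewrite scaler0 addr0 mulN1r addNr. Qed.

Lemma pfN x : f (- x) = - f x.
Proof. by have := fP.1 (-1) x 0; rewrite addr0 scaleN1r pf0 addr0 mulN1r. Qed.

Lemma pfB x y : f (x - y) = f x - f y.
Proof. by have := fP.1 (-1) y x; rewrite scaleN1r mulN1r addrC => ->; rewrite addrC. Qed.

Lemma pfD x y : f (x + y) = f x + f y.
Proof. by have := fP.1 1 x y; rewrite scale1r mul1r. Qed.

Lemma pf_positive a : positive a -> 0 <= f a.
Proof. by move=> [s ssa ->]; have := fP.2 s; rewrite ssa. Qed.

Lemma pf1_ge0 : 0 <= f 1.
Proof. by have := fP.2 1; rewrite star1 mulr1. Qed.

Lemma pf_sa_im h : star h = h -> complex.Im (f h) = 0.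
Proof.
move=> hsa; have := pf_positive (sa_sub_norm_positive hsa).
have := pf1_ge0; rewrite !lecE /= => /andP[/eqP f1 _] /andP[/eqP + _].
rewrite fP.1 pfN raddfB /= Im_mulr f1 mulr0 sub0r => /eqP.
by rewrite oppr_eq0 => /eqP.
Qed.

Lemma pf_saE h : star h = h -> f h = (complex.Re (f h))%:C.
Proof. by move=> /pf_sa_im; case: (f h) => u v /= ->. Qed.

(** Positivity is applied to the two elements ||h|| - h and ||h|| + h. *)
Lemma pf_sa_bound h : star h = h ->
  `|complex.Re (f h)| <= cnorm h * complex.Re (f 1).
Proof.
move=> hsa; have nsa : star (- h) = - h by rewrite starN hsa.
have := pf_positive (sa_sub_norm_positive hsa).
have := pf_positive (sa_sub_norm_positive nsa).
rewrite cnormN opprK !lecE => /andP[_ h1] /andP[_ h2]; move: h1 h2.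
by rewrite !fP.1 pfN !raddfD raddfN /= Re_mulr ler_norml; lra.
Qed.

Lemma state_of_functional : f 1 = 1 ->
  exists phi : state A, forall a, phi a = f a.
Proof.
move=> f1.
have flin : linear (f : A -> R[i]^o) by move=> z x y; exact: fP.1.
pose lf : {linear A -> R[i]^o} := HB.pack (f : A -> R[i]^o)
  (GRing.isLinear.Build _ _ _ _ (f : A -> R[i]^o) flin).
by exists (@State R A lf fP.2 f1).
Qed.

End PositiveFunctional.

Lemma eq_state (phi psi : state A) : (forall a, phi a = psi a) -> phi = psi.
Proof.
case: phi psi => [f fp f1] [g gp g1] /= /funext fg.
have {}fg : f = g.
  case: f g fg {fp f1 gp g1} => [f [[fD] [fZ]]] [g [[gD] [gZ]]] /= fg.
  case: _ / fg gD gZ => gD gZ.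
  by rewrite (Prop_irrelevance gD fD) (Prop_irrelevance gZ fZ).
case: _ / fg gp g1 => gp g1.
by congr State; exact: Prop_irrelevance.
Qed.

Definition rstate (phi : state A) a : R := complex.Re (phi a).

Lemma rstate_lin (phi : state A) t x y :
  rstate phi (x + t%:C *: y) = rstate phi x + t * rstate phi y.
Proof. exact/pf_re/state_positive. Qed.

Lemma rstate1 (phi : state A) : rstate phi 1 = 1.
Proof. by rewrite /rstate state1. Qed.

Lemma rstateB (phi : state A) x y : rstate phi (x - y) = rstate phi x - rstate phi y.
Proof. by rewrite /rstate (pfB (state_positive phi)) raddfB. Qed.

Lemma rstateZ (phi : state A) t x : rstate phi (t%:C *: x) = t * rstate phi x.
Proof.
have := rstate_lin phi t 0 x; rewrite add0r => ->.
by rewrite /rstate (pf0 (state_positive phi)) add0r.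
Qed.

Lemma rstate_bound (phi : state A) h : star h = h -> `|rstate phi h| <= cnorm h.
Proof.
by move=> /(pf_sa_bound (state_positive phi)); rewrite state1 mulr1.
Qed.

Lemma state_parts (phi : state A) x :
  phi x = (rstate phi (rpart x))%:C + 'i%C * (rstate phi (ipart x))%:C.
Proof.
have fP := state_positive phi.
rewrite {1}(rpart_ipart x) addrC fP.1 (pf_saE fP (star_rpart x)).
by rewrite (pf_saE fP (star_ipart x)) addrC.
Qed.

Lemma eq_state_sa (phi psi : state A) :
  (forall h, star h = h -> rstate phi h = rstate psi h) -> phi = psi.
Proof.
move=> e; apply: eq_state => a.
by rewrite !state_parts !e//; [exact: star_ipart | exact: star_rpart].
Qed.

(** Domination by the norm and F(1) = 1 imply positivity: F(||s||^2 - s^2) <= ||s||^2 gives F(s^2)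
    >= 0, and every [star a * a] is such a square by [positive_star_mul]. The complex functional is
    assembled from F on real and imaginary parts. *)
Lemma state_of_sa_functional (F : A -> R) :
  (forall t x y, F (x + t%:C *: y) = F x + t * F y) ->
  (forall x, F x <= cnorm x) -> F 1 = 1 ->
  exists phi : state A, forall h, star h = h -> rstate phi h = F h.
Proof.
move=> Fl Fb F1.
have F0 : F 0 = 0 by have := Fl (-1) 0 0; rewrite scaler0 addr0; lra.
have FD x y : F (x + y) = F x + F y.
  by have := Fl 1 x y; rewrite scale1r mul1r.
have FZ t x : F (t%:C *: x) = t * F x by have := Fl t 0 x; rewrite F0 !add0r.
have FN x : F (- x) = - F x.
  by have := FZ (-1) x; rewrite rmorphN1 scaleN1r mulN1r.
pose f x : R[i] := F (rpart x) +i* F (ipart x).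
have fE x : star x = x -> f x = (F x)%:C.
  by move=> xsa; rewrite /f rpart_sa// ipart_sa// F0.
have fP : positive_functional f.
  split=> [z x y|a].
    rewrite addrC scale_complex addrA /f !rpart_lin !ipart_lin rpart_i ipart_i.
    move: (rpart x) (ipart x) (rpart y) (ipart y) => x1 x2 y1 y2.
    rewrite !FD !FZ FN; case: z => u v; apply/eqP.
    by rewrite eq_complex /=; apply/andP; split; apply/eqP; ring.
  have [s ssa sE] := positive_star_mul a.
  rewrite fE sE; last exact: star_sqr.
  rewrite lecR; have := Fb ((cnorm s ^+ 2)%:C *: 1 - s * s).
  rewrite FD FZ F1 FN; have := cnorm_sub_sqr_le ssa (lexx _); lra.
have [|phi phiE] := state_of_functional fP; first by rewrite fE ?star1// F1.
by exists phi => h hsa; rewrite /rstate phiE fE.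
Qed.

Lemma state_exists : exists phi : state A, True.
Proof.
                                                             
(* On the real multiples of 1 this expression is | |t| + t | - |t| = t, so it reads off the scalar
   without choosing it. *)
pose f (x : A) := cnorm ((cnorm x)%:C *: 1 + x) - cnorm x.
have fE (t : R) : f (t%:C *: 1) = t.
  rewrite /f !cnormZr cnorm1 mulr1 -scalerDl -rmorphD cnormZr cnorm1 mulr1.
  rewrite ger0_norm; first by rewrite addrC addKr.
  by have := ler_norm (- t); rewrite normrN; lra.
have [|||F [Fl Fb Fe]] := @hahn_banach R A (fun x => exists t : R, x = t%:C *: 1) f.
- by exists 0; rewrite scale0r.
- move=> t _ _ [u ->] [v ->].
  have -> : u%:C *: 1 + t%:C *: (v%:C *: 1) = (u + t * v)%:C *: (1 : A).
    by nc_ring R A.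
  by split; [exists (u + t * v) | rewrite !fE].
- by move=> _ [t ->]; rewrite fE cnormZr cnorm1 mulr1 ler_norm.
have F1 : F 1 = 1.
  by rewrite Fe; [rewrite -{1}[1]scale1r fE | exists 1; rewrite scale1r].
by have [phi _] := state_of_sa_functional Fl Fb F1; exists phi.
Qed.

End Functionals.

(** * Extension and restriction of states along a subalgebra *)

Section StateExtension.
Variables (R : realType) (A : cstarAlgType R) (S : cstarSubalg A).

Lemma val_sub_lin (t : R) (x y : subalg_type S) :
  val (x + t%:C *: y) = val x + t%:C *: val y.
Proof. by []. Qed.

Lemma state_extension (theta : state (subalg_type S)) :
  exists psi : state A, forall h : subalg_type S,
    star h = h -> rstate psi (val h) = rstate theta h.
Proof.
have iS x : subalg_set S x -> x \in (S : set A) by rewrite inE.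
(* The default value 0 outside [S] is harmless: the functional is only used on the self-adjoint part
   of [S]. *)
pose g (x : A) : subalg_type S := insubd 0 x.
have gK x : subalg_set S x -> val (g x) = x by move=> /iS Sx; rewrite /g insubdK.
have gV x : g (val x) = x by rewrite /g valKd.
have [|||F [Fl Fb Fe]] := @hahn_banach R A (fun x => subalg_set S x /\ star x = x)
   (fun x => rstate theta (g x)).
- by rewrite star0; split=> //; have := valP (0 : subalg_type S); rewrite inE.
- move=> t x y [Sx xsa] [Sy ysa].
  have e : x + t%:C *: y = val (g x + t%:C *: g y) by rewrite val_sub_lin !gK.
  split; last by rewrite e gV rstate_lin.
  split; last by rewrite starD starZr xsa ysa.
  by rewrite e; have := valP (g x + t%:C *: g y); rewrite inE.
- move=> x [Sx xsa]; have gsa : star (g x) = g x by apply/sub_sa; rewrite gK.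
  apply: le_trans (ler_norm _) _; apply: le_trans (rstate_bound theta gsa) _.
  by rewrite -cnorm_val gK.
have Sval (x : subalg_type S) : subalg_set S (val x) by have := valP x; rewrite inE.
have F1 : F 1 = 1.
  rewrite Fe; last by rewrite star1; split=> //; exact: (Sval 1).
  by rewrite -(rstate1 theta); congr rstate; exact: (gV 1).
have [psi psiE] := state_of_sa_functional Fl Fb F1.
exists psi => h hsa; have vsa : star (val h) = val h by apply/sub_sa.
by rewrite psiE// Fe ?gV.
Qed.

Lemma state_restriction (psi : state A) :
  exists theta : state (subalg_type S), forall h : subalg_type S,
    rstate theta h = rstate psi (val h).
Proof.
have [|theta thetaE] := @state_of_functional _ _
  (fun x : subalg_type S => psi (val x) : R[i]) _ (state1 psi).
  by split=> [z x y|a]; [rewrite -[RHS](linearP psi) | exact: state_ge0].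
by exists theta => h; rewrite /rstate thetaE.
Qed.

End StateExtension.

                                                             

(** * Weak* neighbourhoods and convexity of the state space *)

Section WeakStar.
Variables (R : realType) (A : cstarAlgType R).
Implicit Types (x y a b h : A) (t : R) (phi psi : state A).

Definition weak_near phi (l : seq A) (e : R) psi :=
  forall h, h \in l -> `|rstate phi h - rstate psi h| < e.

Lemma normc_RI (u v : R) : `|u%:C + 'i%C * v%:C : R[i]| <= (`|u| + `|v|)%:C.
Proof.
apply: le_trans (ler_normD _ _) _; rewrite normrM !normc_def /=.
by rewrite expr0n expr1n add0r sqrtr1 mul1r /= !addr0 !sqrtr_sqr -rmorphD.
Qed.

(** Self-adjoint test elements and real values suffice, because a state is determined by its real
    values on the real and imaginary parts of each element. *)
Lemma weak_nbhsP phi (U : set (state A)) :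
  nbhs (phi : weak_star_state A) U <->
  exists (l : seq A) (e : R), [/\ 0 < e, (forall h, h \in l -> star h = h)
    & forall psi, weak_near phi l e psi -> U psi].
Proof.
split; last first.
  move=> [l [e [e0 lsa lU]]].
  have evc h : \forall psi \near (phi : weak_star_state A),
      `|rstate phi h - rstate psi h| < e.
    have c1 : (fun psi : weak_star_state A => (psi : state A) h : R[i]^o)
        @ nbhs (phi : weak_star_state A) --> (phi h : R[i]^o).
      apply: (@cvg_comp _ _ _
        (fun psi : weak_star_state A => (psi : A -> R[i]) : {ptws A -> R[i]^o})
        (fun g : {ptws A -> R[i]^o} => g h)).
        exact: initial_continuous.
      pose f0 : {ptws A -> R[i]^o} := (phi : A -> R[i]).
      have /pointwise_cvgP : {ptws, nbhs f0 --> f0} by [].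
      exact.
    have e1 : (0 : R[i]) < e%:C by rewrite ltcR.
    move/cvgrPdist_lt: c1 => /(_ _ e1); apply: filterS => psi; rewrite -ltcR.
    apply: le_lt_trans; rewrite /rstate -raddfB; exact: normc_ge_Re.
  suff : \forall psi \near (phi : weak_star_state A), weak_near phi l e psi.
    by apply: filterS.
  rewrite /weak_near; elim: l {lsa lU} => [|h l IH].
    by apply: (@filterE _ (nbhs (phi : weak_star_state A)) (nbhs_filter _)).
  apply: filterS2 (evc h) IH => psi h1 h2 k; rewrite inE => /orP[/eqP -> //|].
  exact: h2.
move=> [B [[V Vop VB] Bphi BU]].
(* The filter generated by conditions on finitely many evaluations. It converges pointwise to [phi],
   hence contains every neighbourhood of [phi] in the product topology, in particular [V]. *)
pose G : set_system (A -> R[i]^o) := [set W | exists (l : seq A) (e : R),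
  0 < e /\ forall g, (forall x, x \in l -> `|phi x - g x : R[i]| < e%:C) -> W g].
have GF : Filter G.
  split.
  - by exists [::], 1; split.
  - move=> P Q [l [e [e0 lP]]] [k [d [d0 kQ]]].
    exists (l ++ k), (Num.min e d); split; first by rewrite lt_min e0.
    move=> g gl; split; [apply: lP | apply: kQ] => x xl.
      have := gl x; rewrite mem_cat xl => /(_ isT) h; apply: lt_le_trans h _.
      by rewrite lecR ge_min lexx.
    have := gl x; rewrite mem_cat xl orbT => /(_ isT) h; apply: lt_le_trans h _.
    by rewrite lecR ge_min lexx orbT.
  - move=> P Q PQ [l [e [e0 lP]]]; exists l, e; split=> // g /lP; exact: PQ.
have Gphi : {ptws, G --> (phi : A -> R[i]^o)}.
  apply/pointwise_cvgP => x; apply/cvgrPdist_lt => e e0.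
  have eE : e = (complex.Re e)%:C by rewrite RRe_real// gtr0_real.
  exists [:: x], (complex.Re e); split; first by rewrite -ltcR -eE.
  by move=> g /(_ x); rewrite -eE; apply; rewrite inE.
have [l [e [e0 lV]]] : G V.
  by apply: Gphi; apply: open_nbhs_nbhs; split=> //; rewrite -VB in Bphi.
exists ([seq rpart x | x <- l] ++ [seq ipart x | x <- l]), (e / 2); split.
- by rewrite divr_gt0.
- move=> h; rewrite mem_cat => /orP[] /mapP[x _ ->]; [exact: star_rpart|exact: star_ipart].
- move=> psi near; apply: BU; rewrite -VB /=; apply: lV => x xl.
  rewrite !state_parts opprD addrACA -mulrBr -!rmorphB.
  apply: le_lt_trans (normc_RI _ _) _; rewrite ltcR (splitr e).
  apply: ltrD; apply: near; rewrite mem_cat; apply/orP.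
    by left; exact: map_f.
  by right; exact: map_f.
Qed.
End WeakStar.

Section StateConvexity.
Variables (R : realType) (A : cstarAlgType R).
Implicit Types (a h : A) (t : R) (phi psi : state A).

Lemma positive_functional_comb (f g : A -> R[i]) (s t : R) :
  positive_functional f -> positive_functional g -> 0 <= s -> 0 <= t ->
  positive_functional (fun a => s%:C * f a + t%:C * g a).
Proof.
move=> fP gP s0 t0; split=> [z x y|a].
  by rewrite fP.1 gP.1; ring.
by rewrite addr_ge0// mulr_ge0 ?lecR// ?fP.2 ?gP.2.
Qed.

Lemma state_convex phi psi t : 0 <= t <= 1 ->
  exists chi : state A, forall a,
    rstate chi a = (1 - t) * rstate phi a + t * rstate psi a.
Proof.
move=> /andP[t0 t1]; have s0 : 0 <= 1 - t by rewrite subr_ge0.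
have cP := positive_functional_comb (state_positive phi) (state_positive psi) s0 t0.
have [|chi chiE] := state_of_functional cP.
  by rewrite !state1 !mulr1 -rmorphD subrK.
by exists chi => a; rewrite /rstate chiE raddfD /= !Re_mulr.
Qed.

Lemma rstate_dist_le phi psi h : star h = h ->
  `|rstate phi h - rstate psi h| <= 2 * cnorm h.
Proof.
move=> hsa; have := rstate_bound phi hsa; have := rstate_bound psi hsa.
by rewrite !ler_norml; lra.
Qed.

End StateConvexity.

(** * The Monge-Kantorovich distance and the weak* topology *)

Section MongeKantorovich.
Variables (R : realType) (A : cstarAlgType R) (L : A -> \bar R).
Implicit Types (a b h : A) (t e r K : R) (phi psi : state A).
Hypothesis Lsa : forall a, (L a <= 1)%E -> star a = a.

Lemma normc_state_sub phi psi a : star a = a ->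
  Normc.normc (phi a - psi a) = `|rstate phi a - rstate psi a|.
Proof.
move=> asa; rewrite (pf_saE (state_positive phi) asa) (pf_saE (state_positive psi) asa).
by rewrite -rmorphB /= expr0n addr0 sqrtr_sqr.
Qed.

Lemma mk_le phi psi (x : \bar R) :
  (forall a, (L a <= 1)%E -> ((`|rstate phi a - rstate psi a|)%:E <= x)%E) <->
  (mk L phi psi <= x)%E.
Proof.
split=> [h|h a La].
  by apply: ge_ereal_sup => _ [a La <-]; rewrite normc_state_sub ?h// Lsa.
apply: le_trans h; apply: ereal_sup_ubound; exists a => //.
by rewrite normc_state_sub// Lsa.
Qed.

Lemma mk_leP phi psi e :
  (mk L phi psi <= e%:E)%E <->
  forall a, (L a <= 1)%E -> `|rstate phi a - rstate psi a| <= e.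
Proof.
rewrite -mk_le; split=> h a /h; by rewrite lee_fin.
Qed.

(** Continuity from the weak* topology to the distance, in terms of finitely many test elements; the
    other half of metrization comes from density of the domain. *)
Definition mk_weak_continuous := forall phi e, 0 < e ->
  exists (l : seq A) (d : R), [/\ 0 < d, (forall h, h \in l -> star h = h)
    & forall psi, weak_near phi l d psi ->
        forall a, (L a <= 1)%E -> `|rstate phi a - rstate psi a| <= e].

Lemma metrizes_weak_continuous :
  @metrizes R (weak_star_state A) (mk L) -> mk_weak_continuous.
Proof.
move=> [_ _ _ _ nb] phi e e0.
have /weak_nbhsP [l [d [d0 lsa ld]]] :
    nbhs (phi : weak_star_state A) [set psi | mk L phi psi < e%:E]%E.
  by apply/nb; exists e.
exists l, d; split=> // psi /ld /= /ltW /mk_leP; exact.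
Qed.

                                                                           
                                                                        
(** Convexity makes a local bound global: moving from [phi] towards any [psi] by a fixed fraction t
    stays in the neighbourhood on which the distance to [phi] is at most 1, so [psi] is within 1/t
    of [phi]. *)
Lemma mk_diameter : mk_weak_continuous -> exists2 r, 0 <= r &
  forall phi psi a, (L a <= 1)%E -> `|rstate phi a - rstate psi a| <= r.
Proof.
move=> mc; have [phi _] := state_exists A.
have [l [d [d0 lsa ld]]] := mc phi 1 ltr01.
pose N := \sum_(h <- l) cnorm h.
have N0 : 0 <= N by apply: sumr_ge0 => h _; exact: cnorm_ge0.
have lN h : h \in l -> cnorm h <= N.
  move=> hl; rewrite /N (big_rem h)//= lerDl.
  by apply: sumr_ge0 => k _; exact: cnorm_ge0.
have D0 : 0 < d + 2 * N by rewrite ltr_pwDl// mulr_ge0.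
(* Two states differ by at most 2N on each test element, and 2 N t < d. *)
pose t := d / (d + 2 * N + 1).
have D1 : 0 < d + 2 * N + 1 by rewrite addr_gt0.
have t0 : 0 < t by rewrite divr_gt0.
have tD : t * (d + 2 * N + 1) = d by rewrite /t divfK// gt_eqF.
have t1 : t <= 1 by rewrite /t ler_pdivrMr// mul1r; lra.
have main psi a : (L a <= 1)%E -> `|rstate phi a - rstate psi a| <= t^-1.
  move=> La; have [|chi chiE] := state_convex phi psi (t := t).
    by rewrite ltW.
  have diff b : rstate phi b - rstate chi b = t * (rstate phi b - rstate psi b).
    by rewrite chiE; ring.
  have := ld chi _ a La; rewrite diff normrM gtr0_norm// mulrC.
  rewrite -ler_pdivlMr// div1r; apply => h hl.
  rewrite diff normrM gtr0_norm//.
  have := rstate_dist_le phi psi (lsa _ hl); have := lN _ hl; nra.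
exists (2 * t^-1); first by rewrite mulr_ge0// invr_ge0 ltW.
move=> psi chi a La; have := main psi a La; have := main chi a La.
by rewrite !ler_norml; lra.
Qed.

Hypothesis L_scale : forall t a K, (L a <= K%:E)%E -> (L (t%:C *: a) <= (`|t| * K)%:E)%E.
Hypothesis L0 : L 0 = 0%E.
Hypothesis L_dense : forall h e, star h = h -> 0 < e ->
  exists b K, [/\ 0 < K, (L b <= K%:E)%E & cnorm (h - b) < e].

Lemma mk_scale phi psi a e K : 0 < K -> (mk L phi psi <= e%:E)%E ->
  (L a <= K%:E)%E -> `|rstate phi a - rstate psi a| <= K * e.
Proof.
move=> K0 /mk_leP h La; have Kn0 : K != 0 by rewrite gt_eqF.
have /h : (L ((K^-1)%:C *: a) <= 1)%E.
  have := L_scale K^-1 La; rewrite ger0_norm ?mulVf// invr_ge0; exact: ltW.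
rewrite !rstateZ -mulrBr normrM ger0_norm ?invr_ge0; last exact: ltW.
by rewrite ler_pdivrMl.
Qed.

Lemma L_dense_sa h e : star h = h -> 0 < e ->
  exists b K, [/\ 0 < K, (L b <= K%:E)%E, star b = b & cnorm (h - b) < e].
Proof.
move=> hsa e0; have [b [K [K0 LbK hb]]] := L_dense hsa e0.
exists b, K; split=> //; have Kn0 : K != 0 by rewrite gt_eqF.
have : star ((K^-1)%:C *: b) = (K^-1)%:C *: b.
  apply: Lsa; have := L_scale K^-1 LbK.
  by rewrite ger0_norm ?mulVf// invr_ge0 ltW.
rewrite starZr => /(congr1 (fun x => K%:C *: x)).
by rewrite !scaleVr.
Qed.

(** Each self-adjoint h is a norm limit of elements of finite Lipschitz value, on which the distance
    controls the difference of two states. This separates states and makes distance balls finer than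
    weak* neighbourhoods; the hypothesis gives the converse and, through [mk_diameter],
    finiteness. *)
Lemma weak_continuous_metrizes :
  mk_weak_continuous -> @metrizes R (weak_star_state A) (mk L).
Proof.
move=> mc; have [r r0 diam] := mk_diameter mc.
have mk0 phi psi : (0 <= mk L phi psi)%E.
  apply: le_trans (_ : (`|rstate phi 0 - rstate psi 0|)%:E <= _)%E.
    by rewrite lee_fin.
  by apply: ((mk_le phi psi _).2 (lexx _) 0); rewrite L0.
have mkfin phi psi : (mk L phi psi < +oo)%E.
  by apply: le_lt_trans (ltry r); apply/mk_leP; exact: diam.
have approx phi psi b h e K : star h = h -> star b = b -> 0 < K -> (L b <= K%:E)%E ->
    (mk L phi psi <= e%:E)%E ->
    `|rstate phi h - rstate psi h| <= 2 * cnorm (h - b) + K * e.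
  move=> hsa bsa K0 LbK me; have := mk_scale K0 me LbK.
  have hbsa : star (h - b) = h - b by rewrite starB hsa bsa.
  have := rstate_dist_le phi psi hbsa; rewrite !rstateB !ler_norml; lra.
have mksym phi psi : mk L phi psi = mk L psi phi.
  by apply/eqP; rewrite eq_le; apply/andP; split; apply/mk_le => a La;
    rewrite distrC; move: a La; apply/mk_le.
split.
- by move=> phi psi; rewrite mk0 mkfin.
- move=> phi psi; split=> [m0|->]; last first.
    apply/eqP; rewrite eq_le mk0 andbT; apply/mk_le => a _.
    by rewrite subrr normr0.
  apply: eq_state_sa => h hsa; apply/eqP; rewrite -subr_eq0 -normr_eq0.
  rewrite eq_le normr_ge0 andbT; apply/ler_addgt0Pr => e e0; rewrite add0r.
  have e2 : 0 < e / 2 by rewrite divr_gt0.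
  have [b [K [K0 LbK bsa hb]]] := L_dense_sa hsa e2.
  have := approx phi psi b h 0 K hsa bsa K0 LbK; rewrite m0 lexx => /(_ isT).
  by rewrite mulr0; lra.
- exact: mksym.
- move=> phi psi chi; apply/mk_le => a La.
  have h1 := (mk_le phi psi _).2 (lexx _) a La.
  have h2 := (mk_le psi chi _).2 (lexx _) a La.
  apply: le_trans (leeD h1 h2); rewrite -EFinD lee_fin; exact: ler_distD.
- move=> phi U; split.
    move=> /weak_nbhsP [l [e [e0 lsa lU]]].
    suff [d d0 hd] : exists2 d : R, 0 < d &
        forall psi : state A, (mk L phi psi < d%:E)%E -> weak_near phi l e psi.
      by exists d => // psi /hd; exact: lU.
    elim: l lsa {lU} => [|h l IH] lsa; first by exists 1 => // psi _ h.
    have [|d d0 hd] := IH; first by move=> k kl; apply: lsa; rewrite inE kl orbT.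
    have hsa : star h = h by apply: lsa; rewrite inE eqxx.
    have e4 : 0 < e / 4 by rewrite divr_gt0.
    have [b [K [K0 LbK bsa hb]]] := L_dense_sa hsa e4.
    (* With [cnorm (h - b)] below e/4, the estimate [approx] yields 2 (e/4) + K (e / 4 / K) < e. *)
    exists (Num.min d (e / 4 / K)); first by rewrite lt_min d0 !divr_gt0.
    move=> psi; rewrite EFin_min lt_min => /andP[pd pe] k.
    rewrite inE => /orP[/eqP ->|kl]; last exact: hd.
    have := approx phi psi b h (e / 4 / K) K hsa bsa K0 LbK (ltW pe).
    by rewrite [K * _]mulrC divfK ?gt_eqF//; lra.
  move=> [e e0 eU]; apply/weak_nbhsP.
  have e2 : 0 < e / 2 by rewrite divr_gt0.
  have [l [d [d0 lsa ld]]] := mc phi _ e2; exists l, d; split=> // psi near.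
  apply: eU => /=; apply: (@le_lt_trans _ _ (e / 2)%:E).
    by apply/mk_leP; exact: ld.
  by rewrite lte_fin; lra.
Qed.

End MongeKantorovich.

                                                        

(** * Closures in norm, Jordan and Lie products *)

Section NormTopology.
Variables (R : realType) (A : cstarAlgType R).
Implicit Types (a b : A) (S : set A).

Lemma closure_cnormP S a :
  closure S a <-> forall e, 0 < e -> exists2 b, S b & cnorm (a - b) < e.
Proof.
split=> [h e e0|h B].
  have /h [b [Sb]] : nbhs a (ball a e%:C) by apply: nbhsx_ballx; rewrite ltcR.
  by rewrite -ball_normE /ball_ /= ltcR => hb; exists b.
move=> /nbhs_ballP [e /= e0 eB].
have eE : e = (complex.Re e)%:C by rewrite RRe_real// gtr0_real.
have [|b Sb hb] := h (complex.Re e); first by rewrite -ltcR -eE.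
by exists b; split=> //; apply: eB; rewrite -ball_normE /ball_ /= eE ltcR.
Qed.

Lemma closed_cnormP S : closed S <->
  forall a, (forall e, 0 < e -> exists2 b, S b & cnorm (a - b) < e) -> S a.
Proof. by split=> h a; [move/closure_cnormP/h | move/closure_cnormP/h]. Qed.

End NormTopology.

Section JordanLie.
Variables (R : realType) (A : cstarAlgType R).
Implicit Types (a b x y : A).

Lemma cnorm_bilin_half (c : R[i]) a b x y : `|c| = (2^-1 : R)%:C ->
  cnorm (c *: (a * b + x * y)) <= 2^-1 * (cnorm a * cnorm b + cnorm x * cnorm y).
Proof.
move=> c2; have : ((cnorm (c *: (a * b + x * y)))%:C <=
    (2^-1 * (cnorm a * cnorm b + cnorm x * cnorm y))%:C).
  rewrite cnormZ c2 -rmorphM lecR; have h0 : 0 <= 2^-1 :> R by lra.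
  apply: ler_wpM2l => //; apply: le_trans (cnormD _ _) _.
  by apply: lerD; exact: cnormM.
by rewrite lecR.
Qed.

Lemma norm_half : `|(2 : R[i])^-1| = (2^-1 : R)%:C.
Proof.
by rewrite normfV ger0_norm// fmorphV rmorph_nat.
Qed.

Lemma norm_halfi : `|(2 * 'i%C : R[i])^-1| = (2^-1 : R)%:C.
Proof.
rewrite normfV normrM (_ : `|'i%C| = 1) ?mulr1.
  by rewrite ger0_norm// fmorphV rmorph_nat.
by rewrite normc_def /= expr0n expr1n add0r sqrtr1.
Qed.

Lemma cnorm_jordan a b : cnorm (jordan a b) <= cnorm a * cnorm b.
Proof. have := cnorm_bilin_half a b b a norm_half; rewrite -/(jordan a b); lra. Qed.

Lemma cnorm_lie a b : cnorm (lie a b) <= cnorm a * cnorm b.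
Proof.
have := cnorm_bilin_half a b (- b) a norm_halfi; rewrite mulNr cnormN -/(lie a b); lra.
Qed.

Lemma jordan_sub a b x y : jordan a b - jordan x y = jordan (a - x) b + jordan x (b - y).
Proof. rewrite /jordan; nc_ring R A. Qed.

Lemma lie_sub a b x y : lie a b - lie x y = lie (a - x) b + lie x (b - y).
Proof. rewrite /lie; nc_ring R A. Qed.

End JordanLie.

Section JordanOrLie.
Variables (R : realType) (A : cstarAlgType R).
Implicit Types (a b x y : A) (i : bool).

(** Indexing both products by a boolean lets the two Leibniz inequalities be proved once. *)
Definition jlprod i a b : A := if i then jordan a b else lie a b.

Lemma cnorm_jlprod i a b : cnorm (jlprod i a b) <= cnorm a * cnorm b.
Proof. by case: i; [exact: cnorm_jordan | exact: cnorm_lie]. Qed.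

Lemma jlprod_sub i a b x y :
  jlprod i a b - jlprod i x y = jlprod i (a - x) b + jlprod i x (b - y).
Proof. by case: i; [exact: jordan_sub | exact: lie_sub]. Qed.

Lemma cnorm_jlprod_sub i a b x y : cnorm (jlprod i a b - jlprod i x y) <=
  cnorm (a - x) * cnorm b + cnorm x * cnorm (b - y).
Proof.
rewrite jlprod_sub; apply: le_trans (cnormD _ _) _.
by apply: lerD; exact: cnorm_jlprod.
Qed.

End JordanOrLie.

(** * L-seminorms through finite bounds *)

Section RealLipschitz.
Variables (R : realType) (A0 B0 : R).
Hypotheses (hA0 : 1 <= A0) (hB0 : 0 <= B0).

Definition leibniz_bound (K M N K' : R) := A0 * (K * N + M * K') + B0 * (K * K').

(** [Lseminorm] restated through real bounds L(a) <= K. This suits a seminorm defined as an infimum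
    or a maximum and avoids arithmetic with infinite values; the equivalence is [lip_of_Lseminorm]
    and [Lseminorm_of_lip]. *)
Record lip_axioms (A : cstarAlgType R) (L : A -> \bar R) : Prop := {
  lip_ge0 : forall a, (0 <= L a)%E ;
  lip_sa : forall a K, (L a <= K%:E)%E -> star a = a ;
  lip_add : forall a b K K', (L a <= K%:E)%E -> (L b <= K'%:E)%E ->
    (L (a + b)%R <= (K + K')%:E)%E ;
  lip_scale : forall t a K, (L a <= K%:E)%E -> (L (t%:C *: a)%R <= (`|t| * K)%:E)%E ;
  lip_jl : forall i a b K K', (L a <= K%:E)%E -> (L b <= K'%:E)%E ->
    (L (jlprod i a b) <= (leibniz_bound K (cnorm a) (cnorm b) K')%:E)%E ;
  lip_one : forall t : R, L (t%:C *: 1) = 0%E ;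
  lip_ker : forall a, L a = 0%E -> exists t : R, a = t%:C *: 1 ;
  lip_closed : forall a,
    (forall e, 0 < e -> exists2 b, (L b <= 1)%E & cnorm (a - b) < e) -> (L a <= 1)%E ;
  lip_dense : forall a e, star a = a -> 0 < e ->
    exists b K, [/\ 0 < K, (L b <= K%:E)%E & cnorm (a - b) < e] ;
  lip_mk : mk_weak_continuous L
}.

Section Equivalence.
Variables (A : cstarAlgType R) (L : A -> \bar R).
Implicit Types a b : A.

Lemma dom_le a K : (L a <= K%:E)%E -> dom L a.
Proof. by move=> h; apply: le_lt_trans h (ltry _). Qed.

Lemma dom_fin a : (forall a, (0 <= L a)%E) -> dom L a ->
  exists2 u : R, 0 <= u & L a = u%:E.
Proof.
move=> L0; rewrite /dom /=; have := L0 a; case: (L a) => [u| |] //.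
by rewrite lee_fin => u0 _; exists u.
Qed.

Lemma leibniz_bound_le u v K K' M N : 0 <= u <= K -> 0 <= v <= K' ->
  0 <= M -> 0 <= N -> leibniz_bound u M N v <= leibniz_bound K M N K'.
Proof.
move=> /andP[u0 uK] /andP[v0 vK] M0 N0; rewrite /leibniz_bound.
have A00 : 0 <= A0 by exact: le_trans hA0.
apply: lerD; last by apply: ler_wpM2l => //; exact: ler_pM.
by apply: ler_wpM2l => //; apply: lerD; [apply: ler_wpM2r | apply: ler_wpM2l].
Qed.

Lemma leibniz_boundE u v M N : (leibniz_bound u M N v)%:E =
  (A0%:E * (u%:E * N%:E + M%:E * v%:E) + B0%:E * (u%:E * v%:E))%E.
Proof. by rewrite /leibniz_bound EFinD !EFinM EFinD !EFinM. Qed.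

Lemma lip_of_Lseminorm : Lseminorm A0 B0 L -> lip_axioms L.
Proof.
case=> [[L0 LD LZ] [sa _ _ _ jl] ds ker met leib cl].
have mono a K u : L a = u%:E -> 0 <= u -> (L a <= K%:E)%E -> 0 <= u <= K.
  by move=> -> -> /=; rewrite lee_fin.
have Lone (t : R) : L (t%:C *: 1) = 0%E.
  have : [set a | L a = 0%E] (t%:C *: 1) by rewrite ker; exists t.
  by [].
split => //.
- by move=> a K /dom_le /sa.
- move=> a b K K' aK bK; apply: le_trans (LD _ _ (dom_le aK) (dom_le bK)) _.
  by rewrite EFinD; exact: leeD.
- move=> t a K aK; rewrite LZ ?EFinM; last exact: dom_le aK.
  by apply: lee_wpmul2l => //; rewrite lee_fin.
- move=> i a b K K' aK bK.
  have [u u0 uE] := dom_fin L0 (dom_le aK).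
  have [v v0 vE] := dom_fin L0 (dom_le bK).
  apply: (@le_trans _ _ (leibniz_bound u (cnorm a) (cnorm b) v)%:E); last first.
    rewrite lee_fin; apply: leibniz_bound_le;
      [exact: (mono a)|exact: (mono b)| |]; exact: cnorm_ge0.
  have := leib a b (dom_le aK) (dom_le bK).
  rewrite uE vE -leibniz_boundE ge_max => /andP[].
  by case: i.
- move=> a /= a0; have : [set t%:C *: 1 | t in [set: R]] a by rewrite -ker.
  by move=> [t _ <-]; exists t.
- by move/closed_cnormP : cl.
- move=> a e asa e0.
  have /closure_cnormP /(_ e e0) [b bd ab] := ds a asa.
  have [u u0 uE] := dom_fin L0 bd.
  by exists b, (u + 1); split=> //; [lra | rewrite uE lee_fin; lra].
- exact: metrizes_weak_continuous (fun a h => sa a (dom_le h)) met.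
Qed.

Lemma Lseminorm_of_lip : lip_axioms L -> Lseminorm A0 B0 L.
Proof.
move=> H; have L0 := lip_ge0 H.
have Lz : L 0 = 0%E by have := lip_one H 0; rewrite scale0r.
have fin a : dom L a -> exists u : R, [/\ 0 <= u, L a = u%:E & (L a <= u%:E)%E].
  by move=> /(dom_fin L0) [u u0 uE]; exists u; rewrite uE.
split.
- split => //.
    move=> a b /fin [u [u0 uE uL]] /fin [v [v0 vE vL]].
    by rewrite uE vE -EFinD; exact: lip_add.
  move=> t a /fin [u [u0 uE uL]]; apply/eqP; rewrite eq_le; apply/andP; split.
    by rewrite uE -EFinM; exact: lip_scale.
  have [->|t0] := eqVneq t 0; first by rewrite normr0 mul0e.
  have := lip_scale H t uL => /dom_le /fin [v [v0 vE vL]].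
  have := lip_scale H t^-1 vL; rewrite scalerA -rmorphM mulVf// scale1r uE vE.
  by rewrite -EFinM !lee_fin normfV ler_pdivlMl// normr_gt0.
- split.
  + by move=> a /fin [u [_ _ uL]]; exact: (lip_sa H uL).
  + by rewrite /dom /= Lz.
  + by move=> a b /fin [u [_ _ uL]] /fin [v [_ _ vL]]; apply: dom_le (lip_add H uL vL).
  + by move=> t a /fin [u [_ _ uL]]; apply: dom_le (lip_scale H t uL).
  + move=> a b /fin [u [_ _ uL]] /fin [v [_ _ vL]].
    by split; [apply: dom_le (lip_jl H true uL vL) | apply: dom_le (lip_jl H false uL vL)].
- move=> a asa; apply/closure_cnormP => e e0.
  have [b [K [_ bK ab]]] := lip_dense H asa e0.
  by exists b => //; exact: dom_le bK.
- apply/seteqP; split=> [a /= /(lip_ker H) [t ->]|_ [t _ <-]]; first by exists t.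
  exact: lip_one.
- have Lsa a : (L a <= 1)%E -> star a = a by exact: lip_sa.
  exact: (weak_continuous_metrizes Lsa (lip_scale H) Lz (lip_dense H) (lip_mk H)).
- move=> a b /fin [u [_ uE uL]] /fin [v [_ vE vL]].
  rewrite uE vE -leibniz_boundE ge_max.
  by rewrite (lip_jl H true uL vL) (lip_jl H false uL vL).
- by apply/closed_cnormP; exact: (lip_closed H).
Qed.

Lemma strongly_leibnizP C : 0 <= C -> (forall a, (0 <= L a)%E) ->
  strongly_leibniz C L <-> forall a b K, (L a <= K%:E)%E -> a * b = 1 -> b * a = 1 ->
    (L b <= (C * cnorm b ^+ 2 * K)%:E)%E.
Proof.
move=> C0 L0; split=> [h a b K aK ab ba|h a b].
  have [_] := h a b (dom_le aK) ab ba.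
  move=> /le_trans; apply; rewrite [leRHS]EFinM; apply: lee_wpmul2l => //.
  by rewrite lee_fin mulr_ge0// sqr_ge0.
move=> /(dom_fin L0) [u u0 uE] ab ba.
have := h a b u _ ab ba; rewrite uE lexx => /(_ isT) bL.
by split; [exact: dom_le bL | rewrite -EFinM].
Qed.

End Equivalence.
End RealLipschitz.

                    

                                                                                
                                           
(** * The direct sum of two C*-algebras *)

Definition dsum (R : realType) (A1 A2 : cstarAlgType R) : Type := (A1 * A2)%type.

Section DirectSum.
Variables (R : realType) (A1 A2 : cstarAlgType R).
Local Notation D := (dsum A1 A2).

HB.instance Definition _ := GRing.Algebra.copy D (A1 * A2)%type.

(** The C*-norm of the sum. It is put on the alias [dsum] so that norm and topology come from here
    and not from the instances on pairs. *)
Definition dsum_norm (x : D) : R := Num.max (cnorm x.1) (cnorm x.2).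

Let dsum_normD x y : dsum_norm (x + y) <= dsum_norm x + dsum_norm y.
Proof.
rewrite /dsum_norm ge_max; apply/andP; split.
  by apply: le_trans (cnormD _ _) _; apply: lerD; rewrite le_max lexx.
by apply: le_trans (cnormD _ _) _; apply: lerD; rewrite le_max lexx orbT.
Qed.

Let dsum_normZ (z : R[i]) x : (dsum_norm (z *: x))%:C = `|z| * (dsum_norm x)%:C.
Proof.
have [r0 zE] : 0 <= complex.Re `|z| /\ `|z| = (complex.Re `|z|)%:C.
  by rewrite normc_def /=; split=> //; exact: sqrtr_ge0.
have nZ (A : cstarAlgType R) (a : A) : cnorm (z *: a) = complex.Re `|z| * cnorm a.
  have := cnormZ z a; rewrite {1}zE -rmorphM.
  by move=> /(congr1 (@complex.Re R)).
by rewrite zE -rmorphM /dsum_norm maxr_pMr// -!nZ.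
Qed.

Let dsum_norm_eq0 x : dsum_norm x = 0 -> x = 0.
Proof.
move=> x0; have h : (cnorm x.1 <= 0) && (cnorm x.2 <= 0) by rewrite -ge_max -[leRHS]x0.
case: x h {x0} => a b /= /andP[a0 b0].
have a1 : cnorm a = 0 by apply/eqP; rewrite eq_le a0 cnorm_ge0.
have b1 : cnorm b = 0 by apply/eqP; rewrite eq_le b0 cnorm_ge0.
by rewrite (cnorm_eq0 _ a1) (cnorm_eq0 _ b1).
Qed.

Let dsum_normM x y : dsum_norm (x * y) <= dsum_norm x * dsum_norm y.
Proof.
rewrite /dsum_norm ge_max; apply/andP; split.
  by apply: le_trans (cnormM _ _) _; apply: ler_pM; rewrite ?cnorm_ge0// le_max lexx.
by apply: le_trans (cnormM _ _) _; apply: ler_pM; rewrite ?cnorm_ge0// le_max lexx orbT.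
Qed.

HB.instance Definition _ := isNormedAlgebra.Build R D
  dsum_normD dsum_normZ dsum_norm_eq0 dsum_normM.

Definition dsum_star (x : D) : D := (star x.1, star x.2).

Let dsum_starK : involutive dsum_star.
Proof. by move=> [a b]; rewrite /dsum_star /= !starK. Qed.

Let dsum_starD : {morph dsum_star : x y / x + y}.
Proof. by move=> [a b] [c d]; congr pair; rewrite /= starD. Qed.

Let dsum_starZ (z : R[i]) (x : D) : dsum_star (z *: x) = z^*%C *: dsum_star x.
Proof. by case: x => a b; congr pair; rewrite /= starZ. Qed.

Let dsum_starM (x y : D) : dsum_star (x * y) = dsum_star y * dsum_star x.
Proof. by case: x y => [a b] [c d]; congr pair; rewrite /= starM. Qed.

Let dsum_identity (x : D) : cnorm (dsum_star x * x) = cnorm x ^+ 2.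
Proof.
rewrite /cnorm /= /dsum_norm /= !cstar_identity.
have := cnorm_ge0 x.1; have := cnorm_ge0 x.2.
move: (cnorm x.1) (cnorm x.2) => u v v0 u0.
case: (leP u v) => uv.
  by rewrite max_r// lerXn2r// nnegrE.
by rewrite max_l// lerXn2r// ?nnegrE// ltW.
Qed.

Let U : normedAlgType R := D.

Let dsum_ball (x y : U) (e : R[i]) :
  ball x e y <-> ball x.1 e y.1 /\ ball x.2 e y.2.
Proof.
rewrite -!ball_normE /ball_ /=.
rewrite -[`|x - y|]/((Num.max (cnorm (x.1 - y.1)) (cnorm (x.2 - y.2)))%:C).
rewrite -[`|x.1 - y.1|]/((cnorm (x.1 - y.1))%:C) -[`|x.2 - y.2|]/((cnorm (x.2 - y.2))%:C).
case: e => u v; rewrite !ltcE /= gt_max.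
by split=> [/andP[-> /andP[-> ->]]|[/andP[-> ->] /andP[_ ->]]].
Qed.

Let dsum_complete : complete_norm U.
Proof.
move=> F FF /cauchy_ballP Fc.
pose G1 : set_system A1 := (fst : U -> A1) @ F.
have Gc1 : cauchy G1.
  apply/cauchy_ballP => e e0.
  have [[B C] /= [FB FC] BC] := Fc e e0.
  exists ((fst : U -> A1) @` B, (fst : U -> A1) @` C) => /=.
    by split; [apply: filterS FB | apply: filterS FC] => x ? /=; exists x.
  move=> [_ _] /= [[x Bx <-] [y Cy <-]].
  by have /dsum_ball [] :=  BC (x, y) (conj Bx Cy).
have [l1 Fl1] : exists l : A1, G1 --> l.
  by apply/cvg_ex; exact: cauchy_cvg.
pose G2 : set_system A2 := (snd : U -> A2) @ F.
have Gc2 : cauchy G2.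
  apply/cauchy_ballP => e e0.
  have [[B C] /= [FB FC] BC] := Fc e e0.
  exists ((snd : U -> A2) @` B, (snd : U -> A2) @` C) => /=.
    by split; [apply: filterS FB | apply: filterS FC] => x ? /=; exists x.
  move=> [_ _] /= [[x Bx <-] [y Cy <-]].
  by have /dsum_ball [] :=  BC (x, y) (conj Bx Cy).
have [l2 Fl2] : exists l : A2, G2 --> l.
  by apply/cvg_ex; exact: cauchy_cvg.
apply/(@cvg_ex U); exists ((l1, l2) : U); apply/cvg_ballP => e e0.
move/cvg_ballP: Fl1 => /(_ e e0) h1; move/cvg_ballP: Fl2 => /(_ e e0) h2.
by apply: filterS2 h1 h2 => x hx1 hx2; apply/dsum_ball.
Qed.

HB.instance Definition _ := isCstarAlgebra.Build R D
  dsum_starK dsum_starD dsum_starZ dsum_starM dsum_identity dsum_complete.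

Definition dfst (x : D) : A1 := x.1.
Definition dsnd (x : D) : A2 := x.2.

HB.instance Definition _ := GRing.LRMorphism.copy dfst (@fst A1 A2).
HB.instance Definition _ := GRing.LRMorphism.copy dsnd (@snd A1 A2).

End DirectSum.

                            

(** * Uniform weak* continuity of positive functionals *)

Section FunctionalContinuity.
Variables (R : realType) (A : cstarAlgType R).
Implicit Types (f g : A -> R[i]) (a h : A).

Lemma pf_normalize g : positive_functional g -> 0 < complex.Re (g 1) ->
  exists chi : state A, forall a, complex.Re (g a) = complex.Re (g 1) * rstate chi a.
Proof.
move=> gP s0; set s := complex.Re (g 1) in s0 *.
have sn0 : s != 0 by rewrite gt_eqF.
have cP := positive_functional_comb gP gP (_ : 0 <= s^-1) (lexx 0).
have {cP} cP := cP (ltW _); rewrite invr_gt0 in cP; have {}cP := cP s0.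
have [|chi chiE] := state_of_functional cP.
  by rewrite mul0r addr0 (pf_saE gP (star1 A)) -rmorphM mulVf.
by exists chi => a; rewrite /rstate chiE mul0r addr0 Re_mulr mulVKf.
Qed.

Variable (L : A -> \bar R).
Hypothesis Lsa : forall a, (L a <= 1)%E -> star a = a.

(** Scalars have Lipschitz value 0, so functionals of different mass cannot be close uniformly on
    the Lipschitz ball; subtracting the value at a reference state removes this obstruction. *)
Definition centered (theta : state A) a : A := a - (rstate theta a)%:C *: 1.

Lemma centered_sa theta a : star a = a -> star (centered theta a) = centered theta a.
Proof. by move=> asa; rewrite /centered starB starZr star1 asa. Qed.

Lemma rstate_centered chi theta a :
  rstate chi (centered theta a) = rstate chi a - rstate theta a.
Proof.
by rewrite /centered rstateB rstateZ rstate1 mulr1.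
Qed.

Lemma pf_centered_bound r theta g a :
  (forall phi psi a, (L a <= 1)%E -> `|rstate phi a - rstate psi a| <= r) ->
  positive_functional g -> (L a <= 1)%E ->
  `|complex.Re (g (centered theta a))| <= complex.Re (g 1) * r.
Proof.
move=> diam gP La; have := pf1_ge0 gP; rewrite lecE /= => /andP[_].
rewrite le_eqVlt => /orP[/eqP s0|s0].
  have := pf_sa_bound gP (centered_sa theta (Lsa La)).
  by rewrite -s0 mulr0 mul0r.
have [chi chiE] := pf_normalize gP s0.
rewrite chiE normrM gtr0_norm// rstate_centered; apply: ler_wpM2l; first exact: ltW.
exact: diam.
Qed.

(** If f(1) = 0 then f vanishes on self-adjoint elements, and a small g(1) suffices. Otherwise f and
    g are normalized to states and the difference of masses is charged to the diameter [r]. *)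
Lemma pf_weak_continuous theta f e :
  mk_weak_continuous L -> positive_functional f -> 0 < e ->
  exists (l : seq A) (d : R), [/\ 0 < d, (forall h, h \in l -> star h = h)
    & forall g, positive_functional g ->
      (forall h, h \in l -> `|complex.Re (f h) - complex.Re (g h)| < d) ->
      forall a, (L a <= 1)%E ->
        `|complex.Re (f (centered theta a)) - complex.Re (g (centered theta a))| <= e].
Proof.
move=> mc fP e0; have [r r0 diam] := mk_diameter mc.
set t := complex.Re (f 1).
have r1 : 0 < r + 1 by lra.
have := pf1_ge0 fP; rewrite lecE /= => /andP[_].
rewrite -/t le_eqVlt => /orP[/eqP t0|t0].
  exists [:: 1], (e / (r + 1)); split; first by rewrite divr_gt0.
    by move=> h; rewrite inE => /eqP ->; exact: star1.
  move=> g gP /(_ 1); rewrite inE eqxx => /(_ isT) + a La.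
  have := pf_centered_bound theta diam fP La; rewrite -/t -t0 mul0r => fa.
  have /eqP -> : complex.Re (f (centered theta a)) == 0.
    by rewrite -normr_eq0 eq_le fa normr_ge0.
  rewrite !sub0r !normrN ltr_pdivlMr// => ge.
  apply: le_trans (pf_centered_bound theta diam gP La) _.
  have := ler_norm (complex.Re (g 1)); have := normr_ge0 (complex.Re (g 1)); nra.
have [phi phiE] := pf_normalize fP t0.
have tn0 : t != 0 by rewrite gt_eqF.
have e1 : 0 < e / (2 * t) by rewrite divr_gt0// mulr_gt0.
have [l [d [d0 lsa ld]]] := mc phi _ e1.
pose N := \sum_(h <- l) cnorm h.
have N0 : 0 <= N by apply: sumr_ge0 => h _; exact: cnorm_ge0.
have lN h : h \in l -> cnorm h <= N.
  move=> hl; rewrite /N (big_rem h)//= lerDl.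
  by apply: sumr_ge0 => k _; exact: cnorm_ge0.
have N1 : 0 < 1 + N by lra.
have [d' [d'0 d't d'N d'r]] : exists d', [/\ 0 < d', d' <= t / 2,
    d' * (1 + N) <= d * t & d' * r <= e / 2].
  (* The first bound keeps g(1) positive, the second makes the normalized states [d]-close on [l],
     the third bounds the effect of the change of mass by e/2. *)
  exists (Num.min (t / 2) (Num.min (d * t / (1 + N)) (e / 2 / (r + 1)))); split.
  - by rewrite !lt_min !divr_gt0// mulr_gt0.
  - by rewrite ge_min lexx.
  - by rewrite -ler_pdivlMr// !ge_min lexx orbT.
  - apply: le_trans (_ : e / 2 / (r + 1) * (r + 1) <= _); last by rewrite divfK// gt_eqF.
    apply: ler_pM => //; [by rewrite !le_min !divr_ge0// ?mulr_ge0 ?ltW| |lra].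
    by rewrite !ge_min lexx !orbT.
exists (1 :: l), d'; split=> //.
  by move=> h; rewrite inE => /orP[/eqP ->|/lsa//]; exact: star1.
move=> g gP near a La.
have := near 1; rewrite inE eqxx => /(_ isT); rewrite -/t; set s := complex.Re (g 1) => ts.
have s0 : 0 < s by move: ts; rewrite ltr_norml; lra.
have [chi chiE] := pf_normalize gP s0; rewrite -/s in chiE.
have nearchi : weak_near phi l d chi.
  move=> h hl; have := near h; rewrite inE hl orbT => /(_ isT).
  rewrite phiE chiE -/t => fg; rewrite -(ltr_pM2l t0).
  have chb := rstate_bound chi (lsa _ hl).
  have -> : t * `|rstate phi h - rstate chi h| =
      `|(t * rstate phi h - s * rstate chi h) - (t - s) * rstate chi h|.
    by rewrite -{1}(gtr0_norm t0) -normrM; congr Num.norm; ring.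
  apply: le_lt_trans (ler_normB _ _) _; rewrite normrM.
  have := lN _ hl; have := normr_ge0 (t - s); have := normr_ge0 (rstate chi h); nra.
rewrite phiE chiE -/t.
have -> : t * rstate phi (centered theta a) - s * rstate chi (centered theta a) =
   t * (rstate phi a - rstate chi a) + (t - s) * rstate chi (centered theta a).
  by rewrite !rstate_centered; ring.
apply: le_trans (ler_normD _ _) _; rewrite !normrM gtr0_norm//.
have h1 := ld chi nearchi a La.
have h2 : `|rstate chi (centered theta a)| <= r by rewrite rstate_centered; exact: diam.
have h3 : t * `|rstate phi a - rstate chi a| <= e / 2.
  apply: le_trans (ler_wpM2l (ltW t0) h1) _.
  by rewrite le_eqVlt; apply/orP; left; apply/eqP; field.
have := normr_ge0 (t - s); nra.
Qed.

End FunctionalContinuity.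

(** * The bridge seminorm on the direct sum *)

Section Bridge.
Variables (R : realType) (A0 B0 : R).
Hypotheses (hA0 : 1 <= A0) (hB0 : 0 <= B0).
Variables (A : cstarAlgType R) (S : cstarSubalg A).
Local Notation A1 := (subalg_type S).
Variables (L1 : A1 -> \bar R) (L2 : A -> \bar R) (c : R).
Hypotheses (H1 : lip_axioms A0 B0 L1) (H2 : lip_axioms A0 B0 L2) (c0 : 0 < c).
Local Notation D := (dsum A1 A).
Implicit Types (x y : D) (K : R).

Definition bridge_lip x : \bar R :=
  maxe (L1 x.1) (maxe (L2 x.2) ((cnorm (val x.1 - x.2) / c)%:E)).

Lemma bridge_lipP x K : (bridge_lip x <= K%:E)%E <->
  [/\ (L1 x.1 <= K%:E)%E, (L2 x.2 <= K%:E)%E & cnorm (val x.1 - x.2) <= K * c].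
Proof.
rewrite /bridge_lip !ge_max lee_fin ler_pdivrMr//.
by split=> [/and3P[]|[-> -> ->]].
Qed.

Lemma val_jlprod i (a b : A1) : val (jlprod i a b) = jlprod i (val a) (val b).
Proof. by case: i. Qed.

Lemma dsum_jlprod i x y : jlprod i x y = (jlprod i x.1 y.1, jlprod i x.2 y.2) :> D.
Proof. by case: i. Qed.

Lemma dsum_norm1 x : cnorm x.1 <= cnorm x.
Proof. by rewrite -[cnorm x]/(Num.max (cnorm x.1) (cnorm x.2)) le_max lexx. Qed.

Lemma dsum_norm2 x : cnorm x.2 <= cnorm x.
Proof. by rewrite -[cnorm x]/(Num.max (cnorm x.1) (cnorm x.2)) le_max lexx orbT. Qed.

Lemma dsum_norm_lt x e : cnorm x.1 < e -> cnorm x.2 < e -> cnorm x < e.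
Proof. by rewrite -[cnorm x]/(Num.max (cnorm x.1) (cnorm x.2)) gt_max => -> ->. Qed.

Lemma lip_K_ge0 (B : cstarAlgType R) (L : B -> \bar R) a K :
  lip_axioms A0 B0 L -> (L a <= K%:E)%E -> 0 <= K.
Proof. by move=> H /(le_trans (lip_ge0 H a)); rewrite lee_fin. Qed.

Lemma dsum_star_eq x : star x.1 = x.1 -> star x.2 = x.2 -> star x = x.
Proof. by case: x => a b /= a1 b1; congr pair. Qed.

(** A state of the sum splits into positive functionals on the summands with masses adding to 1.
    Centering leaves one uncontrolled scalar, the mass of the second component times the difference
    of two reference values, and the third term of [bridge_lip] bounds that difference by [c]. *)
Lemma bridge_weak_continuous : mk_weak_continuous bridge_lip.
Proof.
have L1sa a : (L1 a <= 1)%E -> star a = a by exact: (lip_sa H1).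
have L2sa a : (L2 a <= 1)%E -> star a = a by exact: (lip_sa H2).
(* The reference state on [A] extends the one on the subalgebra, so their values on the two
   components of an element are comparable. *)
have [th1 _] := state_exists A1; have [th2 th12] := state_extension th1.
move=> phi e e0.
pose f1 (chi : state D) (a : A1) : R[i] := chi ((a, 0) : D).
pose f2 (chi : state D) (a : A) : R[i] := chi ((0, a) : D).
have f1P chi : positive_functional (f1 chi).
  rewrite /f1; split=> [z a b|a].
    have -> : ((z *: a + b, 0) : D) = z *: ((a, 0) : D) + ((b, 0) : D).
      by congr pair; rewrite /= scaler0 addr0.
    exact: (state_positive chi).1.
  have -> : ((star a * a, 0) : D) = star ((a, 0) : D) * ((a, 0) : D).
    by congr pair; rewrite /= mulr0.
  exact: state_ge0.
have f2P chi : positive_functional (f2 chi).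
  rewrite /f2; split=> [z a b|a].
    have -> : ((0, z *: a + b) : D) = z *: ((0, a) : D) + ((0, b) : D).
      by congr pair; rewrite /= scaler0 addr0.
    exact: (state_positive chi).1.
  have -> : ((0, star a * a) : D) = star ((0, a) : D) * ((0, a) : D).
    by congr pair; rewrite /= mulr0.
  exact: state_ge0.
have fD chi x : rstate chi x = complex.Re (f1 chi x.1) + complex.Re (f2 chi x.2).
  rewrite /f1 /f2 -raddfD -(pfD (state_positive chi)) /rstate.
  by congr (complex.Re (chi _)); case: x => a b; congr pair; rewrite ?addr0 ?add0r.
have e3 : 0 < e / 3 by rewrite divr_gt0.
have [l1 [d1 [d10 l1sa ld1]]] := pf_weak_continuous L1sa th1 (lip_mk H1) (f1P phi) e3.
have [l2 [d2 [d20 l2sa ld2]]] := pf_weak_continuous L2sa th2 (lip_mk H2) (f2P phi) e3.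
(* The element (0, 1) measures the mass of the second component; its tolerance e / 3 / c compensates
   the factor [c]. *)
exists (((0, 1) : D) :: [seq ((h, 0) : D) | h <- l1] ++ [seq ((0, h) : D) | h <- l2]).
exists (Num.min (e / 3 / c) (Num.min d1 d2)); split.
- by rewrite !lt_min d10 d20 divr_gt0.
- move=> h; rewrite inE mem_cat => /or3P[/eqP ->|/mapP[k kl ->]|/mapP[k kl ->]];
    apply: dsum_star_eq; rewrite ?star0 ?star1 ?l1sa ?l2sa//.
move=> psi near x /bridge_lipP [L1x L2x]; rewrite mul1r => xc.
have n1 h : h \in l1 -> `|complex.Re (f1 phi h) - complex.Re (f1 psi h)| < d1.
  move=> hl; have := near (h, 0); rewrite inE mem_cat map_f// orbT => /(_ isT).
  by rewrite !lt_min => /and3P[_].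
have n2 h : h \in l2 -> `|complex.Re (f2 phi h) - complex.Re (f2 psi h)| < d2.
  move=> hl; have := near (0, h); rewrite inE mem_cat orbC map_f ?orbT// => /(_ isT).
  by rewrite !lt_min => /and3P[_].
have n3 : `|complex.Re (f2 phi 1) - complex.Re (f2 psi 1)| * c <= e / 3.
  have := near (0, 1); rewrite inE eqxx => /(_ isT).
  by rewrite !lt_min => /andP[h _]; rewrite -ler_pdivlMr// ltW.
have b1 := ld1 _ (f1P psi) n1 _ L1x; have b2 := ld2 _ (f2P psi) n2 _ L2x.
have f12 chi : complex.Re (f1 chi 1) + complex.Re (f2 chi 1) = 1.
  by rewrite -(fD chi (1 : D)) rstate1.
have dec chi : rstate chi x = complex.Re (f1 chi (centered th1 x.1))
     + complex.Re (f2 chi (centered th2 x.2)) + rstate th1 x.1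
     + complex.Re (f2 chi 1) * (rstate th2 x.2 - rstate th1 x.1).
  rewrite fD /centered (pfB (f1P chi)) (pfB (f2P chi)) !raddfB /=.
  have := f12 chi; have := pf_re (f1P chi) (rstate th1 x.1) 0 1.
  have := pf_re (f2P chi) (rstate th2 x.2) 0 1.
  rewrite !add0r (pf0 (f1P chi)) (pf0 (f2P chi)) !add0r => -> -> h.
  have -> : complex.Re (f1 chi 1) = 1 - complex.Re (f2 chi 1) by rewrite -h addrK.
  ring.
have thc : `|rstate th2 x.2 - rstate th1 x.1| <= c.
  have x1sa := L1sa _ L1x; have x2sa := L2sa _ L2x.
  rewrite -th12// -rstateB; apply: le_trans (rstate_bound _ _) _.
    by rewrite starB x2sa; congr (_ - _); apply/sub_sa.
  by rewrite cnorm_distC.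
rewrite !dec; move: b1 b2; move: (complex.Re (f1 phi _)) (complex.Re (f1 psi _)).
move: (complex.Re (f2 phi (centered _ _))) (complex.Re (f2 psi (centered _ _))).
move: (rstate th1 x.1) (rstate th2 x.2) thc => t1 t2 thc u v u' v' b1 b2.
set w := complex.Re (f2 phi 1) in n3 *; set w' := complex.Re (f2 psi 1) in n3 *.
have -> : u' + u + t1 + w * (t2 - t1) - (v' + v + t1 + w' * (t2 - t1)) =
   (u' - v') + (u - v) + (w - w') * (t2 - t1) by ring.
apply: le_trans (ler_normD _ _) _.
have h := ler_normD (u' - v') (u - v).
rewrite normrM; have := normr_ge0 (w - w').
have : `|w - w'| * `|t2 - t1| <= `|w - w'| * c by apply: ler_wpM2l.
lra.
Qed.

Lemma bridge_lip_axioms : lip_axioms A0 B0 bridge_lip.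
Proof.
have nscale (t : R) : 0 <= `|t| by exact: normr_ge0.
split.
- by move=> x; rewrite /bridge_lip !le_max (lip_ge0 H1).
- move=> x K /bridge_lipP [h1 h2 _].
  by apply: dsum_star_eq; [exact: (lip_sa H1 h1)|exact: (lip_sa H2 h2)].
- move=> x y K K' /bridge_lipP [x1 x2 x3] /bridge_lipP [y1 y2 y3].
  apply/bridge_lipP; split; [exact: (lip_add H1)|exact: (lip_add H2)|].
  rewrite mulrDl; apply: le_trans (lerD x3 y3).
  by apply: le_trans (cnormD _ _); rewrite addrACA -opprD.
- move=> t x K /bridge_lipP [x1 x2 x3].
  apply/bridge_lipP; split; [exact: (lip_scale H1)|exact: (lip_scale H2)|].
  have -> : val (t%:C *: x).1 - (t%:C *: x).2 = t%:C *: (val x.1 - x.2).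
    by rewrite scalerBr.
  by rewrite cnormZr -mulrA; apply: ler_wpM2l.
- move=> i x y K K' /bridge_lipP [x1 x2 x3] /bridge_lipP [y1 y2 y3].
  have K0 := lip_K_ge0 H1 x1; have K'0 := lip_K_ge0 H1 y1.
  have mono (M M' N N' : R) : 0 <= M -> M <= M' -> 0 <= N -> N <= N' ->
      leibniz_bound A0 B0 K M N K' <= leibniz_bound A0 B0 K M' N' K'.
    move=> M0 MM N0 NN; rewrite /leibniz_bound lerD2r.
    apply: ler_wpM2l; first exact: le_trans hA0.
    by apply: lerD; [apply: ler_wpM2l | apply: ler_wpM2r].
  have nn := cnorm_ge0; have d1 := dsum_norm1; have d2 := dsum_norm2.
  apply/bridge_lipP; rewrite dsum_jlprod /=; split.
  + apply: le_trans (lip_jl H1 i x1 y1) _; rewrite lee_fin; exact: mono.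
  + apply: le_trans (lip_jl H2 i x2 y2) _; rewrite lee_fin; exact: mono.
  (* The distance between the components obeys a Leibniz rule with constant 1, which lies below the
     bound because A0 >= 1 and B0 >= 0. *)
  rewrite val_jlprod; apply: le_trans (cnorm_jlprod_sub _ _ _ _ _) _.
  have z1 : cnorm (val x.1 - x.2) * cnorm (val y.1) <= K * c * cnorm y.
    by apply: ler_pM; rewrite ?nn//; exact: (d1 y).
  have z2 : cnorm x.2 * cnorm (val y.1 - y.2) <= cnorm x * (K' * c).
    by apply: ler_pM; rewrite ?nn//; exact: d2.
  apply: le_trans (lerD z1 z2) _.
  have -> : K * c * cnorm y + cnorm x * (K' * c) = (K * cnorm y + cnorm x * K') * c by ring.
  apply: ler_wpM2r; first exact: ltW.
  rewrite /leibniz_bound -[leLHS]addr0; apply: lerD; last by rewrite !mulr_ge0.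
  by rewrite ler_peMl// addr_ge0// mulr_ge0 ?nn.
- move=> t; apply/eqP; rewrite eq_le; apply/andP; split.
    apply/bridge_lipP; rewrite !(lip_one H1, lip_one H2); split=> //.
    by rewrite -[val _]/(t%:C *: (1 : A)) subrr cnorm0 mul0r.
  by rewrite /bridge_lip le_max (lip_ge0 H1).
- move=> x x0; have : (bridge_lip x <= 0%:E)%E by rewrite x0.
  move=> /bridge_lipP [x1 _ x3].
  have : L1 x.1 = 0%E by apply/eqP; rewrite eq_le x1 (lip_ge0 H1).
  move=> /(lip_ker H1) [t xt]; exists t.
  have : cnorm (val x.1 - x.2) = 0.
    by apply/eqP; rewrite eq_le cnorm_ge0 andbT (le_trans x3)// mul0r.
  move=> /cnorm_eq0 /eqP; rewrite subr_eq0 => /eqP.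
  by case: x xt {x0 x1 x3} => a b /= -> <-.
- move=> x h; apply/bridge_lipP; rewrite mul1r; split.
  + apply: (lip_closed H1) => e /h [y /bridge_lipP [y1 _ _] xy].
    by exists y.1 => //; apply: le_lt_trans xy; exact: (dsum_norm1 (x - y)).
  + apply: (lip_closed H2) => e /h [y /bridge_lipP [_ y2 _] xy].
    by exists y.2 => //; apply: le_lt_trans xy; exact: (dsum_norm2 (x - y)).
  + apply/ler_addgt0Pr => e e0.
    have e2 : 0 < e / 2 by rewrite divr_gt0.
    have [y /bridge_lipP [_ _ +] xy] := h _ e2; rewrite mul1r => y3.
    have a1 : cnorm (val x.1 - val y.1) < e / 2.
      exact: le_lt_trans (dsum_norm1 (x - y)) xy.
    have a2 : cnorm (x.2 - y.2) < e / 2.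
      exact: le_lt_trans (dsum_norm2 (x - y)) xy.
    have := cnorm_triangle (val y.1) (val x.1) x.2.
    have := cnorm_triangle y.2 (val y.1) x.2.
    by rewrite (cnorm_distC y.2); lra.
- move=> x e xsa e0.
  have [x1sa x2sa] : star x.1 = x.1 /\ star x.2 = x.2.
    by split; [exact: (congr1 fst xsa) | exact: (congr1 snd xsa)].
  have [a [K [K0 aK xa]]] := lip_dense H1 x1sa e0.
  have [b [K' [K'0 bK xb]]] := lip_dense H2 x2sa e0.
  pose M := cnorm (val a - b) / c.
  have M0 : 0 <= M by rewrite divr_ge0 ?cnorm_ge0// ltW.
  exists ((a, b) : D), (K + K' + M); split.
  + lra.
  + apply/bridge_lipP; split=> /=.
    * by apply: le_trans aK _; rewrite lee_fin; lra.
    * by apply: le_trans bK _; rewrite lee_fin; lra.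
    * by rewrite -ler_pdivrMr// -/M; lra.
  + exact: dsum_norm_lt.
- exact: bridge_weak_continuous.
Qed.

Lemma bridge_strongly_leibniz C : 1 <= C ->
  strongly_leibniz C L1 -> strongly_leibniz C L2 -> strongly_leibniz C bridge_lip.
Proof.
move=> C1; have C0 : 0 <= C by exact: le_trans C1.
move=> /(strongly_leibnizP C0 (lip_ge0 H1)) sl1 /(strongly_leibnizP C0 (lip_ge0 H2)) sl2.
apply/(strongly_leibnizP C0 (lip_ge0 bridge_lip_axioms)).
move=> x y K /bridge_lipP [x1 x2 x3] xy yx.
have K0 := lip_K_ge0 H1 x1.
have xy1 : x.1 * y.1 = 1 by exact: (congr1 fst xy).
have xy2 : x.2 * y.2 = 1 by exact: (congr1 snd xy).
have yx1 : y.1 * x.1 = 1 by exact: (congr1 fst yx).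
have yx2 : y.2 * x.2 = 1 by exact: (congr1 snd yx).
have mono N : 0 <= N -> N <= cnorm y -> C * N ^+ 2 * K <= C * cnorm y ^+ 2 * K.
  move=> N0 Ny; apply: ler_wpM2r => //; apply: ler_wpM2l => //.
  by rewrite lerXn2r// nnegrE cnorm_ge0.
have nn := cnorm_ge0.
apply/bridge_lipP; split.
- apply: le_trans (sl1 _ _ _ x1 xy1 yx1) _; rewrite lee_fin.
  by apply: mono => //; exact: dsum_norm1.
- apply: le_trans (sl2 _ _ _ x2 xy2 yx2) _; rewrite lee_fin.
  by apply: mono => //; exact: dsum_norm2.
have vxy1 : val y.1 * val x.1 = 1 by exact: (congr1 val yx1).
(* The resolvent identity, giving the quadratic factor in the norm of the inverse; C >= 1 absorbs
   the constant. *)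
have -> : val y.1 - y.2 = val y.1 * (x.2 - val x.1) * y.2.
  by rewrite mulrBr mulrBl vxy1 mul1r -mulrA xy2 mulr1.
apply: (@le_trans _ _ (cnorm y * (K * c) * cnorm y)).
  apply: le_trans (cnormM _ _) _; apply: ler_pM; rewrite ?nn//; last exact: dsum_norm2.
  apply: le_trans (cnormM _ _) _; apply: ler_pM; rewrite ?nn//; first exact: (dsum_norm1 y).
  by rewrite cnorm_distC.
have -> : C * cnorm y ^+ 2 * K * c = C * (cnorm y * (K * c) * cnorm y) by ring.
by rewrite ler_peMl// !mulr_ge0 ?nn// ltW.
Qed.

End Bridge.

(** * The bridge as a tunnel and its extent *)

Section Hausdorff.
Variables (R : realType) (T : Type) (d : T -> T -> \bar R).
Implicit Types (X Y : set T).

Lemma hausdorff_setT_le Y (c : R) : (forall y, d y y = 0)%E -> 0 <= c ->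
  (forall x, exists2 y, Y y & (d x y <= c%:E)%E) ->
  (hausdorff_dist d setT Y <= c%:E)%E.
Proof.
move=> d0 c0 h; rewrite /hausdorff_dist ge_max; apply/andP; split.
  apply: ge_ereal_sup => _ [x _ <-]; have [y Yy xy] := h x.
  by apply: le_trans xy; apply: ereal_inf_lbound; exists y.
apply: ge_ereal_sup => _ [y Yy <-].
apply: (@le_trans _ _ 0%E); last by rewrite lee_fin.
by rewrite -(d0 y); apply: ereal_inf_lbound; exists y.
Qed.

Lemma hausdorff_ge0 X Y : (forall x y, 0 <= d x y)%E -> X !=set0 ->
  (0 <= hausdorff_dist d X Y)%E.
Proof.
move=> d0 [x Xx]; rewrite /hausdorff_dist le_max; apply/orP; left.
apply: (@le_trans _ _ (ereal_inf [set d x y | y in Y])).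
  by apply: le_ereal_inf_tmp => _ [y _ <-].
by apply: ereal_sup_ubound; exists x.
Qed.

End Hausdorff.

Section Pullback.
Variables (R : realType) (D A : cstarAlgType R) (pi : {lrmorphism D -> A}).
Hypothesis pi_star : forall d, pi (star d) = star (pi d).

Lemma state_pullback (psi : state A) :
  exists2 chi : state D, pullback_states pi chi & forall x, rstate chi x = rstate psi (pi x).
Proof.
have cP : positive_functional (fun d => psi (pi d) : R[i]).
  split=> [z x y|x]; first by rewrite linearP (state_positive psi).1.
  have -> : pi (star x * x) = star (pi x) * pi x by rewrite rmorphM /= pi_star.
  exact: state_ge0.
have [|chi chiE] := state_of_functional cP; first by rewrite rmorph1 state1.
exists chi; first by exists psi; apply/funext => d; exact: chiE.
by move=> x; rewrite /rstate chiE.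
Qed.

End Pullback.

Section PropinquityNonnegative.
Variables (R : realType) (A0 B0 C : R) (A1 A2 : cstarAlgType R).
Variables (L1 : A1 -> \bar R) (L2 : A2 -> \bar R).

Lemma extent_ge0 (tau : tunnel A0 B0 L1 L2) : (0 <= extent tau)%E.
Proof.
rewrite /extent le_max hausdorff_ge0//.
  move=> phi psi; have [h _ _ _ _] := Lip_mk (tunnel_qcms tau).
  by case/andP: (h phi psi).
by have [phi _] := state_exists (tunnel_alg tau); exists phi.
Qed.

Lemma propinquity_ge0 : (0 <= propinquity_SL A0 B0 C L1 L2)%E.
Proof. by apply: le_ereal_inf_tmp => _ [tau [_ ->]]; exact: extent_ge0. Qed.

End PropinquityNonnegative.

Section BridgeTunnel.
Variables (R : realType) (A0 B0 C : R).
Hypotheses (hA0 : 1 <= A0) (hB0 : 0 <= B0) (hC : 1 <= C).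
Variables (A : cstarAlgType R) (S : cstarSubalg A).
Local Notation A1 := (subalg_type S).
Variables (L1 : A1 -> \bar R) (L2 : A -> \bar R) (c : R).
Hypotheses (H1 : lip_axioms A0 B0 L1) (H2 : lip_axioms A0 B0 L2) (c0 : 0 < c).
Hypotheses (SL1 : strongly_leibniz C L1) (SL2 : strongly_leibniz C L2).
Hypothesis L12 : forall a : A1, (L2 (val a) <= L1 a)%E.
Hypothesis L21 : forall (b : A) K K', (L2 b <= K%:E)%E -> K < K' ->
  exists2 a : A1, (L1 a <= K'%:E)%E & cnorm (val a - b) <= K' * c.
Local Notation D := (dsum A1 A).
Local Notation LD := (bridge_lip L1 L2 c).
Let HD : lip_axioms A0 B0 LD := bridge_lip_axioms hA0 hB0 H1 H2 c0.

(** The diagonal lift of [a] attains the infimum: its components coincide, and L2 does not exceed L1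
    on the subalgebra. *)
Lemma bridge_left_isometry : quantum_isometry LD L1 (@dfst R A1 A).
Proof.
have LDa (a : A1) : (LD ((a, val a) : D) <= L1 a)%E.
  rewrite /bridge_lip /= subrr cnorm0 mul0r !ge_max lexx L12 /=.
  exact: lip_ge0 H1 a.
have Lle (d : D) : (L1 (dfst d) <= LD d)%E by rewrite /bridge_lip le_max lexx.
split=> //.
- by move=> a; exists ((a, val a) : D).
- by move=> d; apply: le_lt_trans; exact: Lle.
- move=> a ad; apply/eqP; rewrite eq_le; apply/andP; split.
    by apply: le_ereal_inf_tmp => _ [d [_ <-] <-]; exact: Lle.
  apply: le_trans (LDa a); apply: ereal_inf_lbound.
  by exists ((a, val a) : D) => //; split=> //; exact: le_lt_trans (LDa a) ad.
Qed.

(** Here a lift is found only up to an arbitrary [e], since [L21] requires a strictly larger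
    constant; this is enough for the infimum. *)
Lemma bridge_right_isometry : quantum_isometry LD L2 (@dsnd R A1 A).
Proof.
have Lle (d : D) : (L2 (dsnd d) <= LD d)%E.
  by rewrite /bridge_lip !le_max lexx orbT.
split=> //.
- by move=> b; exists ((0, b) : D).
- by move=> d; apply: le_lt_trans; exact: Lle.
- move=> b bd; apply/eqP; rewrite eq_le; apply/andP; split.
    by apply: le_ereal_inf_tmp => _ [d [_ <-] <-]; exact: Lle.
  have [u u0 uE] := dom_fin (lip_ge0 H2) bd; rewrite uE.
  apply/lee_addgt0Pr => e e0; rewrite -EFinD.
  have [||a aK ab] := L21 (K := u) (K' := u + e) (b := b).
  - by rewrite uE.
  - by rewrite ltrDl.
  have LDab : (LD ((a, b) : D) <= (u + e)%:E)%E.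
    by apply/bridge_lipP => //; split=> //=; rewrite uE lee_fin lerDl ltW.
  apply: le_trans (LDab); apply: ereal_inf_lbound.
  by exists ((a, b) : D) => //; split=> //; exact: le_lt_trans LDab (ltry _).
Qed.

Definition bridge_tunnel : tunnel A0 B0 L1 L2 :=
  Tunnel (Lseminorm_of_lip HD) bridge_left_isometry bridge_right_isometry.

Let LDsa (x : D) : (LD x <= 1)%E -> star x = x.
Proof. exact: (lip_sa HD). Qed.

(** [psi] is [phi] composed with the diagonal embedding of the subalgebra; x and the diagonal lift
    of its first component differ by (0, x.2 - x.1), of norm at most [c]. *)
Let to_left (phi : state D) : exists psi : state A1,
  forall x, (LD x <= 1)%E -> `|rstate phi x - rstate psi (dfst x)| <= c.
Proof.
have cP : positive_functional (fun a : A1 => phi ((a, val a) : D) : R[i]).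
  split=> [z x y|x]; last by have := state_ge0 phi ((x, val x) : D).
  by rewrite -(state_positive phi).1.
have [|psi psiE] := state_of_functional cP; first exact: state1.
exists psi => x LDx; rewrite {2}/rstate psiE -/(rstate phi _) -rstateB.
have [_ _] := (bridge_lipP _ _ c0 _ _).1 LDx; rewrite mul1r => xc.
have xsa := LDsa LDx.
have e : x - ((dfst x, val (dfst x)) : D) = ((0, x.2 - val x.1) : D).
  by case: x {LDx xc xsa} => a b; congr pair; rewrite /= subrr.
rewrite e; apply: le_trans (rstate_bound _ _) _.
  apply: dsum_star_eq; first exact: star0.
  rewrite /= starB (congr1 snd xsa : star x.2 = x.2).
  by rewrite -val_star (congr1 fst xsa : star x.1 = x.1).
rewrite -[cnorm _]/(Num.max (cnorm (0 : A1)) (cnorm (x.2 - val x.1))).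
by rewrite ge_max cnorm0 ltW//= cnorm_distC.
Qed.

(** Reaching a state of the left summand costs [c]. Extending it to [A] and evaluating on the second
    component instead of the first costs another [c]. *)
Lemma bridge_extent : (extent bridge_tunnel <= (2 * c)%:E)%E.
Proof.
have mk0 : forall phi : state D, mk LD phi phi = 0%E.
  have [_ h _ _ _] := Lip_mk (Lseminorm_of_lip HD).
  by move=> phi; apply/h.
have c20 : 0 <= 2 * c by rewrite mulr_ge0// ltW.
rewrite /extent ge_max; apply/andP; split; apply: hausdorff_setT_le => // phi.
  have [psi psiE] := to_left phi.
  have [chi pchi chiE] := @state_pullback R D A1 (@dfst R A1 A) (fun=> erefl) psi.
  exists chi => //; apply/(mk_leP LDsa) => x LDx; rewrite chiE.
  by apply: le_trans (psiE x LDx) _; lra.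
have [psi psiE] := to_left phi.
have [ext extE] := state_extension psi.
have [chi pchi chiE] := @state_pullback R D A (@dsnd R A1 A) (fun=> erefl) ext.
exists chi => //; apply/(mk_leP LDsa) => x LDx; rewrite chiE.
have [_ _] := (bridge_lipP _ _ c0 _ _).1 LDx; rewrite mul1r => xc.
have xsa := LDsa LDx.
have x1sa : star x.1 = x.1 := congr1 fst xsa.
have x2sa : star x.2 = x.2 := congr1 snd xsa.
have h1 := psiE x LDx; rewrite -extE// in h1.
have h2 : `|rstate ext (val x.1) - rstate ext x.2| <= c.
  rewrite -rstateB; apply: le_trans xc; apply: rstate_bound.
  by rewrite starB x2sa -val_star x1sa.
move: h1 h2; rewrite /dfst /dsnd !ler_norml; lra.
Qed.

Lemma bridge_propinquity : (propinquity_SL A0 B0 C L1 L2 <= (2 * c)%:E)%E.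
Proof.
apply: le_trans bridge_extent; apply: ereal_inf_lbound.
exists bridge_tunnel; split=> //.
exact: (bridge_strongly_leibniz hA0 hB0 H1 H2 c0 hC SL1 SL2).
Qed.

End BridgeTunnel.

                           

(** * The limit seminorm *)

Section LimitSeminorm.
Variables (R : realType) (A0 B0 C : R).
Hypotheses (hA0 : 1 <= A0) (hB0 : 0 <= B0) (hC : 1 <= C).
Variables (A : cstarAlgType R) (An : nat -> cstarSubalg A).
Local Notation T n := (subalg_type (An n)).
Hypothesis An_nondecreasing : forall n, An n `<=` An n.+1.
Hypothesis An_dense : closure (\bigcup_n (An n : set A)) = setT.
Variable Ln : forall n, T n -> \bar R.
Hypothesis HL : forall n, lip_axioms A0 B0 (@Ln n).
Hypothesis SL : forall n, strongly_leibniz C (@Ln n).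
Variables beta sigma : nat -> R.
Hypothesis sigma_gt0 : forall n, 0 < sigma n.
Hypothesis sigmaS : forall n, sigma n = beta n + sigma n.+1.
Hypothesis sigma0 : forall e, 0 < e -> forall m, exists2 n, (m <= n)%N & sigma n <= e.
Hypothesis h1 : forall n (a : T n) (a' : T n.+1),
    val a' = val a -> (Ln a' <= Ln a)%E.
Hypothesis h2 : forall n (a : T n.+1), (Ln a <= 1)%E ->
    exists2 b : T n, (Ln b <= 1)%E & cnorm (val a - val b) < beta n.
Implicit Types (a b : A) (K : R) (n m : nat).

Definition approximable n K a :=
  exists x : T n, (Ln x <= K%:E)%E /\ cnorm (a - val x) <= K * sigma n.

Lemma approximable_mono n K K' a : K <= K' -> approximable n K a -> approximable n K' a.
Proof.
move=> KK [x [xK ax]]; exists x; split.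
  by apply: le_trans xK _; rewrite lee_fin.
by apply: le_trans ax _; apply: ler_wpM2r => //; exact: ltW.
Qed.

(** Normalize the approximant to Lipschitz value 1, apply hypothesis (2), scale back: the error
    grows by K beta(n), which is exactly K sigma(n) - K sigma(n+1). *)
Lemma approximable_pred n K a : 0 < K -> approximable n.+1 K a -> approximable n K a.
Proof.
move=> K0 [x [xK ax]]; have Kn0 : K != 0 by rewrite gt_eqF.
have [|y y1 xy] := h2 (a := (K^-1)%:C *: x).
  have := lip_scale (HL n.+1) K^-1 xK.
  by rewrite ger0_norm ?mulVf// invr_ge0 ltW.
exists (K%:C *: y); split.
  by have := lip_scale (HL n) K y1; rewrite mulr1 gtr0_norm.
apply: le_trans (cnorm_triangle (val x) _ _) _; rewrite sigmaS mulrDr addrC.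
apply: lerD => //.
have -> : val x - val (K%:C *: y) = K%:C *: (val ((K^-1)%:C *: x) - val y).
  by rewrite -[val ((K^-1)%:C *: x)]/((K^-1)%:C *: val x) scalerBr scaleVr.
by rewrite cnormZr gtr0_norm// ler_pM2l// ltW.
Qed.

Lemma approximable_le m n K a : (m <= n)%N -> 0 < K ->
  approximable n K a -> approximable m K a.
Proof.
move=> mn K0; rewrite -(subnKC mn); elim: (n - m)%N => [|k IH]; first by rewrite addn0.
by rewrite addnS => /approximable_pred h; apply: IH; exact: h.
Qed.

Definition limit_lip a : \bar R :=
  ereal_inf [set K%:E | K in [set K | 0 < K /\ forall n, approximable n K a]].

Lemma limit_lip_ge0 a : (0 <= limit_lip a)%E.
Proof. by apply: le_ereal_inf_tmp => _ [K [K0 _] <-]; rewrite lee_fin ltW. Qed.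

Lemma limit_lipP a K K' n : (limit_lip a <= K%:E)%E -> K < K' -> approximable n K' a.
Proof.
move=> aK KK; have : (limit_lip a < K'%:E)%E by apply: le_lt_trans aK _; rewrite lte_fin.
by move=> /ereal_inf_lt [_ [K1 [K10 h] <-]]; rewrite lte_fin => /ltW /approximable_mono; apply.
Qed.

Lemma limit_lip_le a K : 0 <= K ->
  (forall K', K < K' -> forall m, exists2 n, (m <= n)%N & approximable n K' a) ->
  (limit_lip a <= K%:E)%E.
Proof.
move=> K0 h; apply/lee_addgt0Pr => e e0; rewrite -EFinD.
apply: ereal_inf_lbound; exists (K + e) => //; split; first by lra.
move=> m; have [|n mn] := h (K + e) _ m; first by rewrite ltrDl.
by apply: approximable_le => //; lra.
Qed.

Lemma limit_lip_K_ge0 a K : (limit_lip a <= K%:E)%E -> 0 <= K.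
Proof. by move=> /(le_trans (limit_lip_ge0 a)); rewrite lee_fin. Qed.

Lemma subalg_chain n m (x : T n) : (n <= m)%N ->
  exists2 y : T m, val y = val x & (Ln y <= Ln x)%E.
Proof.
move=> nm; rewrite -(subnKC nm); elim: (m - n)%N => [|k [y yx yL]].
  by rewrite addn0; exists x.
rewrite addnS; have yS : val y \in (An (n + k).+1 : set A).
  rewrite inE; apply: An_nondecreasing; have := valP y; by rewrite inE.
exists (Sub (val y) yS : T _) => //.
by apply: le_trans yL; apply: h1.
Qed.

(** At every level m >= n the element approximates itself with error 0, and its Lipschitz value has
    not increased. *)
Lemma limit_lip_val n (x : T n) : (limit_lip (val x) <= Ln x)%E.
Proof.
have [dx|ndx] := pselect (dom (@Ln n) x); last first.
  by move/negP: ndx; rewrite -leNgt leye_eq => /eqP ->; rewrite leey.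
have [u u0 uE] := dom_fin (lip_ge0 (HL n)) dx; rewrite uE.
apply: limit_lip_le => // K uK m; exists (maxn n m); first exact: leq_maxr.
have [y yx yL] := subalg_chain x (leq_maxl n m).
exists y; split; first by apply: le_trans yL _; rewrite uE lee_fin ltW.
by rewrite yx subrr cnorm0 mulr_ge0//; [lra | exact: ltW].
Qed.

Lemma limit_lip_sa a K : (limit_lip a <= K%:E)%E -> star a = a.
Proof.
move=> aK; have K0 := limit_lip_K_ge0 aK.
apply/eqP; rewrite -subr_eq0; apply/eqP.
apply: (@cnorm_small_eq0 _ _ (2 * (K + 1))) => e e0.
have [n _ ne] := sigma0 e0 0.
have [|x [xK ax]] := limit_lipP (K' := K + 1) n aK; first by rewrite ltrDl.
have xsa : star (val x) = val x by apply/sub_sa; exact: (lip_sa (HL n) xK).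
have := cnorm_triangle (val x) (star a) a.
rewrite -{1}xsa -starB cnorm_star (cnorm_distC (val x)) => h.
have : (K + 1) * sigma n <= (K + 1) * e by apply: ler_wpM2l => //; lra.
lra.
Qed.

Lemma limit_lip_add a b K K' : (limit_lip a <= K%:E)%E -> (limit_lip b <= K'%:E)%E ->
  (limit_lip (a + b)%R <= (K + K')%:E)%E.
Proof.
move=> aK bK; have K0 := limit_lip_K_ge0 aK; have K'0 := limit_lip_K_ge0 bK.
apply: limit_lip_le; first exact: addr_ge0.
move=> M KM m; exists m => //; pose e := (M - (K + K')) / 2.
have e0 : 0 < e by rewrite divr_gt0// subr_gt0.
have [|x [xK ax]] := limit_lipP (K' := K + e) m aK; first by rewrite ltrDl.
have [|y [yK by_]] := limit_lipP (K' := K' + e) m bK; first by rewrite ltrDl.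
have ME : M = (K + e) + (K' + e) by rewrite /e; field.
exists (x + y); split; first by rewrite ME; exact: (lip_add (HL m)).
rewrite ME [in leRHS]mulrDl; apply: le_trans (lerD ax by_).
by apply: le_trans (cnormD _ _); rewrite addrACA -opprD.
Qed.

Lemma limit_lip_scale (t : R) a K : (limit_lip a <= K%:E)%E ->
  (limit_lip (t%:C *: a)%R <= (`|t| * K)%:E)%E.
Proof.
move=> aK; have K0 := limit_lip_K_ge0 aK; have t0 := normr_ge0 t.
apply: limit_lip_le; first exact: mulr_ge0.
move=> M KM m; exists m => //; pose e := (M - `|t| * K) / (`|t| + 1).
have t1 : 0 < `|t| + 1 by lra.
have e0 : 0 < e by rewrite divr_gt0// subr_gt0.
have eE : e * (`|t| + 1) = M - `|t| * K by rewrite /e divfK// gt_eqF.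
have [|x [xK ax]] := limit_lipP (K' := K + e) m aK; first by rewrite ltrDl.
apply: (@approximable_mono m (`|t| * (K + e))); first by nra.
exists (t%:C *: x); split; first exact: (lip_scale (HL m)).
have -> : t%:C *: a - val (t%:C *: x) = t%:C *: (a - val x) by rewrite scalerBr.
by rewrite cnormZr -mulrA; apply: ler_wpM2l.
Qed.

Lemma leibniz_bound_continuous K M N K' e :
  0 <= K -> 0 <= M -> 0 <= N -> 0 <= K' -> 0 < e ->
  exists2 d, 0 < d & leibniz_bound A0 B0 (K + d) (M + d) (N + d) (K' + d) <=
    leibniz_bound A0 B0 K M N K' + e.
Proof.
move=> K0 M0 N0 K'0 e0.
have A00 : 0 <= A0 by exact: le_trans hA0.
(* The increment of the bound is d times an expression affine in d, and G is that expression at d =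
   1. *)
pose G := A0 * (K + N + M + K' + 2) + B0 * (K + K' + 1).
have G0 : 0 <= G by rewrite addr_ge0// mulr_ge0//; lra.
have G1 : 0 < G + 1 by lra.
exists (Num.min 1 (e / (G + 1))); first by rewrite lt_min ltr01 divr_gt0.
set d := Num.min _ _.
have d0 : 0 <= d by rewrite le_min ler01 divr_ge0// ltW.
have d1 : d <= 1 by rewrite ge_min lexx.
have dG : d * G <= e.
  apply: (@le_trans _ _ (d * (G + 1))); first by apply: ler_wpM2l => //; lra.
  by rewrite -ler_pdivlMr// ge_min lexx orbT.
apply: (@le_trans _ _ (leibniz_bound A0 B0 K M N K' + d * G)); last by rewrite lerD2l.
have -> : leibniz_bound A0 B0 (K + d) (M + d) (N + d) (K' + d) =
  leibniz_bound A0 B0 K M N K' + d * (A0 * (K + N + M + K' + 2 * d) + B0 * (K + K' + d)).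
  by rewrite /leibniz_bound; ring.
rewrite lerD2l; apply: ler_wpM2l => //.
by apply: lerD; apply: ler_wpM2l => //; lra.
Qed.

Lemma sigma_small K e m : 0 <= K -> 0 < e -> exists2 n, (m <= n)%N & K * sigma n <= e.
Proof.
move=> K0 e0; have K1 : 0 < K + 1 by lra.
have [n mn ns] := sigma0 (divr_gt0 e0 K1) m; exists n => //.
apply: (@le_trans _ _ ((K + 1) * sigma n)).
  by apply: ler_wpM2r; [exact: ltW|lra].
by rewrite mulrC -ler_pdivlMr.
Qed.

(** The product of late approximants approximates the product, and their norms exceed those of [a]
    and [b] by at most d. The error has the shape of a Leibniz bound with constants 1 and 0 times
    sigma(n), so A0 >= 1 and B0 >= 0 bring it under the allowed error. *)
Lemma limit_lip_jl i a b K K' : (limit_lip a <= K%:E)%E -> (limit_lip b <= K'%:E)%E ->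
  (limit_lip (jlprod i a b) <= (leibniz_bound A0 B0 K (cnorm a) (cnorm b) K')%:E)%E.
Proof.
move=> aK bK; have K0 := limit_lip_K_ge0 aK; have K'0 := limit_lip_K_ge0 bK.
have A00 : 0 <= A0 by exact: le_trans hA0.
have a0 := cnorm_ge0 a; have b0 := cnorm_ge0 b.
apply: limit_lip_le.
  by rewrite /leibniz_bound addr_ge0 ?mulr_ge0 ?addr_ge0 ?mulr_ge0.
move=> M KM m.
have e0 : 0 < M - leibniz_bound A0 B0 K (cnorm a) (cnorm b) K' by rewrite subr_gt0.
have [d d0 dM] := leibniz_bound_continuous K0 a0 b0 K'0 e0.
rewrite [X in _ <= X]addrC subrK in dM.
have KK : 0 <= (K + d) + (K' + d) by lra.
have [n mn nd] := sigma_small m KK d0; exists n => //.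
have s0 := sigma_gt0 n.
have [|x [xK ax]] := limit_lipP (K' := K + d) n aK; first by rewrite ltrDl.
have [|y [yK by_]] := limit_lipP (K' := K' + d) n bK; first by rewrite ltrDl.
have ad : (K + d) * sigma n <= d.
  apply: le_trans nd; apply: ler_wpM2r; lra.
have bd : (K' + d) * sigma n <= d.
  apply: le_trans nd; apply: ler_wpM2r; lra.
have xn : cnorm x <= cnorm a + d.
  rewrite -cnorm_val; have := cnormB a (a - val x); rewrite subKr; lra.
have yn : cnorm y <= cnorm b + d.
  rewrite -cnorm_val; have := cnormB b (b - val y); rewrite subKr; lra.
exists (jlprod i x y); split.
  apply: le_trans (lip_jl (HL n) i xK yK) _; rewrite lee_fin; apply: le_trans dM.
  rewrite /leibniz_bound lerD2r; apply: ler_wpM2l => //; apply: lerD.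
    by apply: ler_wpM2l => //; lra.
  by apply: ler_wpM2r => //; lra.
rewrite val_jlprod; apply: le_trans (cnorm_jlprod_sub _ _ _ _ _) _.
apply: (@le_trans _ _
  (leibniz_bound A0 B0 (K + d) (cnorm a + d) (cnorm b + d) (K' + d) * sigma n)); last first.
  by apply: ler_wpM2r => //; exact: ltW.
have z1 : cnorm (a - val x) * cnorm b <= (K + d) * sigma n * (cnorm b + d).
  by apply: ler_pM; rewrite ?cnorm_ge0//; lra.
have z2 : cnorm (val x) * cnorm (b - val y) <= (cnorm a + d) * ((K' + d) * sigma n).
  by apply: ler_pM; rewrite ?cnorm_ge0.
apply: le_trans (lerD z1 z2) _.
have -> : (K + d) * sigma n * (cnorm b + d) + (cnorm a + d) * ((K' + d) * sigma n) =
   ((K + d) * (cnorm b + d) + (cnorm a + d) * (K' + d)) * sigma n by ring.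
apply: ler_wpM2r; first exact: ltW.
have w0 : 0 <= (K + d) * (cnorm b + d) + (cnorm a + d) * (K' + d).
  by rewrite addr_ge0 ?mulr_ge0//; lra.
rewrite /leibniz_bound -[leLHS]addr0; apply: lerD; first by rewrite ler_peMl.
by rewrite !mulr_ge0//; lra.
Qed.

Lemma limit_lip_one (t : R) : limit_lip (t%:C *: 1) = 0%E.
Proof.
apply/eqP; rewrite eq_le limit_lip_ge0 andbT.
by have := limit_lip_val (t%:C *: 1 : T 0); rewrite (lip_one (HL 0)).
Qed.

(** Level 0 already decides. With K arbitrarily small, [a] is a limit of elements of A_0 of
    arbitrarily small L_0-value, so it lies in A_0, and closedness of the unit ball of L_0 gives
    L_0(a) = 0. *)
Lemma limit_lip_ker a : limit_lip a = 0%E -> exists t : R, a = t%:C *: 1.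
Proof.
move=> a0.
have s0 := sigma_gt0 0; have s1 : 0 < sigma 0 + 1 by lra.
have app K e : 0 < K -> 0 < e -> exists x : T 0, (Ln x <= K%:E)%E /\ cnorm (a - val x) < e.
  move=> K0 e0; pose K' := Num.min K (e / (sigma 0 + 1)).
  have K'0 : 0 < K' by rewrite lt_min K0 divr_gt0.
  have [|x [xK ax]] := limit_lipP (K := 0) (K' := K') (a := a) 0 _ K'0; first by rewrite a0.
  exists x; split; first by apply: le_trans xK _; rewrite lee_fin ge_min lexx.
  have : K' * (sigma 0 + 1) <= e by rewrite -ler_pdivlMr// ge_min lexx orbT.
  lra.
have aS : a \in (An 0 : set A).
  rewrite inE; apply: ((closed_cnormP _).1 (@subalg_top_closed _ _ (An 0))) => e e0.
  have [x [_ ax]] := app 1 e ltr01 e0.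
  by exists (val x) => //; have := valP x; rewrite inE.
pose a' : T 0 := Sub a aS.
have : Ln a' = 0%E.
  apply/eqP; rewrite eq_le (lip_ge0 (HL 0)) andbT; apply/lee_addgt0Pr => e e0.
  rewrite add0e.
  have : (Ln ((e^-1)%:C *: a') <= 1)%E.
    apply: (lip_closed (HL 0)) => d d0.
    have [x [xe ax]] := app e _ e0 (mulr_gt0 e0 d0).
    exists ((e^-1)%:C *: x).
      have := lip_scale (HL 0) e^-1 xe.
      by rewrite ger0_norm ?mulVf ?gt_eqF// invr_ge0 ltW.
    rewrite -scalerBr cnormZr ger0_norm; last by rewrite invr_ge0 ltW.
    by rewrite ltr_pdivrMl.
  move=> /(lip_scale (HL 0) e); rewrite scaleVr ?gt_eqF// mulr1 gtr0_norm//.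
move=> /(lip_ker (HL 0)) [t at_]; exists t.
exact: (congr1 val at_).
Qed.

Lemma limit_lip_closed a :
  (forall e, 0 < e -> exists2 b, (limit_lip b <= 1)%E & cnorm (a - b) < e) ->
  (limit_lip a <= 1)%E.
Proof.
move=> h; apply: limit_lip_le => // K K1 m; exists m => //.
pose e := (K - 1) / 2.
have e0 : 0 < e by rewrite divr_gt0// subr_gt0.
(* At a fixed level m the tolerance is proportional to sigma(m), so an approximant of b serves [a]
   with the constant 1 + 2e = K. *)
have [b b1 ab] := h _ (mulr_gt0 e0 (sigma_gt0 m)).
have [|x [xK bx]] := limit_lipP (K' := 1 + e) m b1; first by rewrite ltrDl.
have KE : K = e + (1 + e) by rewrite /e; field.
exists x; split; first by apply: le_trans xK _; rewrite lee_fin; lra.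
apply: le_trans (cnorm_triangle b _ _) _; rewrite KE [leRHS]mulrDl.
by apply: lerD => //; exact: ltW.
Qed.

Lemma cnorm_rpart_le a : cnorm (rpart a) <= cnorm a.
Proof.
rewrite /rpart cnormZr; have h0 : 0 <= 2^-1 :> R by lra.
rewrite ger0_norm//; have := cnormD a (star a); rewrite cnorm_star; lra.
Qed.

Lemma limit_lip_dense a e : star a = a -> 0 < e ->
  exists b K, [/\ 0 < K, (limit_lip b <= K%:E)%E & cnorm (a - b) < e].
Proof.
move=> asa e0; have e2 : 0 < e / 2 by rewrite divr_gt0.
have : closure (\bigcup_n (An n : set A)) a by rewrite An_dense.
move=> /closure_cnormP /(_ _ e2) [y [n _ yS] ay].
have yS' : y \in (An n : set A) by rewrite inE.
pose y' : T n := Sub y yS'.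
have [x [K [K0 xK yx]]] := lip_dense (HL n) (star_rpart y') e2.
exists (val x), K; split=> //.
  by apply: le_trans xK; exact: limit_lip_val.
have e1 : cnorm (a - rpart y) <= cnorm (a - y).
  rewrite -{1}(rpart_sa asa).
  have -> : rpart a - rpart y = rpart (a - y).
    by rewrite /rpart starB -scalerBr opprD addrACA.
  exact: cnorm_rpart_le.
have e3 : cnorm (rpart y - val x) < e / 2 by exact: yx.
have := cnorm_triangle (rpart y) a (val x); lra.
Qed.

Lemma limit_lip_weak_continuous : mk_weak_continuous limit_lip.
Proof.
move=> phi e e0; have e8 : 0 < e / 8 by rewrite divr_gt0.
have [n _ ns] := sigma0 e8 0.
have [phi' phi'E] := state_restriction (An n) phi.
have e4 : 0 < e / 4 by rewrite divr_gt0.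
have [l [d [d0 lsa ld]]] := lip_mk (HL n) phi' e4.
exists [seq val h | h <- l], d; split=> //.
  by move=> _ /mapP [h hl ->]; apply/sub_sa; exact: lsa.
move=> psi near a a1; have [psi' psi'E] := state_restriction (An n) psi.
have near' : weak_near phi' l d psi'.
  by move=> h hl; rewrite phi'E psi'E; apply: near; exact: map_f.
(* With constant 2, x lies within e/4 of [a], costing at most e/2 on two states; x/2 is in the unit
   ball of L_n, and continuity there with tolerance e/4 costs the other e/2. *)
have [|x [xK ax]] := limit_lipP (K' := 2) n a1; first by rewrite ltr1n.
have asa := limit_lip_sa a1.
have xsa : star (val x) = val x by apply/sub_sa; exact: (lip_sa (HL n) xK).
pose x' : T n := (2^-1 : R)%:C *: x.
have x'1 : (Ln x' <= 1)%E.
  have := lip_scale (HL n) 2^-1 xK; rewrite ger0_norm ?invr_ge0//.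
  by rewrite mulVf// pnatr_eq0.
have := ld psi' near' x' x'1; rewrite phi'E psi'E.
have xE (chi : state A) : rstate chi (val x') = 2^-1 * rstate chi (val x).
  exact: (rstateZ chi).
rewrite !xE => h.
have axsa : star (a - val x) = a - val x by rewrite starB asa xsa.
have := rstate_dist_le phi psi axsa; rewrite !rstateB.
move: h; rewrite !ler_norml; lra.
Qed.

Lemma limit_lip_axioms : lip_axioms A0 B0 limit_lip.
Proof.
split.
- exact: limit_lip_ge0.
- exact: limit_lip_sa.
- exact: limit_lip_add.
- exact: limit_lip_scale.
- exact: limit_lip_jl.
- exact: limit_lip_one.
- exact: limit_lip_ker.
- exact: limit_lip_closed.
- exact: limit_lip_dense.
- exact: limit_lip_weak_continuous.
Qed.

(** Since x = a (1 - b (a - x)), a Neumann series inverts the second factor, and y = z b for its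
    inverse z. *)
Lemma nearby_inverse a b x : a * b = 1 -> b * a = 1 ->
  cnorm (a - x) * cnorm b < 1 ->
  exists y, [/\ x * y = 1, y * x = 1 & b - y = y * (x - a) * b].
Proof.
move=> ab ba small.
have [|z [zr rz]] := @neumann_series _ _ (b * (a - x)).
  by apply: le_lt_trans small; rewrite mulrC; exact: cnormM.
have bx : b * x = 1 - b * (a - x) by rewrite mulrBr ba subKr.
have xa : x = a * (1 - b * (a - x)) by rewrite -bx mulrA ab mul1r.
exists (z * b); split.
- by rewrite {1}xa -mulrA (mulrA _ z) rz mul1r.
- by rewrite -mulrA bx.
- by rewrite mulrBr mulrBl -(mulrA z b x) bx zr mul1r -!mulrA ab mulr1.
Qed.

Lemma square_bound_continuous N K e : 0 <= N -> 0 <= K -> 0 < e ->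
  exists2 d, 0 < d & C * (N + d) ^+ 2 * (K + d) <= C * N ^+ 2 * K + e.
Proof.
move=> N0 K0 e0; have C0 : 0 <= C by exact: le_trans hC.
pose G := C * ((N + 1) ^+ 2 + (2 * N + 1) * K).
have G0 : 0 <= G by rewrite mulr_ge0// addr_ge0 ?sqr_ge0// mulr_ge0//; lra.
have G1 : 0 < G + 1 by lra.
exists (Num.min 1 (e / (G + 1))); first by rewrite lt_min ltr01 divr_gt0.
set d := Num.min _ _.
have d0 : 0 <= d by rewrite le_min ler01 divr_ge0// ltW.
have d1 : d <= 1 by rewrite ge_min lexx.
have dG : d * G <= e.
  apply: (@le_trans _ _ (d * (G + 1))); first by apply: ler_wpM2l => //; lra.
  by rewrite -ler_pdivlMr// ge_min lexx orbT.
apply: (@le_trans _ _ (C * N ^+ 2 * K + d * G)); last by rewrite lerD2l.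
have -> : C * (N + d) ^+ 2 * (K + d) =
   C * N ^+ 2 * K + d * (C * ((N + d) ^+ 2 + (2 * N + d) * K)) by ring.
rewrite lerD2l; apply: ler_wpM2l => //; apply: ler_wpM2l => //.
apply: lerD; last by apply: ler_wpM2r => //; lra.
by rewrite lerXn2r// ?nnegrE; lra.
Qed.

(** The inverse y of a late approximant x lies in A_n and is bounded there by the strong Leibniz
    property of L_n. Its distance to b is at most ||y|| ||x - a|| ||b||, which, as C >= 1, fits
    within the same bound times sigma(n). *)
Lemma limit_lip_strongly_leibniz : strongly_leibniz C limit_lip.
Proof.
have C0 : 0 <= C by exact: le_trans hC.
apply/(strongly_leibnizP C0 limit_lip_ge0) => a b K aK ab ba.
have K0 := limit_lip_K_ge0 aK; set N := cnorm b; have N0 : 0 <= N := cnorm_ge0 b.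
apply: limit_lip_le; first by rewrite !mulr_ge0 ?sqr_ge0.
move=> M KM m.
have e0 : 0 < M - C * N ^+ 2 * K by rewrite subr_gt0.
have [d d0 dM] := square_bound_continuous N0 K0 e0.
rewrite [X in _ <= X]addrC subrK in dM.
have Nd : 0 < (N + d) * (N + 1) + 1.
  by rewrite ltr_wpDl// mulr_ge0//; lra.
have Kd : 0 <= K + d by lra.
(* Chosen so that q N < 1, which makes x invertible, and q N (N + d) <= d, which gives ||y|| <= N +
   d. *)
pose q := Num.min d 1 / ((N + d) * (N + 1) + 1).
have q0 : 0 < q by rewrite divr_gt0// lt_min d0 ltr01.
have qE : q * ((N + d) * (N + 1) + 1) = Num.min d 1 by rewrite /q divfK// gt_eqF.
have [n mn ns] := sigma_small m Kd q0; exists n => //.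
have s0 := sigma_gt0 n.
have [|x [xK ax]] := limit_lipP (K' := K + d) n aK; first by rewrite ltrDl.
have axq : cnorm (a - val x) <= q by exact: le_trans ax ns.
have an0 := cnorm_ge0 (a - val x).
have md : Num.min d 1 <= d by rewrite ge_min lexx.
have m1 : Num.min d 1 <= 1 by rewrite ge_min lexx orbT.
have qN : q * (N * (N + d)) <= d by nra.
have qN1 : q * N < 1 by nra.
have small : cnorm (a - val x) * cnorm b < 1.
  by apply: le_lt_trans qN1; apply: ler_wpM2r.
have [y [xy yx by_]] := nearby_inverse ab ba small.
have xsa : star x = x := lip_sa (HL n) xK.
have [y' [y'y xy' y'x]] := sub_inverse xsa xy yx.
have yN : cnorm y <= N + d.
  have h : cnorm y <= N + cnorm y * (q * N).
    have := cnormB b (b - y); rewrite subKr by_ => /le_trans; apply; rewrite lerD2l.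
    apply: le_trans (cnormM _ _) _; rewrite mulrA; apply: ler_wpM2r => //.
    apply: le_trans (cnormM _ _) _; apply: ler_wpM2l; first exact: cnorm_ge0.
    by rewrite cnorm_distC.
  (* From ||y|| (1 - q N) <= N, a norm above N + d would contradict q N (N + d) <= d. *)
  rewrite leNgt; apply/negP => hY; nra.
exists y'; split.
  apply: le_trans ((strongly_leibnizP C0 (lip_ge0 (HL n))).1 (@SL n) _ _ _ xK xy' y'x) _.
  rewrite lee_fin; apply: le_trans dM; apply: ler_wpM2r => //; apply: ler_wpM2l => //.
  by rewrite -cnorm_val y'y lerXn2r// nnegrE ?cnorm_ge0//; lra.
rewrite y'y by_; apply: (@le_trans _ _ (C * (N + d) ^+ 2 * (K + d) * sigma n)); last first.
  by apply: ler_wpM2r => //; exact: ltW.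
have z : cnorm (y * (val x - a) * b) <= (N + d) * ((K + d) * sigma n) * (N + d).
  apply: le_trans (cnormM _ _) _; apply: ler_pM; rewrite ?cnorm_ge0//;
    last by rewrite lerDl ltW.
  apply: le_trans (cnormM _ _) _; apply: ler_pM; rewrite ?cnorm_ge0//.
  by rewrite cnorm_distC.
apply: le_trans z _.
have -> : C * (N + d) ^+ 2 * (K + d) * sigma n =
   C * ((N + d) * ((K + d) * sigma n) * (N + d)) by ring.
by rewrite ler_peMl// !mulr_ge0//; lra.
Qed.

Lemma limit_lip_propinquity n :
  (propinquity_SL A0 B0 C (@Ln n) limit_lip <= (2 * sigma n)%:E)%E.
Proof.
apply: (bridge_propinquity hA0 hB0 hC (HL n) limit_lip_axioms (sigma_gt0 n) (@SL n)
  limit_lip_strongly_leibniz) => [x|b K K' bK KK]; first exact: limit_lip_val.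
have [x [xK bx]] := limit_lipP n bK KK.
by exists x => //; rewrite cnorm_distC.
Qed.

End LimitSeminorm.

(** * Tails of the summable sequence and the conclusion *)

Section Tails.
Variables (R : realType) (beta : nat -> R).
Hypothesis beta_gt0 : forall j, 0 < beta j.
Hypothesis beta_summable : cvgn (series beta).

Definition tail n : R := limn (series beta) - series beta n.

Lemma tailS n : tail n = beta n + tail n.+1.
Proof. by rewrite /tail seriesSr; ring. Qed.

Lemma series_nd : {homo series beta : n m / (n <= m)%N >-> n <= m}.
Proof.
by apply/nondecreasing_seqP => n; rewrite seriesSr lerDl ltW.
Qed.

Lemma tail_gt0 n : 0 < tail n.
Proof.
rewrite tailS ltr_pwDl// /tail subr_ge0.
exact: (nondecreasing_cvgn_le series_nd beta_summable).
Qed.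

Lemma tail_cvg0 : tail n @[n --> \oo] --> 0.
Proof.
rewrite -(subrr (limn (series beta))).
by apply: cvgB => //; exact: cvg_cst.
Qed.

Lemma tail_small e : 0 < e -> forall m, exists2 n, (m <= n)%N & tail n <= e.
Proof.
move=> e0 m; have [N _ hN] : \forall n \near \oo, `|0 - tail n| < e.
  by move/cvgrPdist_lt: tail_cvg0 => /(_ _ e0).
exists (maxn m N); first exact: leq_maxl.
have := hN (maxn m N) (leq_maxr _ _); rewrite sub0r normrN => /ltW.
by apply: le_trans; exact: ler_norm.
Qed.

Lemma eseries_tail n : (\sum_(n <= j <oo) (beta j)%:E)%E = (tail n)%:E.
Proof.
apply: cvg_lim => //.
have : (series beta m - series beta n)%:E @[m --> \oo] --> (tail n)%:E.
  by apply: cvg_EFin; [exact: nearW | apply: cvgB => //; exact: cvg_cst].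
apply: cvg_trans; apply: near_eq_cvg; exists n => // m /= nm.
by rewrite sumEFin sub_series_geq.
Qed.

End Tails.

Theorem theorem3p1 (R : realType) (A0 B0 C : R)
  (hA0 : 1 <= A0) (hB0 : 0 <= B0) (hC : 1 <= C)
  (A : cstarAlgType R) (An : nat -> cstarSubalg A)
  (An_nondecreasing : forall n, An n `<=` An n.+1)
  (An_dense : closure (\bigcup_n (An n : set A)) = setT)
  (Ln : forall n, subalg_type (An n) -> \bar R)
  (Ln_qcms : forall n, Lseminorm A0 B0 (@Ln n))
  (Ln_leibniz : forall n, strongly_leibniz C (@Ln n))
  (beta : nat -> R) (beta_gt0 : forall j, 0 < beta j)
  (beta_summable : cvgn (series beta))
  (h1 : forall n (a : subalg_type (An n)) (a' : subalg_type (An n.+1)),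
    val a' = val a -> (Ln n.+1 a' <= Ln n a)%E)
  (h2 : forall n (a : subalg_type (An n.+1)), (Ln n.+1 a <= 1)%E ->
    exists2 b : subalg_type (An n),
      (Ln n b <= 1)%E & cnorm (val a - val b) < beta n) :
  exists L : A -> \bar R,
    [/\ strongly_leibniz C L,
        Lseminorm A0 B0 L,
        forall n : nat,
          (propinquity_SL A0 B0 C (@Ln n) L <=
             4%:E * \sum_(n <= j <oo) (beta j)%:E)%E
      & propinquity_SL A0 B0 C (@Ln n) L @[n --> \oo] --> 0%E].
Proof.
have H n : lip_axioms A0 B0 (@Ln n) by exact: lip_of_Lseminorm.
have s0 := tail_gt0 beta_gt0 beta_summable.
have sS := tailS beta.
have ssm := tail_small beta_summable.
have bound n : (propinquity_SL A0 B0 C (@Ln n) (limit_lip Ln (tail beta))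
    <= (2 * tail beta n)%:E)%E.
  exact: (limit_lip_propinquity hA0 hB0 hC An_nondecreasing An_dense H Ln_leibniz
    s0 sS ssm h1 h2).
exists (limit_lip Ln (tail beta)); split.
- exact: (limit_lip_strongly_leibniz hC H Ln_leibniz s0 sS ssm h2).
- apply: Lseminorm_of_lip.
  exact: (limit_lip_axioms hA0 hB0 An_nondecreasing An_dense H s0 sS ssm h1 h2).
- move=> n; apply: le_trans (bound n) _.
  rewrite eseries_tail// -EFinM lee_fin; have := s0 n; lra.
(* The distance is squeezed between 0 and twice the tail, the lower bound because every extent is
   nonnegative. *)
- apply: (@squeeze_cvge _ _ _ _ (fun=> 0%E) _ (fun n => (2 * tail beta n)%:E)).
  + by apply: nearW => n; rewrite propinquity_ge0 bound.
  + exact: cvg_cst.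
  + have -> : 0%E = (2 * 0)%:E :> \bar R by rewrite mulr0.
    by apply: cvg_EFin; [exact: nearW | apply: cvgMr; exact: tail_cvg0].
Qed.
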